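(* Let $G \in \{\mathbb{Z}^2_{8}, \mathbb{Z}\boxtimes\mathbb{Z}\}$ (as defined in the context). There exists $C_0>0$ such that for all $C > C_0$ we have $q(G, Ct^{6/7}) = q(G,\infty)$, where $Ct^{6/7}$ denotes the spreading function $g(t)=Ct^{6/7}$.
   Context: Graphs: $\mathbb{Z}\boxtimes\mathbb{Z}$ has vertex set $\mathbb{Z}^2$, with $(x,y)$ adjacent to $(x',y')$ iff $\max(|x-x'|,|y-y'|)=1$. $\mathbb{Z}^2_{8}$ (the ''eighth plane'') is the subgraph of $\mathbb{Z}\boxtimes\mathbb{Z}$ on vertex set $\{(x,y): 0\le x\le y\}$ with edge set $\{((x,y),(x+i,y+1)) : 0\le x\le y,\ i\in\{0,1\}\}$. The containment game $(G,q,g)$, for a real $q>0$ and a spreading function $g:\mathbb{N}\to\mathbb{N}\cup\{\infty\}$, is a full-information two-player game between Container and Spreader on an infinite graph $G$. It starts from a finite set $\mathcal{B}_0$ of occupied vertices. At turn $t=1,2,\dots$, first Container deletes from the current graph at most $\lfloor tq\rfloor-\lfloor (t-1)q\rfloor$ non-occupied vertices; then Spreader chooses $g(t)$ vertices (when $g=\infty$, any number of vertices) of the remaining graph at distance at most one from $\mathcal{B}_{t-1}$ and adds them to form $\mathcal{B}_t$. Container wins if after some time no new vertices become occupied; otherwise Spreader wins. For $g=\infty$ this is the Firefighter Problem. Define $q(G,g)$ as the set of $q>0$ such that Container wins $(G,q,g)$ for every finite initial set $\mathcal{B}_0$. *)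

(* Defs.v *)
From Stdlib Require Import Reals Lra ZArith List.
Import ListNotations.
Open Scope R_scope.

Inductive Graph := Eighth | King.

Definition vtx : Type := (Z * Z)%type.
Definition vset : Type := vtx -> Prop.

Definition inV (G : Graph) (v : vtx) : Prop :=
  match G with
  | King => True
  | Eighth => (0 <= fst v <= snd v)%Z
  end.

Definition adj (G : Graph) (u v : vtx) : Prop :=
  match G with
  | King => Z.max (Z.abs (fst u - fst v)) (Z.abs (snd u - snd v)) = 1%Z
  | Eighth => inV Eighth u /\ inV Eighth v /\
      ((snd v = snd u + 1 /\ (fst v = fst u \/ fst v = fst u + 1)) \/
       (snd u = snd v + 1 /\ (fst u = fst v \/ fst u = fst v + 1)))%Z
  end.

Definition card_le (S : vset) (k : nat) : Prop :=
  exists l : list vtx, (length l <= k)%nat /\ forall x, S x -> In x l.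

Definition finite_set (S : vset) : Prop :=
  exists l : list vtx, forall x, S x -> In x l.

(** spreading function N -> N ∪ {∞}; None = ∞ *)
Definition spreading : Type := nat -> option nat.

Definition budget (q : R) (t : nat) : nat :=
  Z.to_nat (Int_part (INR t * q) - Int_part (INR (t - 1) * q)).

(** A Container strategy: given the turn t and the history B_0..B_{t-1}
    (full information; the own past deletions are determined by it),
    the set of vertices deleted at turn t. *)
Definition cstrategy : Type := nat -> list vset -> vset.

Definition hist (B : nat -> vset) (t : nat) : list vset := map B (seq 0 t).

Definition deleted (sigma : cstrategy) (B : nat -> vset) (t : nat) : vset :=
  fun v => exists s, (1 <= s <= t)%nat /\ sigma s (hist B s) v.

Definition container_legal (G : Graph) (q : R) (sigma : cstrategy)
    (B : nat -> vset) (t : nat) : Prop :=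
  let X := sigma t (hist B t) in
  card_le X (budget q t) /\
  forall v, X v -> inV G v /\ ~ deleted sigma B (t - 1) v /\ ~ B (t - 1)%nat v.

Definition spreader_legal (G : Graph) (g : spreading) (sigma : cstrategy)
    (B : nat -> vset) (t : nat) : Prop :=
  (forall v, B (t - 1)%nat v -> B t v) /\
  (forall v, B t v -> B (t - 1)%nat v \/
      (inV G v /\ ~ deleted sigma B t v /\ exists u, B (t - 1)%nat u /\ adj G u v)) /\
  match g t with
  | Some k => card_le (fun v => B t v /\ ~ B (t - 1)%nat v) k
  | None => True
  end.

Definition container_wins_from (G : Graph) (q : R) (g : spreading) (B0 : vset) : Prop :=
  exists sigma : cstrategy,
    forall B : nat -> vset,
      (forall v, B 0%nat v <-> B0 v) ->
      (forall t, (1 <= t)%nat -> spreader_legal G g sigma B t) ->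
      (forall t, (1 <= t)%nat -> container_legal G q sigma B t) /\
      exists T : nat, forall t, (T <= t)%nat -> forall v, B t v -> B T v.

Definition in_qset (G : Graph) (g : spreading) (q : R) : Prop :=
  0 < q /\
  forall B0 : vset, finite_set B0 -> (forall v, B0 v -> inV G v) ->
    container_wins_from G q g B0.

Definition g_infty : spreading := fun _ => None.

Definition g_pow (C : R) : spreading :=
  fun t => Some (Z.to_nat (Int_part (C * Rpower (INR t) (6 / 7)))).

(* Main.v *)
Require Import Defs.
From Stdlib Require Import Reals Lra ZArith List Lia.
From Stdlib Require Import Classical ClassicalEpsilon Permutation.
From Stdlib Require Import FunctionalExtensionality PropExtensionality.
Import ListNotations.
Open Scope Z_scope.

(* If [q] is greater than 1 (eighth plane) or 3 (strong grid), then Container wins even against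
   [g = infinity], by deleting a distant barrier in the order in which the fire could arrive at it.
   Otherwise Container deletes at most 1 (or 3) vertices per turn, and Spreader wins with
   [C t^(6/7)] new vertices per turn, as follows.

   The fire advances by one row per turn on a front (on four fronts, the sides of a growing box, in
   the strong grid). A front carries a number [beta] such that, whatever Container does, the front
   does not become smaller than [beta] plus its free growth minus the number of deleted cells that
   it has passed. The sum of these numbers exceeds the number of deleted cells that have not been
   passed yet, so that the front survives (at most one of the four is dead at any time, and it
   revives as soon as a neighbour reaches its corner).

   What remains is to keep the fronts sparse without decreasing [beta]. Let [w] be about
   [t^(1/7)]. In regions that no deleted cell disturbs during the next [12 w^2] rows, it is enough
   to keep cells at distance about [w], [O(t/w) = O(w^6)] in total: the gaps close before
   Container can exploit them. Around the ends of the intervals of cells that the front will reach,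
   everything within distance [O(w^2)] is kept. If there are [O(w^4)] such ends in the next
   [O(w^2)] rows, this is again [O(w^6)] cells. If there are more, then the front will gain more
   than [w^4] cells over [beta], while thinning it out everywhere loses only [O(w^4)] cells. *)

(** * Cardinality of predicates *)

(** The exponent balances as follows. Cells at distance w leave gaps that w rows close, except that
    the O(w) deletions of that time shade O(w) cells each. So O(w^2) cells may be missing, and as
    gaps close at a constant rate, O(w^2) rows are needed. During these the O(w^2) deletions shade
    O(w^2) cells each: this is the loss of w^4 that a front with more than w^4 ends can afford.
    Keeping w^2 cells around each of w^4 ends costs w^6, which is t/w for t = w^7. The thresholds 1
    and 3 come from the growth of the fronts. In the eighth plane the front gains one cell per turn.
    In the strong grid a side gains two, one of which is used up by the term for its extent, so that
    three live sides match three deletions. A pruned front has to be compared with the full one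
    under all future moves of Container. This is why [Good] quantifies over all sets of future
    deletions within the budget, and why pruning is justified by translating such sets and not by
    following strategies. *)

Definition Fin {A : Type} (P : A -> Prop) : Prop := exists l, forall x, P x -> In x l.

(* A junk value when [P] is infinite. *)
Definition card {A : Type} (P : A -> Prop) : Z :=
  epsilon (inhabits 0) (fun n => exists l, NoDup l /\ (forall x, In x l <-> P x) /\
    Z.of_nat (length l) = n).

Definition eqd {A : Type} (x y : A) : {x = y} + {x <> y} :=
  excluded_middle_informative (x = y).

Definition decb (P : Prop) : bool := if excluded_middle_informative P then true else false.

Lemma decb_true P : decb P = true <-> P.
Proof. unfold decb. destruct excluded_middle_informative; split; auto; discriminate. Qed.

Lemma Fin_list {A} (P : A -> Prop) : Fin P -> exists l, NoDup l /\ forall x, In x l <-> P x.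
Proof.
  intros [l Hl]. exists (nodup eqd (filter (fun x => decb (P x)) l)). split.
  - apply NoDup_nodup.
  - intros x. rewrite nodup_In, filter_In, decb_true. intuition.
Qed.

Lemma card_eq {A} (P : A -> Prop) l :
  NoDup l -> (forall x, In x l <-> P x) -> card P = Z.of_nat (length l).
Proof.
  intros Hn Hl. unfold card.
  match goal with |- epsilon ?i ?Q = _ => assert (H : Q (epsilon i Q)) end.
  { apply epsilon_spec. exists (Z.of_nat (length l)), l. auto. }
  destruct H as (l' & Hn' & Hl' & <-). f_equal. apply Permutation_length.
  apply NoDup_Permutation; auto. intros x. rewrite Hl, Hl'. tauto.
Qed.

Lemma card_spec {A} (P : A -> Prop) : Fin P ->
  exists l, NoDup l /\ (forall x, In x l <-> P x) /\ card P = Z.of_nat (length l).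
Proof.
  intros H. destruct (Fin_list P H) as (l & H1 & H2). exists l. split; [|split]; auto.
  apply card_eq; auto.
Qed.

Lemma Fin_sub {A} (P Q : A -> Prop) : Fin Q -> (forall x, P x -> Q x) -> Fin P.
Proof. intros [l H] S. exists l. auto. Qed.

Lemma Fin_or {A} (P Q : A -> Prop) : Fin P -> Fin Q -> Fin (fun x => P x \/ Q x).
Proof. intros [l H] [m K]. exists (l ++ m). intros x. rewrite in_app_iff. intuition. Qed.

Lemma Fin_inj {A B} (f : A -> B) (P : A -> Prop) (Q : B -> Prop) : Fin Q ->
  (forall x, P x -> Q (f x)) -> (forall x y, P x -> P y -> f x = f y -> x = y) -> Fin P.
Proof.
  intros [l H] HQ Hi.
  revert P HQ Hi H. revert Q. induction l as [|b l IH]; intros Q P HQ Hi H.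
  - exists []. intros x Hx. apply (H (f x)). auto.
  - destruct (IH (fun y => Q y /\ y <> b) (fun x => P x /\ f x <> b)) as [m Hm].
    + intros x [? ?]. auto.
    + intros x y [? ?] [? ?]. auto.
    + intros y [Hy Hb]. destruct (H y Hy); [congruence|auto].
    + destruct (classic (exists x, P x /\ f x = b)) as [(x0 & H0 & E0)|N].
      * exists (x0 :: m). intros x Hx. destruct (classic (f x = b)) as [E|E].
        -- left. apply Hi; auto. congruence.
        -- right. auto.
      * exists m. intros x Hx. apply Hm. split; auto. intros E. apply N. eauto.
Qed.

Lemma Fin_empty {A} (P : A -> Prop) : (forall x, ~ P x) -> Fin P.
Proof. intros H. exists []. intros x Hx. apply (H x Hx). Qed.

Lemma Fin_interval a b : Fin (fun x => a <= x <= b).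
Proof.
  exists (map (fun k => a + Z.of_nat k) (seq 0 (Z.to_nat (b - a + 1)))).
  intros x Hx. apply in_map_iff. exists (Z.to_nat (x - a)). split; [lia|].
  apply in_seq. lia.
Qed.

Lemma Fin_prod {A B} (P : A -> Prop) (Q : B -> Prop) : Fin P -> Fin Q ->
  Fin (fun v => P (fst v) /\ Q (snd v)).
Proof.
  intros [l H] [m K]. exists (list_prod l m). intros [x y] [Hx Hy].
  apply in_prod; auto.
Qed.

Lemma card_mono {A} (P Q : A -> Prop) : Fin Q -> (forall x, P x -> Q x) -> card P <= card Q.
Proof.
  intros H S. destruct (card_spec P (Fin_sub _ _ H S)) as (l & Hl1 & Hl2 & ->).
  destruct (card_spec Q H) as (m & Hm1 & Hm2 & ->). apply inj_le.
  apply NoDup_incl_length; auto. intros x Hx. apply Hm2, S, Hl2, Hx.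
Qed.

Lemma card_ext {A} (P Q : A -> Prop) : Fin Q -> (forall x, P x <-> Q x) -> card P = card Q.
Proof.
  intros H E. apply Z.le_antisymm; apply card_mono; auto; try (intros; apply E; auto).
  apply (Fin_sub _ Q); auto. intros; apply E; auto.
Qed.

Lemma card_nonneg {A} (P : A -> Prop) : Fin P -> 0 <= card P.
Proof. intros H. destruct (card_spec P H) as (l & _ & _ & ->). lia. Qed.

Lemma card_or {A} (P Q : A -> Prop) : Fin P -> Fin Q ->
  card (fun x => P x \/ Q x) <= card P + card Q.
Proof.
  intros H K. destruct (card_spec P H) as (l & Hl1 & Hl2 & ->).
  destruct (card_spec Q K) as (m & Hm1 & Hm2 & ->).
  destruct (card_spec _ (Fin_or _ _ H K)) as (o & Ho1 & Ho2 & ->).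
  rewrite <- Nat2Z.inj_add, <- length_app. apply inj_le. apply NoDup_incl_length; auto.
  intros x Hx. apply Ho2 in Hx. rewrite in_app_iff, Hl2, Hm2. auto.
Qed.

Lemma card_disj {A} (P Q : A -> Prop) : Fin P -> Fin Q -> (forall x, P x -> Q x -> False) ->
  card (fun x => P x \/ Q x) = card P + card Q.
Proof.
  intros H K D. destruct (card_spec P H) as (l & Hl1 & Hl2 & ->).
  destruct (card_spec Q K) as (m & Hm1 & Hm2 & ->).
  rewrite <- Nat2Z.inj_add, <- length_app. apply card_eq.
  - apply NoDup_app; auto. intros x Hx Hy. apply (D x); [apply Hl2|apply Hm2]; auto.
  - intros x. rewrite in_app_iff, Hl2, Hm2. tauto.
Qed.

Lemma card_split {A} (P Q : A -> Prop) : Fin P ->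
  card P = card (fun x => P x /\ Q x) + card (fun x => P x /\ ~ Q x).
Proof.
  intros H. rewrite <- card_disj.
  - symmetry. apply card_ext; auto. intros x. destruct (classic (Q x)); tauto.
  - apply (Fin_sub _ P); tauto.
  - apply (Fin_sub _ P); tauto.
  - tauto.
Qed.

Lemma card_empty {A} (P : A -> Prop) : (forall x, ~ P x) -> card P = 0.
Proof.
  intros H. rewrite (card_eq P []); auto; [constructor|].
  intros x. split; [intros []|intros Hx; apply (H x Hx)].
Qed.

Lemma card_pos {A} (P : A -> Prop) x : Fin P -> P x -> 1 <= card P.
Proof.
  intros H Hx. destruct (card_spec P H) as (l & _ & Hl & ->).
  destruct l; simpl; [apply Hl in Hx; destruct Hx|lia].
Qed.

Lemma card_ex {A} (P : A -> Prop) : Fin P -> 1 <= card P -> exists x, P x.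
Proof.
  intros H Hc. apply NNPP. intros N. rewrite card_empty in Hc; [lia|]. intros x Hx. eauto.
Qed.

Lemma card_single {A} (a : A) (P : A -> Prop) : (forall x, P x <-> x = a) -> card P = 1.
Proof.
  intros H. rewrite (card_eq P [a]); auto.
  - constructor; [intros []|constructor].
  - intros x. rewrite H. simpl. intuition.
Qed.

Lemma card_le_inj {A B} (f : A -> B) (P : A -> Prop) (Q : B -> Prop) : Fin Q ->
  (forall x, P x -> Q (f x)) -> (forall x y, P x -> P y -> f x = f y -> x = y) ->
  card P <= card Q.
Proof.
  intros H HQ Hi. destruct (card_spec P (Fin_inj f P Q H HQ Hi)) as (l & Hl1 & Hl2 & ->).
  destruct (card_spec Q H) as (m & Hm1 & Hm2 & ->). apply inj_le.
  rewrite <- (length_map f l). apply NoDup_incl_length.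
  - assert (G : forall x, In x l -> P x) by (intros; apply Hl2; auto). clear Hl2.
    induction Hl1 as [|x l Hx Hn IH]; simpl; constructor.
    + intros Hin. apply in_map_iff in Hin as (y & E & Hy). apply Hx.
      rewrite (Hi x y); auto; apply G; simpl; auto.
    + apply IH. intros; apply G; simpl; auto.
  - intros y Hy. apply in_map_iff in Hy as (x & <- & Hx). apply Hm2, HQ, Hl2, Hx.
Qed.

Lemma card_bij {A B} (f : A -> B) (g : B -> A) (P : A -> Prop) (Q : B -> Prop) : Fin Q ->
  (forall x, P x -> Q (f x) /\ g (f x) = x) -> (forall y, Q y -> P (g y) /\ f (g y) = y) ->
  card P = card Q.
Proof.
  intros H HP HQ.
  assert (HF : Fin P).
  { apply (Fin_inj f P Q); auto.
    - intros; apply HP; auto.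
    - intros x y Hx Hy E. apply HP in Hx as [_ <-]. apply HP in Hy as [_ <-]. congruence. }
  apply Z.le_antisymm.
  - apply (card_le_inj f); auto.
    + intros; apply HP; auto.
    + intros x y Hx Hy E. apply HP in Hx as [_ <-]. apply HP in Hy as [_ <-]. congruence.
  - apply (card_le_inj g); auto.
    + intros; apply HQ; auto.
    + intros x y Hx Hy E. apply HQ in Hx as [_ <-]. apply HQ in Hy as [_ <-]. congruence.
Qed.

Lemma card_interval a b : a <= b + 1 -> card (fun x => a <= x <= b) = b - a + 1.
Proof.
  intros H. rewrite (card_eq _ (map (fun k => a + Z.of_nat k) (seq 0 (Z.to_nat (b - a + 1))))).
  - rewrite length_map, length_seq. lia.
  - apply FinFun.Injective_map_NoDup; [intros x y E; lia|apply seq_NoDup].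
  - intros x. rewrite in_map_iff. split.
    + intros (k & <- & Hk). apply in_seq in Hk. lia.
    + intros Hx. exists (Z.to_nat (x - a)). split; [lia|]. apply in_seq. lia.
Qed.

Lemma card_interval_le (P : Z -> Prop) a b : a <= b + 1 -> (forall x, P x -> a <= x <= b) ->
  card P <= b - a + 1.
Proof.
  intros H HP. rewrite <- card_interval by auto. apply card_mono; auto. apply Fin_interval.
Qed.

Lemma card_double {A B} (P : A -> Prop) (Q : B -> Prop) (R : A -> B -> Prop) m k :
  Fin P -> Fin Q -> 0 <= k ->
  (forall x, P x -> m <= card (fun y => Q y /\ R x y)) ->
  (forall y, Q y -> card (fun x => P x /\ R x y) <= k) ->
  card P * m <= k * card Q.
Proof.
  intros HP HQ Hk HR1 HR2.
  destruct (card_spec P HP) as (l & Hl1 & Hl2 & El).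
  destruct (card_spec Q HQ) as (n & Hn1 & Hn2 & En).
  assert (HF : Fin (fun v : A * B => P (fst v) /\ Q (snd v))) by (apply Fin_prod; auto).
  assert (L : forall l', NoDup l' -> incl l' l ->
    Z.of_nat (length l') * m <= card (fun v : A * B => In (fst v) l' /\ Q (snd v) /\ R (fst v) (snd v))).
  { induction l' as [|x l' IH]; intros N I.
    - simpl. apply card_nonneg. apply Fin_empty. intros v [[] _].
    - inversion N; subst.
      assert (Px : P x) by (apply Hl2, I; simpl; auto).
      specialize (HR1 x Px).
      assert (Hs : forall z, In z l' -> P z) by (intros; apply Hl2, I; simpl; auto).
      assert (F1 : Fin (fun v : A * B => In (fst v) l' /\ Q (snd v) /\ R (fst v) (snd v))).
      { apply (Fin_sub _ _ HF). intros v (? & ? & ?). auto. }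
      assert (F2 : Fin (fun v : A * B => fst v = x /\ Q (snd v) /\ R (fst v) (snd v))).
      { apply (Fin_sub _ _ HF). intros v (E & ? & ?). rewrite E. auto. }
      assert (E2 : card (fun v : A * B => fst v = x /\ Q (snd v) /\ R (fst v) (snd v))
        = card (fun y => Q y /\ R x y)).
      { apply (card_bij snd (fun y => (x, y))).
        - apply (Fin_sub _ _ HQ). tauto.
        - intros [u v] (E & ? & ?). simpl in *. subst. auto.
        - intros y (? & ?). simpl. auto. }
      assert (E3 : card (fun v : A * B => In (fst v) (x :: l') /\ Q (snd v) /\ R (fst v) (snd v))
         = card (fun v : A * B => fst v = x /\ Q (snd v) /\ R (fst v) (snd v))
         + card (fun v : A * B => In (fst v) l' /\ Q (snd v) /\ R (fst v) (snd v))).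
      { rewrite <- card_disj; auto.
        - apply card_ext; [apply Fin_or; auto|]. intros v. simpl.
          split; [intros ([?|?] & ?)|intros [(? & ?)|(? & ?)]]; subst; auto.
        - intros v (E & _) (I' & _). congruence. }
      specialize (IH H2 (fun z Hz => I z (or_intror Hz))).
      rewrite E3, E2. cbn [length]. lia. }
  assert (U : forall n', NoDup n' -> incl n' n ->
    card (fun v : A * B => P (fst v) /\ In (snd v) n' /\ R (fst v) (snd v)) <= k * Z.of_nat (length n')).
  { induction n' as [|y n' IH]; intros N I.
    - rewrite card_empty; [simpl; lia|]. intros v (_ & [] & _).
    - inversion N; subst.
      assert (Qy : Q y) by (apply Hn2, I; simpl; auto).
      specialize (HR2 y Qy).
      assert (Hs : forall z, In z n' -> Q z) by (intros; apply Hn2, I; simpl; auto).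
      assert (F1 : Fin (fun v : A * B => P (fst v) /\ In (snd v) n' /\ R (fst v) (snd v))).
      { apply (Fin_sub _ _ HF). intros v (? & ? & ?). auto. }
      assert (F2 : Fin (fun v : A * B => P (fst v) /\ snd v = y /\ R (fst v) (snd v))).
      { apply (Fin_sub _ _ HF). intros v (? & E & ?). rewrite E. auto. }
      assert (E2 : card (fun v : A * B => P (fst v) /\ snd v = y /\ R (fst v) (snd v))
        = card (fun x => P x /\ R x y)).
      { apply (card_bij fst (fun x => (x, y))).
        - apply (Fin_sub _ _ HP). tauto.
        - intros [u v] (? & E & ?). simpl in *. subst. auto.
        - intros x (? & ?). simpl. auto. }
      assert (E3 : card (fun v : A * B => P (fst v) /\ In (snd v) (y :: n') /\ R (fst v) (snd v))
         <= card (fun v : A * B => P (fst v) /\ snd v = y /\ R (fst v) (snd v))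
         + card (fun v : A * B => P (fst v) /\ In (snd v) n' /\ R (fst v) (snd v))).
      { rewrite <- card_disj; auto.
        - apply card_mono; [apply Fin_or; auto|]. intros v (? & [?|?] & ?); simpl; subst; auto.
        - intros v (_ & E & _) (_ & I' & _). congruence. }
      specialize (IH H2 (fun z Hz => I z (or_intror Hz))).
      cbn [length]. lia. }
  specialize (L l Hl1 (fun x Hx => Hx)). specialize (U n Hn1 (fun x Hx => Hx)).
  rewrite El, En.
  apply Z.le_trans with (1 := L). apply Z.le_trans with (2 := U).
  apply card_mono.
  - apply (Fin_sub _ _ HF). intros v (? & ? & ?). split; auto. apply Hn2; auto.
  - intros v (? & ? & ?). split; [apply Hl2|split; [apply Hn2|]]; auto.
Qed.

Lemma card_fiber {A B} (P : A -> Prop) (Q : B -> Prop) (R : A -> B -> Prop) k :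
  Fin P -> Fin Q -> 0 <= k ->
  (forall x, P x -> exists y, Q y /\ R x y) ->
  (forall y, Q y -> card (fun x => P x /\ R x y) <= k) ->
  card P <= k * card Q.
Proof.
  intros HP HQ Hk H1 H2. rewrite <- (Z.mul_1_r (card P)).
  apply (card_double P Q R); auto.
  intros x Hx. destruct (H1 x Hx) as (y & Hy). apply (card_pos _ y); auto.
  apply (Fin_sub _ _ HQ). tauto.
Qed.

Lemma Fin_max (P : Z -> Prop) : Fin P -> (exists x, P x) -> exists m, P m /\ forall x, P x -> x <= m.
Proof.
  intros H [x0 H0]. destruct (Fin_list P H) as (l & _ & Hl).
  assert (G : forall l : list Z, l <> [] -> exists m, In m l /\ forall x, In x l -> x <= m).
  { induction l0 as [|a l0 IH]; [congruence|]. intros _. destruct l0 as [|b l0].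
    - exists a. simpl. split; auto. intros x [->|[]]. lia.
    - destruct IH as (m & Hm & Hx); [discriminate|]. destruct (Z.le_gt_cases a m).
      + exists m. split; [right; auto|]. intros x [->|Hx']; auto.
      + exists a. split; [left; auto|]. intros x [->|Hx']; [lia|]. apply Hx in Hx'. lia. }
  destruct (G l) as (m & Hm & Hx).
  - intros ->. apply Hl in H0. destruct H0.
  - exists m. split; [apply Hl; auto|]. intros; apply Hx, Hl; auto.
Qed.

Lemma Fin_shift (P : Z -> Prop) c : Fin P -> Fin (fun x => P (x + c)).
Proof. intros H. apply (Fin_inj (fun x => x + c) _ P); auto. intros; lia. Qed.

Lemma card_shift (P : Z -> Prop) c : Fin P -> card (fun x => P (x + c)) = card P.
Proof.
  intros H. apply (card_bij (fun x => x + c) (fun x => x - c)); auto.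
  - intros; split; auto; lia.
  - intros y Hy. replace (y - c + c) with y by lia. auto.
Qed.

Lemma Fin_slice (c : Z) (P : Z -> Prop) : Fin P -> Fin (fun v : Z * Z => fst v = c /\ P (snd v)).
Proof.
  intros H. apply (Fin_inj snd _ P); auto; [tauto|].
  intros [u v] [u' v'] [E1 _] [E2 _] E3. simpl in *. congruence.
Qed.

Lemma card_slice (c : Z) (P : Z -> Prop) : Fin P ->
  card (fun v : Z * Z => fst v = c /\ P (snd v)) = card P.
Proof.
  intros H. apply (card_bij snd (fun x => (c, x))); auto.
  intros [u v] [E K]. simpl in *. subst. auto.
Qed.

(** * One-dimensional fronts *)

(* A cell at position [x] has the children [x - a, ..., x + b] in the next row; [q] cells are
   deleted per move. *)
Class Offsets (a b q : Z) : Prop :=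
  offsets : 0 <= a <= 1 /\ 0 <= b <= 1 /\ 1 <= a + b /\ 0 <= q <= 3.

Ltac useoff := match goal with H : Offsets _ _ _ |- _ =>
  let K := fresh in pose proof H as K; unfold Offsets in K end.
Ltac olia := first [lia | useoff; lia].
Ltac onia := first [nia | useoff; nia].

Section Front.
Context {a b q : Z} {HO : Offsets a b q}.
Notation r := (a + b).

Lemma off_mul k : 0 <= k -> 0 <= a * k <= k /\ 0 <= b * k <= k.
Proof. useoff. nia. Qed.

Lemma off_mono k m : k <= m -> a * k <= a * m /\ b * k <= b * m.
Proof. useoff. nia. Qed.

Definition ch (F : Z -> Prop) (x : Z) : Prop := exists y, F y /\ y - a <= x <= y + b.

(** The cells of [F] itself are not tested against [Bk]: occupied cells are never deleted, so only
    rows after [y] matter. *)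
Fixpoint reach (Bk : Z -> Z -> Prop) (y : Z) (F : Z -> Prop) (j : nat) : Z -> Prop :=
  match j with
  | O => F
  | S k => fun x => ch (reach Bk y F k) x /\ ~ Bk (y + Z.of_nat (S k)) x
  end.

Definition rend (F : Z -> Prop) (x : Z) : Prop := F x /\ ~ F (x + 1).

Lemma ch_Fin F : Fin F -> Fin (ch F).
Proof.
  intros H.
  apply (Fin_sub _ (fun x => F (x + 1) \/ F (x + 0) \/ F (x + -1))).
  - repeat apply Fin_or; apply Fin_shift; auto.
  - intros x (y & Hy & Hx). assert (y = x + 1 \/ y = x + 0 \/ y = x + -1) as [->|[->| ->]] by olia; auto.
Qed.

Lemma ch_mono F G x : (forall z, F z -> G z) -> ch F x -> ch G x.
Proof. intros H (y & Hy & Hx). exists y. auto. Qed.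

Lemma rend_Fin F : Fin F -> Fin (rend F).
Proof. intros H. apply (Fin_sub _ F); auto. intros x []; auto. Qed.

(** Shifted by [a], the children of [y] are [y], ..., [y + r]. They contain [F] and the right
    neighbour of every run, and for [r = 2] also the cell two past the maximum. Counting a new cell
    for each run is what later rewards a front with many ends. *)
Lemma card_ch F : Fin F -> (exists x, F x) -> card F + (r - 1) + card (rend F) <= card (ch F).
Proof.
  intros H E. destruct (Fin_max F H E) as (m & Hm & Hx).
  assert (F1 : Fin (fun x => rend F (x + -1))) by (apply Fin_shift, rend_Fin; auto).
  assert (E1 : card F + card (rend F) = card (fun x => F x \/ rend F (x + -1))).
  { rewrite card_disj; auto.
    - rewrite (card_shift (rend F) (-1)); auto. apply rend_Fin; auto.
    - intros x Fx [_ N]. apply N. replace (x + -1 + 1) with x by olia. auto. }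
  rewrite <- (card_shift (ch F) (- a)) by (apply ch_Fin; auto).
  assert (FC : Fin (fun x => ch F (x + - a))) by (apply Fin_shift, ch_Fin; auto).
  assert (r = 1 \/ r = 2) as [R|R] by olia.
  - replace (card F + (r - 1) + card (rend F)) with (card F + card (rend F)) by olia.
    rewrite E1. apply card_mono; auto.
    intros x [Fx|[Fx _]]; [exists x|exists (x + -1)]; split; auto; olia.
  - replace (card F + (r - 1) + card (rend F)) with ((card F + card (rend F)) + 1) by olia.
    rewrite E1, <- (card_single (m + 2) (fun x => x = m + 2)) by tauto.
    rewrite <- card_disj.
    + apply card_mono; auto.
      intros x [[Fx|[Fx _]]| ->]; [exists x|exists (x + -1)|exists m]; split; auto; olia.
    + apply Fin_or; auto.
    + exists [m + 2]. simpl. auto.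
    + intros x [Fx|[Fx _]] ->; apply Hx in Fx; olia.
Qed.

Lemma card_ch_le F : Fin F -> (exists x, F x) -> card F + r <= card (ch F).
Proof.
  intros H E. assert (G := card_ch F H E). destruct (Fin_max F H E) as (m & Hm & Hx).
  assert (1 <= card (rend F)); [|olia].
  apply (card_pos _ m); [apply rend_Fin; auto|]. split; auto. intros K. apply Hx in K. olia.
Qed.

Lemma reach_Fin Bk y F j : Fin F -> Fin (reach Bk y F j).
Proof.
  intros H. induction j; simpl; auto. apply (Fin_sub _ (ch (reach Bk y F j))).
  - apply ch_Fin; auto.
  - tauto.
Qed.

Lemma reach_mono Bk Bk' y F F' j x :
  (forall i z, y < i -> Bk' i z -> Bk i z) -> (forall z, F z -> F' z) ->
  reach Bk y F j x -> reach Bk' y F' j x.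
Proof.
  intros H1 H2. revert x. induction j; simpl; intros x; auto.
  intros [Hc N]. split.
  - eapply ch_mono; eauto.
  - intros K. apply N, H1; auto. olia.
Qed.

Lemma reach_same Bk Bk' y F j x :
  (forall i z, y < i -> (Bk' i z <-> Bk i z)) -> (reach Bk y F j x <-> reach Bk' y F j x).
Proof.
  intros H. split; apply reach_mono; auto; intros i z Hi; apply H; auto.
Qed.

Lemma reach_range Bk y F j x lo hi : (forall z, F z -> lo <= z <= hi) ->
  reach Bk y F j x -> lo - a * Z.of_nat j <= x <= hi + b * Z.of_nat j.
Proof.
  intros H. revert x. induction j; simpl; intros x.
  - intros Hx. apply H in Hx. olia.
  - intros [(z & Hz & Hx) _]. apply IHj in Hz. olia.
Qed.

Lemma reach_comp Bk y F i j x :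
  reach Bk y F (i + j) x <-> reach Bk (y + Z.of_nat i) (reach Bk y F i) j x.
Proof.
  revert x. induction j; intros x.
  - rewrite Nat.add_0_r. simpl. tauto.
  - rewrite Nat.add_succ_r. cbn [reach].
    replace (y + Z.of_nat (S (i + j))) with (y + Z.of_nat i + Z.of_nat (S j)) by olia.
    split; intros [(z & Hz & Hx) N]; split; auto; exists z; split; auto; apply IHj; auto.
Qed.

Lemma reach_ne_le Bk y F i j : (i <= j)%nat -> (exists x, reach Bk y F j x) ->
  exists x, reach Bk y F i x.
Proof.
  intros H. induction H; auto. intros (x & (z & Hz & _) & _). apply IHle. eauto.
Qed.

Lemma reach_split Bk y F j x : reach Bk y F j x <-> exists f, F f /\ reach Bk y (eq f) j x.
Proof.
  revert x. induction j; simpl; intros x.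
  - split; [intros; exists x; auto|intros (f & Hf & ->); auto].
  - split.
    + intros [(z & Hz & Hx) N]. apply IHj in Hz as (f & Hf & Hz). exists f.
      split; auto. split; auto. exists z; auto.
    + intros (f & Hf & (z & Hz & Hx) & N). split; auto. exists z. split; auto. apply IHj. eauto.
Qed.

Definition pth (Bk : Z -> Z -> Prop) (y : Z) (p : nat -> Z) (i n : nat) : Prop :=
  forall k, (i <= k < n)%nat ->
    p k - a <= p (S k) <= p k + b /\ ~ Bk (y + Z.of_nat (S k)) (p (S k)).

Lemma reach_pth Bk y F p i n : (i <= n)%nat -> reach Bk y F i (p i) -> pth Bk y p i n ->
  reach Bk y F n (p n).
Proof.
  intros H R P. induction H as [|m H IH]; auto.
  assert (K : pth Bk y p i m) by (intros k Hk; apply P; olia).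
  specialize (IH K). destruct (P m) as [S1 S2]; [olia|].
  split; auto. exists (p m). auto.
Qed.

Lemma pth_reach Bk y F n x : reach Bk y F n x ->
  exists p, F (p O) /\ p n = x /\ pth Bk y p 0 n.
Proof.
  revert x. induction n; intros x.
  - intros H. exists (fun _ => x). split; [|split]; auto. intros k Hk. olia.
  - intros [(z & Hz & Hx) N]. apply IHn in Hz as (p & P0 & Pn & P).
    exists (fun k => if Nat.leb k n then p k else x). split; [|split].
    + auto.
    + destruct (Nat.leb_spec (S n) n); auto; olia.
    + intros k Hk. destruct (Nat.leb_spec k n); [|olia].
      destruct (Nat.leb_spec (S k) n).
      * apply P. olia.
      * assert (k = n) by olia. subst k. rewrite Pn. auto.
Qed.

Lemma pth_sub Bk Bk' y p i n i' n' : pth Bk y p i n -> (i <= i')%nat -> (n' <= n)%nat ->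
  (forall k, (i' <= k < n')%nat -> Bk' (y + Z.of_nat (S k)) (p (S k)) -> Bk (y + Z.of_nat (S k)) (p (S k))) ->
  pth Bk' y p i' n'.
Proof. intros P H1 H2 H k Hk. destruct (P k); [olia|]. split; auto. Qed.

Lemma pth_range Bk y p i n k : pth Bk y p i n -> (i <= k <= n)%nat ->
  p i - a * Z.of_nat (k - i) <= p k <= p i + b * Z.of_nat (k - i).
Proof.
  intros P [H K]. induction H as [|m H IH].
  - rewrite Nat.sub_diag. olia.
  - destruct (P m) as [S1 _]; [olia|]. assert (IH' := IH ltac:(olia)).
    replace (S m - i)%nat with (S (m - i)) by olia. olia.
Qed.

(* The offsets form an interval, so a path cannot step over another one without landing on a
   child of it. *)
Lemma crossing Bk y F P p k : reach Bk y F k (P k) ->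
  P k - a <= P (S k) <= P k + b ->
  p k - a <= p (S k) <= p k + b -> ~ Bk (y + Z.of_nat (S k)) (p (S k)) ->
  (P k < p k /\ p (S k) <= P (S k)) \/ (p k < P k /\ P (S k) <= p (S k)) ->
  reach Bk y F (S k) (p (S k)).
Proof. intros R S1 S2 N C. split; auto. exists (P k). split; auto. olia. Qed.

Definition withX (D : Z -> Z -> Prop) (X : Z * Z -> Prop) : Z -> Z -> Prop :=
  fun i x => D i x \/ X (i, x).

Definition FinD (D : Z -> Z -> Prop) : Prop := Fin (fun v : Z * Z => D (fst v) (snd v)).

(* The sets of cells that can be deleted when [q] cells are deleted before each of the next moves. *)
Definition timed (y : Z) (X : Z * Z -> Prop) : Prop :=
  Fin X /\ forall j : nat, card (fun v => X v /\ fst v <= y + Z.of_nat j) <= q * Z.of_nat j.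

(** Over [[lo, hi]] all blocked cells count, met or not, so that the count does not drop when the
    front is pruned there. Outside, only the cells touched by the front count; this limits what
    adjacent sides of a box can both be charged for. *)
Definition crd (Bk : Z -> Z -> Prop) (y : Z) (F : Z -> Prop) (lo hi : Z) (j : nat) : Z * Z -> Prop :=
  fun v => exists k : nat, (k < j)%nat /\ fst v = y + Z.of_nat (S k) /\ Bk (fst v) (snd v) /\
    (lo <= snd v <= hi \/ ch (reach Bk y F k) (snd v)).

(* [beta] is a lower bound, robust against future deletions, for the size that the front [F] in
   row [y] has after it advanced [h] rows, normalised by its free growth and by the blocked cells
   that it passes; the count stops when the front dies. *)
Definition Good (F : Z -> Prop) (D : Z -> Z -> Prop) (y lo hi : Z) (h : nat) (beta : Z) : Prop :=
  forall X, timed y X -> forall j : nat, (j <= h)%nat ->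
    (forall i, (i < j)%nat -> exists x, reach (withX D X) y F i x) ->
    (j = h \/ forall x, ~ reach (withX D X) y F j x) ->
    beta <= card (reach (withX D X) y F j) + card (crd (withX D X) y F lo hi j) - r * Z.of_nat j.

Lemma withX_Fin D X : FinD D -> Fin X -> FinD (withX D X).
Proof.
  intros H K. apply (Fin_sub _ (fun v : Z * Z => D (fst v) (snd v) \/ X v)); [apply Fin_or; auto|].
  intros [i x] [?|?]; auto.
Qed.

Lemma row_Fin Bk i : FinD Bk -> Fin (fun x => Bk i x).
Proof.
  intros H. apply (Fin_inj (fun x => (i, x)) _ _ H); auto. intros x z _ _ E. congruence.
Qed.

Lemma crd_Fin Bk y F lo hi j : FinD Bk -> Fin (crd Bk y F lo hi j).
Proof. intros H. apply (Fin_sub _ _ H). intros v (k & _ & _ & K & _). auto. Qed.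

Definition crow (Bk : Z -> Z -> Prop) (y : Z) (F : Z -> Prop) (lo hi : Z) (k : nat) : Z -> Prop :=
  fun x => Bk (y + Z.of_nat (S k)) x /\ (lo <= x <= hi \/ ch (reach Bk y F k) x).

Lemma crow_Fin Bk y F lo hi k : FinD Bk -> Fin (crow Bk y F lo hi k).
Proof. intros H. apply (Fin_sub _ _ (row_Fin Bk (y + Z.of_nat (S k)) H)). intros x []; auto. Qed.

Lemma card_crd_S Bk y F lo hi j : FinD Bk ->
  card (crd Bk y F lo hi (S j)) = card (crd Bk y F lo hi j) + card (crow Bk y F lo hi j).
Proof.
  intros H.
  rewrite <- (card_slice (y + Z.of_nat (S j)) _ (crow_Fin Bk y F lo hi j H)), <- card_disj.
  - apply card_ext.
    + apply Fin_or; [apply crd_Fin; auto|]. apply (Fin_sub _ _ H). intros v (E' & C & _). rewrite E'. auto.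
    + intros v. split.
      * intros (k & Hk & E' & B & C). destruct (Nat.eq_dec k j) as [->|N].
        -- right. split; auto. split; auto. rewrite <- E'. auto.
        -- left. exists k. split; [olia|auto].
      * intros [(k & Hk & C)|(E' & B & C)].
        -- exists k. split; [olia|auto].
        -- exists j. rewrite <- E' in B. auto.
  - apply crd_Fin; auto.
  - apply (Fin_sub _ _ H). intros v (E' & C & _). rewrite E'. auto.
  - intros v (k & Hk & E' & _) (E'' & _). olia.
Qed.

Lemma card_crd_0 Bk y F lo hi : card (crd Bk y F lo hi 0) = 0.
Proof. apply card_empty. intros v (k & Hk & _). olia. Qed.

Lemma reach_grow Bk y F j : Fin F -> FinD Bk -> (exists x, reach Bk y F j x) ->
  card (reach Bk y F j) + (r - 1) + card (rend (reach Bk y F j)) <=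
  card (reach Bk y F (S j)) + card (fun x => Bk (y + Z.of_nat (S j)) x /\ ch (reach Bk y F j) x).
Proof.
  intros H K E. assert (FR := reach_Fin Bk y F j H).
  assert (G := card_ch _ FR E).
  rewrite (card_split (ch (reach Bk y F j)) (fun x => ~ Bk (y + Z.of_nat (S j)) x)) in G
    by (apply ch_Fin; auto).
  assert (card (fun x => ch (reach Bk y F j) x /\ ~ ~ Bk (y + Z.of_nat (S j)) x)
    <= card (fun x => Bk (y + Z.of_nat (S j)) x /\ ch (reach Bk y F j) x)).
  { apply card_mono.
    - apply (Fin_sub _ _ (row_Fin Bk (y + Z.of_nat (S j)) K)). tauto.
    - intros x [? N]. split; auto. apply NNPP; auto. }
  cbn [reach]. olia.
Qed.

(** The surplus [card (rend _) - 1] is kept for [pot_sum]: added up over a strip, it puts a front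
    with many ends far ahead of [beta]. *)
Lemma pot_grow Bk y F lo hi j : Fin F -> FinD Bk -> (exists x, reach Bk y F j x) ->
  card (reach Bk y F j) + card (crd Bk y F lo hi j) - r * Z.of_nat j
    + (card (rend (reach Bk y F j)) - 1) <=
  card (reach Bk y F (S j)) + card (crd Bk y F lo hi (S j)) - r * Z.of_nat (S j).
Proof.
  intros H K E. rewrite card_crd_S by auto.
  assert (G := reach_grow Bk y F j H K E).
  assert (card (fun x => Bk (y + Z.of_nat (S j)) x /\ ch (reach Bk y F j) x) <=
    card (crow Bk y F lo hi j)).
  { apply card_mono; [apply crow_Fin; auto|]. intros x []. split; auto. }
  olia.
Qed.

Lemma rend_pos F : Fin F -> (exists x, F x) -> 1 <= card (rend F).
Proof.
  intros H E. destruct (Fin_max F H E) as (m & Hm & Hx).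
  apply (card_pos _ m); [apply rend_Fin; auto|]. split; auto. intros K. apply Hx in K. olia.
Qed.

Lemma pot_mono Bk y F lo hi i j : Fin F -> FinD Bk -> (i <= j)%nat ->
  (forall k, (i <= k < j)%nat -> exists x, reach Bk y F k x) ->
  card (reach Bk y F i) + card (crd Bk y F lo hi i) - r * Z.of_nat i <=
  card (reach Bk y F j) + card (crd Bk y F lo hi j) - r * Z.of_nat j.
Proof.
  intros H K L E. induction L as [|m L IH]; [olia|].
  assert (E' : exists x, reach Bk y F m x) by (apply E; olia).
  assert (G := pot_grow Bk y F lo hi m H K E').
  assert (R := rend_pos _ (reach_Fin Bk y F m H) E').
  assert (IH' := IH (fun k Hk => E k ltac:(olia))). olia.
Qed.

Lemma Good_init F D y lo hi h : Fin F -> FinD D -> Good F D y lo hi h (card F).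
Proof.
  intros H K X [FX _] j _ E _.
  assert (G := pot_mono (withX D X) y F lo hi 0 j H (withX_Fin D X K FX) ltac:(olia)
     (fun k Hk => E k ltac:(olia))).
  rewrite card_crd_0 in G. cbn [reach] in G. olia.
Qed.

Lemma Good_le F D y lo hi h beta beta' : Good F D y lo hi h beta -> beta' <= beta ->
  Good F D y lo hi h beta'.
Proof. intros G L X T j Hj E S. specialize (G X T j Hj E S). olia. Qed.

Lemma Good_extend F D y lo hi h h' beta : Fin F -> FinD D -> (h <= h')%nat ->
  Good F D y lo hi h beta -> Good F D y lo hi h' beta.
Proof.
  intros H K L G X T j Hj E S. assert (FX := proj1 T).
  destruct (Nat.le_gt_cases j h) as [J|J].
  - apply G; auto. destruct S as [->|S]; auto. left. olia.
  - assert (G' := G X T h (le_n h) (fun i Hi => E i ltac:(olia)) (or_introl eq_refl)).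
    assert (M := pot_mono (withX D X) y F lo hi h j H (withX_Fin D X K FX) ltac:(olia)
     (fun k Hk => E k ltac:(olia))).
    olia.
Qed.

Lemma timed_none y X i x : timed y X -> X (i, x) -> y < i.
Proof.
  intros [FX T] H. specialize (T O). apply Z.nle_gt. intros L.
  assert (1 <= card (fun v => X v /\ fst v <= y + Z.of_nat 0)); [|olia].
  apply (card_pos _ (i, x)); [apply (Fin_sub _ X); tauto|]. simpl. split; auto. olia.
Qed.

Lemma timed_le y X h : timed y X -> card (fun v => X v /\ fst v <= y + Z.of_nat h) <= q * Z.of_nat h.
Proof. intros [_ T]. apply T. Qed.

(** * One move of Container and one row of the front *)

Section Step.
Context (F : Z -> Prop) (D D' : Z -> Z -> Prop) (E : Z * Z -> Prop) (y lo hi lo' hi' beta : Z)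
  (h : nat) (HF : Fin F) (HD : FinD D) (HE : Fin E) (HEq : card E <= q)
  (HD' : forall i x, D' i x <-> D i x \/ E (i, x)) (Hlo : lo' <= lo) (Hhi : hi <= hi').

(** The cells of [E] take up the budget of the first move, and [X'] that of the later ones. The
    cells of [E] in rows up to [y] are dropped, since a [timed] set has none there and the front
    never meets them. *)
Lemma step_timed X' : timed (y + 1) X' -> timed y (fun v => (E v /\ y < fst v) \/ X' v).
Proof.
  intros TT. destruct (TT) as [FX T].
  assert (F1 : Fin (fun v => E v /\ y < fst v)) by (apply (Fin_sub _ E); tauto).
  split; [apply Fin_or; auto|].
  intros j. destruct j.
  - rewrite card_empty; [olia|]. intros [i x] [[(_ & K)|K] L]; simpl in *; [olia|].
    assert (y + 1 < i) by (eapply timed_none; eauto). olia.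
  - specialize (T j).
    assert (card (fun v => ((E v /\ y < fst v) \/ X' v) /\ fst v <= y + Z.of_nat (S j)) <=
      card E + card (fun v => X' v /\ fst v <= y + 1 + Z.of_nat j)); [|olia].
    etransitivity; [|apply card_or; auto; apply (Fin_sub _ X'); tauto].
    apply card_mono; [apply Fin_or; auto; apply (Fin_sub _ X'); tauto|].
    intros v [[(? & _)|?] L]; auto. right. split; auto. olia.
Qed.

Lemma step_bk X' i x : timed (y + 1) X' -> y < i ->
  (withX D' X' i x <-> withX D (fun v => (E v /\ y < fst v) \/ X' v) i x).
Proof. intros _ L. unfold withX. rewrite HD'. simpl. tauto. Qed.

Lemma step_reach X' j x : timed (y + 1) X' ->
  (reach (withX D' X') (y + 1) (reach D' y F 1) j x <->
   reach (withX D (fun v => (E v /\ y < fst v) \/ X' v)) y F (S j) x).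
Proof.
  intros T. rewrite (reach_same _ _ y F (S j) x (fun i z Hi => step_bk X' i z T Hi)).
  change (S j) with (1 + j)%nat. rewrite reach_comp.
  assert (G : forall z, reach D' y F 1 z <-> reach (withX D' X') y F 1 z).
  { intros z. cbn [reach]. unfold withX. split; intros [C N]; split; auto.
    intros [K|K]; auto. assert (y + 1 < y + Z.of_nat 1) by (eapply timed_none; eauto). olia. }
  split; apply reach_mono; auto; intros; apply G; auto.
Qed.

(** Each continuation [X'] after the move becomes, together with [E], a continuation before it. The
    first row of the old count is settled: it adds the free growth [r] to the bound and takes off
    the cells charged in it. *)
Lemma Good_step : (exists x, F x) ->
  Good F D y lo hi (S h) beta ->
  Good (reach D' y F 1) D' (y + 1) lo' hi' h (beta + r - card (crow D' y F lo hi 0)).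
Proof.
  intros NE G X' T j Hj En S.
  pose (X := fun v => (E v /\ y < fst v) \/ X' v).
  assert (TX := step_timed X' T). fold X in TX.
  assert (FB : FinD (withX D X)) by (apply withX_Fin; auto; apply TX).
  assert (FB' : FinD D').
  { apply (Fin_sub _ (fun v => D (fst v) (snd v) \/ E v)); [apply Fin_or; auto|].
    intros [i x] K. apply HD' in K. auto. }
  assert (FB'' : FinD (withX D' X')) by (apply withX_Fin; auto; apply T).
  assert (G' := G X TX (Datatypes.S j) ltac:(olia)).
  assert (P : beta <= card (reach (withX D X) y F (Datatypes.S j))
     + card (crd (withX D X) y F lo hi (Datatypes.S j)) - r * Z.of_nat (Datatypes.S j)).
  { apply G'.
    - intros i Hi. destruct i; [exact NE|]. destruct (En i) as (x & Hx); [olia|].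
      exists x. apply step_reach; auto.
    - destruct S as [->|S]; auto. right. intros x Hx. apply (S x). apply step_reach; auto. }
  rewrite (card_ext _ _ (reach_Fin _ _ _ _ HF) (fun x => step_reach X' j x T)). fold X.
  assert (card (crd (withX D X) y F lo hi (Datatypes.S j)) <=
    card (crow D' y F lo hi 0) + card (crd (withX D' X') (y + 1) (reach D' y F 1) lo' hi' j)).
  { assert (C1 : card (crd (withX D X) y F lo hi 1) = card (crow D' y F lo hi 0)).
    { rewrite card_crd_S, card_crd_0 by auto. apply card_ext; [apply crow_Fin; auto|].
      intros x. unfold crow. cbn [reach].
      assert (SB := step_bk X' (y + Z.of_nat 1) x T ltac:(olia)). fold X in SB. rewrite <- SB.
      unfold withX. split; intros [K C]; split; auto. destruct K as [K|K]; auto.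
      assert (y + 1 < y + Z.of_nat 1) by (eapply timed_none; eauto). olia. }
    rewrite <- C1.
    etransitivity; [|apply card_or; apply crd_Fin; auto].
    apply card_mono; [apply Fin_or; apply crd_Fin; auto|].
    intros v (k & Hk & Ev & B & C). destruct k.
    - left. exists O. auto.
    - right. exists k. split; [olia|]. split; [olia|]. split.
      + apply step_bk; auto. olia.
      + destruct C as [C|C]; [left; olia|]. right. eapply ch_mono; [|exact C].
        intros z Hz. apply step_reach; auto. }
  olia.
Qed.

(** This is the clause of [Good] for dead fronts, taken at [j = 1] and without deletions after
    [E]. *)
Lemma Good_die : (exists x, F x) -> (forall x, ~ reach D' y F 1 x) ->
  Good F D y lo hi (S h) beta -> beta + r <= card (crow D' y F lo hi 0).
Proof.
  intros NE Em G.
  assert (T : timed (y + 1) (fun _ => False)).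
  { split; [apply Fin_empty; auto|]. intros j. rewrite card_empty by tauto. olia. }
  pose (X := fun v => (E v /\ y < fst v) \/ (fun _ : Z * Z => False) v).
  assert (TX := step_timed _ T). fold X in TX.
  assert (FB : FinD (withX D X)) by (apply withX_Fin; auto; apply TX).
  assert (FB' : FinD D').
  { apply (Fin_sub _ (fun v => D (fst v) (snd v) \/ E v)); [apply Fin_or; auto|].
    intros [i x] K. apply HD' in K. auto. }
  assert (EE : forall x, ~ reach (withX D X) y F 1 x).
  { intros x Hx. apply (step_reach _ 0 x T) in Hx. apply (Em x Hx). }
  assert (P := G X TX 1%nat ltac:(olia)).
  assert (P' := P (fun i Hi => ltac:(replace i with O by olia; exact NE)) (or_intror EE)).
  rewrite (card_empty (reach (withX D X) y F 1)) in P' by auto.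
  rewrite card_crd_S, card_crd_0 in P' by auto.
  assert (card (crow (withX D X) y F lo hi 0) = card (crow D' y F lo hi 0)); [|olia].
  apply card_ext; [apply crow_Fin; auto|].
  intros x. unfold crow. cbn [reach].
  assert (SB := step_bk _ (y + Z.of_nat 1) x T ltac:(olia)). fold X in SB. rewrite <- SB.
  unfold withX. tauto.
Qed.

End Step.
End Front.

Arguments ch : clear implicits.
Arguments reach : clear implicits.
Arguments pth : clear implicits.
Arguments timed : clear implicits.
Arguments crd : clear implicits.
Arguments crow : clear implicits.
Arguments Good : clear implicits.

Lemma Offsets_sym a b q : Offsets a b q -> Offsets b a q.
Proof. unfold Offsets. lia. Qed.

(** * Pruning a front *)

Section Prune.
Context {a b q : Z} {HO : Offsets a b q}.
Notation r := (a + b).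
Notation ch := (ch a b).
Notation reach := (reach a b).
Notation pth := (pth a b).
Notation Good := (Good a b q).
Notation crd := (crd a b).
Notation timed := (timed q).

(** A path to [x] that avoids the newly blocked cells would still be a path, so it meets one of
    them, and the offsets confine that cell to the cone below [x]. *)
Lemma lost_cone Bk Bk' y F j x : reach Bk y F j x -> ~ reach Bk' y F j x ->
  exists k z, (k < j)%nat /\ Bk' (y + Z.of_nat (S k)) z /\ ~ Bk (y + Z.of_nat (S k)) z /\
    x - b * Z.of_nat j <= z <= x + a * Z.of_nat j.
Proof.
  intros R N. destruct (pth_reach _ _ _ _ _ R) as (p & P0 & Pj & P).
  destruct (classic (exists k, (k < j)%nat /\ Bk' (y + Z.of_nat (S k)) (p (S k)))) as [(k & Hk & B)|C].
  - exists k, (p (S k)). split; auto. split; auto. split.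
    + destruct (P k); auto. olia.
    + assert (P' : pth Bk y p (S k) j) by (intros m Hm; apply P; olia).
      assert (G := pth_range _ _ _ _ _ j P' ltac:(olia)).
      rewrite Pj in G. onia.
  - exfalso. apply N. rewrite <- Pj. apply (reach_pth _ _ _ p 0); auto; [olia|].
    intros k Hk. destruct (P k); auto. split; auto. intros B. apply C. exists k. split; auto. olia.
Qed.

Lemma card_near {A} (k : A -> Z) (P : Z -> Prop) (Q : A -> Prop) u v :
  Fin P -> Fin Q -> 0 <= u -> 0 <= v ->
  (forall x, P x -> exists c, Q c /\ x - u <= k c <= x + v) ->
  card P <= (u + v + 1) * card Q.
Proof.
  intros HP HQ Hu Hv H.
  apply (card_fiber P Q (fun x c => x - u <= k c <= x + v)); auto; try olia.
  intros c _. replace (u + v + 1) with ((k c + u) - (k c - v) + 1) by olia.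
  apply card_interval_le; olia || (intros; olia).
Qed.

Lemma free_reach y (F : Z -> Prop) g j x : F g ->
  g - a * Z.of_nat j <= x <= g + b * Z.of_nat j -> reach (fun _ _ => False) y F j x.
Proof.
  intros Hg. revert x. induction j; intros x Hx.
  - replace x with g by olia. auto.
  - split; auto. exists (Z.max (x - b) (g - a * Z.of_nat j)). split; [apply IHj; onia|onia].
Qed.

(** Each of at most [q j] deletions shades at most [r j + 1] cells of row [j]. *)
Lemma kill_bound D X y F j : Fin F -> timed y X ->
  card (reach D y F j) <= card (reach (withX D X) y F j)
    + (r * Z.of_nat j + 1) * (q * Z.of_nat j).
Proof.
  intros HF T. assert (FR := reach_Fin D y F j HF).
  rewrite (card_split _ (reach (withX D X) y F j) FR).
  assert (card (fun x => reach D y F j x /\ reach (withX D X) y F j x) <=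
    card (reach (withX D X) y F j)).
  { apply card_mono; [apply reach_Fin; auto|tauto]. }
  assert (FX : Fin (fun v => X v /\ fst v <= y + Z.of_nat j)) by (apply (Fin_sub _ X); [apply T|tauto]).
  assert (C : card (fun x => reach D y F j x /\ ~ reach (withX D X) y F j x) <=
    (b * Z.of_nat j + a * Z.of_nat j + 1) * card (fun v => X v /\ fst v <= y + Z.of_nat j)).
  { apply (card_near snd); auto; try onia.
    - apply (Fin_sub _ (reach D y F j)); auto; tauto.
    - intros x [R N]. destruct (lost_cone _ _ _ _ _ _ R N) as (k & z & Hk & B & NB & Hz).
      exists (y + Z.of_nat (S k), z). simpl fst. simpl snd. split; auto. split; [|olia].
      destruct B; tauto. }
  assert (K := timed_le y X j T).
  replace (r * Z.of_nat j + 1) with (b * Z.of_nat j + a * Z.of_nat j + 1) by ring.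
  assert (0 <= b * Z.of_nat j + a * Z.of_nat j + 1) by onia.
  assert (M := Z.mul_le_mono_nonneg_l _ _ _ H0 K). olia.
Qed.

(* Removing the cell [f] from a front that is dense around [f], in a region free of deleted cells,
   costs nothing: future deletions [X] against the pruned front can be traded for deletions [X'']
   that do at least as much harm to the unpruned one. Take surviving paths [P] and [Q] on the two
   sides of [f]; in the trap between them, replace the cells of [X] by the cells of row [s0] that
   the pruned front misses. The latter are not more numerous, since every gap shrinks by [a + b]
   per row, except where [X] hits the trap. *)
Section Exact.
Context (F : Z -> Prop) (D : Z -> Z -> Prop) (y lo hi : Z) (h : nat) (f L Y : Z) (J s0 : nat)
  (X : Z * Z -> Prop).
Notation F' := (fun z => F z /\ z <> f).
Notation zJ := (Z.of_nat J).
Notation zs := (Z.of_nat s0).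
Notation E := (q * zJ * (r * zJ + 1)).
(** [J] rows fill the gaps of the pruned front except in the shadows of at most [q J] cells of [X],
    whence [E]; the other [s0 - J] rows suffice to close what is missing. A window of width [L] is
    too wide to be killed before row [s0], and [Y] has room for all paths that start within [L] of
    [f] and run for [s0] rows. *)
Context (HF : Fin F) (HD : FinD D) (HT : timed y X)
  (HJ : (1 <= J <= s0)%nat) (Hs : (s0 <= h)%nat) (HE : E <= r * (zs - zJ))
  (HL : r * zJ + E + q * zs < L) (HY : L + r * zs <= Y)
  (Hfree : forall k x, (1 <= k <= s0)%nat -> f - Y <= x <= f + Y -> ~ D (y + Z.of_nat k) x)
  (Hdense : forall x, f - Y <= x -> x + r * zJ <= f + Y -> exists g, F' g /\ x <= g <= x + r * zJ)
  (Hends : lo + Y + 1 <= f <= hi - Y - 1).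
Notation B := (withX D X).

Lemma near_J (S0 : Z -> Prop) x :
  (forall g, F' g -> x - b * zJ <= g <= x + a * zJ -> S0 g) ->
  f - Y <= x - b * zJ -> x + a * zJ <= f + Y -> ~ reach B y S0 J x ->
  exists c, (X c /\ fst c <= y + zJ) /\ x - b * zJ <= snd c <= x + a * zJ.
Proof.
  intros HS H1 H2 N. destruct (Hdense (x - b * zJ)) as (g & Hg & Hx); [olia|olia|].
  assert (R : reach (fun _ _ => False) y S0 J x).
  { apply (free_reach y S0 g); [apply HS; auto|]; olia. }
  destruct (lost_cone _ _ _ _ _ _ R N) as (k & z & Hk & C & _ & Hz).
  exists (y + Z.of_nat (S k), z). simpl. split; [|olia]. split; [|olia].
  destruct C as [C|C]; auto. exfalso. apply (Hfree (S k) z); auto; olia.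
Qed.

Lemma cardXJ : card (fun v => X v /\ fst v <= y + zJ) <= q * zJ.
Proof. apply timed_le; auto. Qed.

Lemma FinXle i : Fin (fun v => X v /\ fst v <= i).
Proof. apply (Fin_sub _ X); [apply HT|tauto]. Qed.

Lemma near_J_card (P : Z -> Prop) : Fin P ->
  (forall x, P x -> exists c, (X c /\ fst c <= y + zJ) /\ x - b * zJ <= snd c <= x + a * zJ) ->
  card P <= E.
Proof.
  intros HP H. assert (G := card_near snd P _ (b * zJ) (a * zJ) HP (FinXle _) ltac:(onia) ltac:(onia) H).
  assert (K := cardXJ).
  replace (r * zJ + 1) with (b * zJ + a * zJ + 1) by ring.
  assert (H0 : 0 <= b * zJ + a * zJ + 1) by onia.
  assert (M := Z.mul_le_mono_nonneg_l _ _ _ H0 K). olia.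
Qed.

Lemma cardX_S i : card (fun v => X v /\ fst v <= y + Z.of_nat (S i)) =
  card (fun v => X v /\ fst v <= y + Z.of_nat i) + card (fun x => X (y + Z.of_nat (S i), x)).
Proof.
  rewrite (card_split _ (fun v => fst v <= y + Z.of_nat i) (FinXle _)). f_equal.
  - apply card_ext; [apply FinXle|]. intros v. intuition olia.
  - apply (card_bij snd (fun x => (y + Z.of_nat (S i), x))).
    + apply (Fin_inj (fun x => (y + Z.of_nat (S i), x)) _ X); auto; [apply HT|].
      intros u v _ _ K. congruence.
    + intros [u v] [[K1 K2] K3]. simpl in *. assert (u = y + Z.pos (Pos.of_succ_nat i)) as -> by olia. auto.
    + intros x K. simpl. split; auto. split; [split; auto|]; olia.
Qed.

(** In row [J] the window has at least [L - r J - E] descendants. From then on the growth of each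
    row makes up for everything except the cells deleted there, at most [q s0] in total. *)
Lemma survive u : f - L <= u -> u + L - 1 <= f + L -> (u + L - 1 < f \/ f < u) ->
  exists p, F' (p O) /\ u <= p O <= u + L - 1 /\ pth B y p 0 s0.
Proof.
  intros U1 U2 U3. pose (S0 := fun z => F' z /\ u <= z <= u + L - 1).
  assert (FS : Fin S0) by (apply (Fin_sub _ F); auto; unfold S0; tauto).
  assert (RJ : L - r * zJ - E <= card (reach B y S0 J)).
  { assert (C : card (fun x => u + b * zJ <= x <= u + L - 1 - a * zJ) = L - r * zJ)
      by (rewrite card_interval; onia).
    rewrite (card_split _ (reach B y S0 J)) in C by apply Fin_interval.
    assert (card (fun x => (u + b * zJ <= x <= u + L - 1 - a * zJ) /\ reach B y S0 J x)
      <= card (reach B y S0 J)) by (apply card_mono; [apply reach_Fin; auto|tauto]).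
    assert (card (fun x => (u + b * zJ <= x <= u + L - 1 - a * zJ) /\ ~ reach B y S0 J x) <= E); [|olia].
    apply near_J_card.
    - apply (Fin_sub _ _ (Fin_interval (u + b * zJ) (u + L - 1 - a * zJ))). tauto.
    - intros x [K N]. apply (near_J S0); auto; try onia.
      intros g Hg Hx. split; auto. olia. }
  assert (G : forall i, (J <= i <= s0)%nat ->
    L - r * zJ - E <= card (reach B y S0 i) + card (fun v => X v /\ fst v <= y + Z.of_nat i)).
  { intros i [L1 L2]. induction L1 as [|m L1 IH].
    - assert (0 <= card (fun v => X v /\ fst v <= y + zJ)) by apply card_nonneg, FinXle. olia.
    - specialize (IH ltac:(olia)).
      assert (T := timed_le y X m HT).
      assert (NE : exists x, reach B y S0 m x).
      { apply card_ex; [apply reach_Fin; auto|]. onia. }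
      assert (FB : FinD B) by (apply withX_Fin; auto; apply HT).
      assert (GR := reach_grow B y S0 m FS FB NE).
      assert (RE := rend_pos _ (reach_Fin B y S0 m FS) NE).
      assert (card (fun x => B (y + Z.of_nat (S m)) x /\ ch (reach B y S0 m) x) <=
        card (fun x => X (y + Z.of_nat (S m), x))).
      { apply card_mono.
        - apply (Fin_inj (fun x => (y + Z.of_nat (S m), x)) _ X); auto; [apply HT|].
          intros u' v' _ _ K. congruence.
        - intros x [[K|K] (z & Hz & Hx)]; auto. exfalso.
          apply (reach_range _ _ _ _ _ u (u + L - 1)) in Hz; [|unfold S0; intros; tauto].
          assert (OM := off_mono (Z.of_nat (S m)) zs ltac:(lia)).
          apply (Hfree (S m) x); auto; [olia|]. olia. }
      rewrite cardX_S. olia. }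
  specialize (G s0 ltac:(olia)). assert (T := timed_le y X s0 HT).
  destruct (card_ex (reach B y S0 s0)) as (x & Hx); [apply reach_Fin; auto|olia|].
  destruct (pth_reach _ _ _ _ _ Hx) as (p & P0 & _ & P).
  exists p. unfold S0 in P0. tauto.
Qed.

Section Trap.
Context (P Q : nat -> Z) (P0 : F' (P O)) (PL : f - L <= P O < f) (PP : pth B y P 0 s0)
  (Q0 : F' (Q O)) (QL : f < Q O <= f + L) (QQ : pth B y Q 0 s0).
Notation R' := (reach B y F').
Notation trap i x := (P i < x < Q i).

Lemma PR k : (k <= s0)%nat -> R' k (P k).
Proof.
  intros H. apply (reach_pth _ _ _ P 0); auto; [olia|].
  intros i Hi. apply PP. olia.
Qed.

Lemma QR k : (k <= s0)%nat -> R' k (Q k).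
Proof.
  intros H. apply (reach_pth _ _ _ Q 0); auto; [olia|].
  intros i Hi. apply QQ. olia.
Qed.

Lemma trap_range i x : (i <= s0)%nat -> trap i x -> f - Y + 1 <= x <= f + Y - 1.
Proof.
  intros H T. assert (G1 := pth_range _ _ _ 0 s0 i PP ltac:(olia)).
  assert (G2 := pth_range _ _ _ 0 s0 i QQ ltac:(olia)).
  rewrite Nat.sub_0_r in *. onia.
Qed.

(* A path of the unpruned front that leaves the trap crosses one of its two walls, after which it
   is a path of the pruned front. *)
Lemma outside_trap (X'' : Z * Z -> Prop) s1 p n : (1 <= s1 <= s0)%nat ->
  (forall i x, X (y + Z.of_nat i, x) -> ~ ((1 <= i <= s1)%nat /\ trap i x) -> X'' (y + Z.of_nat i, x)) ->
  (forall x, trap s1 x -> R' s1 x \/ withX D X'' (y + Z.of_nat s1) x) ->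
  F (p O) -> pth (withX D X'') y p 0 n -> forall i, (i <= n)%nat ->
  R' i (p i) \/ ((i < s1)%nat /\ trap i (p i)).
Proof.
  intros Hs1 H1 H2 p0 PT. induction i as [|i IH]; intros Hi.
  - destruct (Z.eq_dec (p O) f) as [E0|E0].
    + right. rewrite E0. split; [olia|olia].
    + left. simpl. auto.
  - destruct (PT i) as [St Nb]; [olia|].
    assert (HB : ~ ((1 <= S i <= s1)%nat /\ trap (S i) (p (S i))) -> ~ B (y + Z.of_nat (S i)) (p (S i))).
    { intros N [K|K]; apply Nb; [left; auto|right; apply H1; auto]. }
    destruct (classic ((1 <= S i <= s1)%nat /\ trap (S i) (p (S i)))) as [[T1 T2]|T].
    + destruct (Nat.eq_dec (S i) s1) as [Es|Es].
      * rewrite <- Es in H2. destruct (H2 _ T2) as [K|K]; auto. contradiction.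
      * right. split; auto. olia.
    + left. specialize (HB T). destruct (IH ltac:(olia)) as [K|[K1 K2]].
      * split; auto. exists (p i). auto.
      * assert (p (S i) <= P (S i) \/ Q (S i) <= p (S i)) as [W|W].
        { destruct (Z.le_gt_cases (p (S i)) (P (S i))); auto.
          destruct (Z.le_gt_cases (Q (S i)) (p (S i))); auto. exfalso. apply T. split; olia. }
        -- apply (crossing _ _ _ P); auto; [apply PR; olia|apply PP; olia|]. left. split; olia.
        -- apply (crossing _ _ _ Q); auto; [apply QR; olia|apply QQ; olia|]. right. split; olia.
Qed.

Definition miss i x := trap i x /\ ~ R' i x.
Definition hitX i x := X (y + Z.of_nat i, x) /\ trap i x.

Lemma trap_Fin (G : Z -> Prop) i : (forall x, G x -> trap i x) -> Fin G.
Proof. intros H. apply (Fin_sub _ _ (Fin_interval (P i) (Q i))). intros x K. apply H in K. olia. Qed.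

(** Read backwards: all parents of an uncovered cell are missed cells of the row before, and they
    lie in the trap because the walls are not among them. So [card_ch_le] with the offsets exchanged
    shows that a gap shrinks by [r] per row, up to new deletions. *)
Lemma miss_step i : (S i <= s0)%nat ->
  card (miss (S i)) <= Z.max 0 (card (miss i) - r) + card (hitX (S i)).
Proof.
  intros Hi. pose (N0 := fun x => trap (S i) x /\ ~ ch (R' i) x).
  assert (FN : Fin N0) by (apply (trap_Fin _ (S i)); unfold N0; tauto).
  assert (FM : Fin (miss i)) by (apply (trap_Fin _ i); unfold miss; tauto).
  assert (FH : Fin (hitX (S i))) by (apply (trap_Fin _ (S i)); unfold hitX; tauto).
  assert (C : card (miss (S i)) <= card N0 + card (hitX (S i))).
  { etransitivity; [|apply card_or; auto]. apply card_mono; [apply Fin_or; auto|].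
    intros x [T N]. destruct (classic (ch (R' i) x)) as [K|K]; [|left; split; auto].
    right. split; auto. destruct (classic (B (y + Z.of_nat (S i)) x)) as [[K'|K']|K']; auto.
    - exfalso. apply (Hfree (S i) x); auto; [olia|]. apply trap_range in T; auto; olia.
    - exfalso. apply N. split; auto. }
  destruct (classic (exists x, N0 x)) as [NE|NE].
  - assert (G := card_ch_le (HO := Offsets_sym _ _ _ HO) N0 FN NE).
    match type of G with _ <= ?u => assert (u <= card (miss i)); [|olia] end.
    apply card_mono; auto.
    intros z (x & (T & N) & Hz).
    assert (W : forall g, R' i g -> ~ (x - b <= g <= x + a)).
    { intros g Hg Hx. apply N. exists g. split; auto. olia. }
    assert (W1 := W _ (PR i ltac:(olia))). assert (W2 := W _ (QR i ltac:(olia))).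
    destruct (PP i) as [S1 _]; [olia|]. destruct (QQ i) as [S2 _]; [olia|].
    split; [olia|]. intros K. apply (W z K). olia.
  - rewrite (card_empty N0) in C; [olia|]. intros x Hx. apply NE. eauto.
Qed.

Lemma miss_J : card (miss J) <= E.
Proof.
  apply near_J_card; [apply (trap_Fin _ J); unfold miss; tauto|].
  intros x [T N].
  assert (G1 := pth_range _ _ _ 0 s0 J PP ltac:(olia)).
  assert (G2 := pth_range _ _ _ 0 s0 J QQ ltac:(olia)). rewrite Nat.sub_0_r in *.
  apply (near_J F'); auto; onia.
Qed.

Definition inT v := X v /\ exists i, (1 <= i <= s0)%nat /\ fst v = y + Z.of_nat i /\ trap i (snd v).

Lemma inT_Fin : Fin inT.
Proof. apply (Fin_sub _ X); [apply HT|]. unfold inT. tauto. Qed.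

Lemma card_inT_S i : (S i <= s0)%nat ->
  card (fun v => inT v /\ fst v <= y + Z.of_nat (S i)) =
  card (fun v => inT v /\ fst v <= y + Z.of_nat i) + card (hitX (S i)).
Proof.
  intros Hi. rewrite (card_split _ (fun v => fst v <= y + Z.of_nat i)); [f_equal|].
  - apply card_ext; [apply (Fin_sub _ _ inT_Fin); tauto|]. intros v. intuition olia.
  - apply (card_bij snd (fun x => (y + Z.of_nat (S i), x))).
    + apply (trap_Fin _ (S i)). unfold hitX. tauto.
    + intros [u v] [[[K1 (k & Hk & K2 & K3)] K4] K5]. simpl fst in *. simpl snd in *.
      assert (k = S i) as -> by olia. subst u. split; auto. split; auto.
    + intros x [K1 K2]. simpl snd. split; auto. simpl fst. split; [split|]; try olia.
      split; auto. exists (S i). simpl fst. simpl snd. split; [olia|auto].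
  - apply (Fin_sub _ _ inT_Fin); tauto.
Qed.

Lemma miss_bound : card (miss s0) <= card inT.
Proof.
  assert (G : forall i, (J <= i <= s0)%nat -> card (miss i) <=
    Z.max 0 (E - r * (Z.of_nat i - zJ)) + card (fun v => inT v /\ fst v <= y + Z.of_nat i)).
  { intros i [L1 L2]. induction L1 as [|m L1 IH].
    - assert (M := miss_J).
      assert (0 <= card (fun v => inT v /\ fst v <= y + zJ)); [|olia].
      apply card_nonneg. apply (Fin_sub _ _ inT_Fin); tauto.
    - specialize (IH ltac:(olia)). assert (M := miss_step m L2). rewrite card_inT_S by auto.
      assert (0 <= card (fun v => inT v /\ fst v <= y + Z.of_nat m)).
      { apply card_nonneg. apply (Fin_sub _ _ inT_Fin); tauto. }
      olia. }
  specialize (G s0 ltac:(olia)).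
  assert (card (fun v => inT v /\ fst v <= y + zs) <= card inT).
  { apply card_mono; [apply inT_Fin|tauto]. }
  olia.
Qed.

Lemma trap_case : exists X'', timed y X'' /\
  (forall x, reach (withX D X'') y F h x -> R' h x) /\
  card (crd (withX D X'') y F lo hi h) <= card (crd B y F' lo hi h).
Proof.
  assert (FB : FinD B) by (apply withX_Fin; auto; apply HT).
  assert (Out : forall X'' s1, (1 <= s1 <= s0)%nat ->
    (forall i x, X (y + Z.of_nat i, x) -> ~ ((1 <= i <= s1)%nat /\ trap i x) -> X'' (y + Z.of_nat i, x)) ->
    (forall x, trap s1 x -> R' s1 x \/ withX D X'' (y + Z.of_nat s1) x) ->
    (forall x, reach (withX D X'') y F h x -> R' h x) /\
    (forall k x, (k < h)%nat -> ch (reach (withX D X'') y F k) x -> lo <= x <= hi \/ ch (R' k) x)).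
  { intros X'' s1 Hs1 H1 H2. split.
    - intros x Hx. destruct (pth_reach _ _ _ _ _ Hx) as (p & p0 & <- & PT).
      destruct (outside_trap X'' s1 p h Hs1 H1 H2 p0 PT h (le_n h)) as [K|[K _]]; auto. olia.
    - intros k x Hk (z & Hz & Hx).
      destruct (pth_reach _ _ _ _ _ Hz) as (p & p0 & <- & PT).
      destruct (outside_trap X'' s1 p k Hs1 H1 H2 p0 PT k (le_n k)) as [K|[K1 K2]].
      + right. exists (p k). auto.
      + left. apply trap_range in K2; [|olia]. olia. }
  destruct (classic (exists k, (k <= s0)%nat /\ Q k <= P k)) as [(k & Hk & Ck)|NC].
  (* The walls meet in row [k]: the trap closes by itself and nothing has to be traded. *)
  - exists X. split; auto.
    destruct (Out X k) as [O1 O2]; auto.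
    + destruct k; olia.
    + intros x T. olia.
    + split; auto. apply card_mono; [apply crd_Fin; auto|].
      intros v (m & Hm & Ev & Bv & C). exists m. repeat split; auto.
      destruct C as [C|C]; auto.
  (* All caps lie in the last row [s0], so the trade only postpones deletions and respects every
     budget. Since the trap lies over [[lo, hi]], the count of the pruned front contains all of
     [inT], which pays for the caps. *)
  - pose (caps := fun v : Z * Z => fst v = y + zs /\ miss s0 (snd v)).
    pose (X'' := fun v => (X v /\ ~ inT v) \/ caps v).
    assert (FM : Fin (miss s0)) by (apply (trap_Fin _ s0); unfold miss; tauto).
    assert (FC : Fin caps).
    { apply Fin_slice; auto. }
    assert (CC : card caps <= card inT).
    { unfold caps. rewrite card_slice by auto. apply miss_bound. }
    assert (FX : Fin X) by apply HT.
    exists X''. destruct (Out X'' s0) as [O1 O2]; [olia| | |].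
    + intros i x K N. left. split; auto. intros (_ & k & Hk & E1 & T). simpl in *.
      apply N. assert (i = k) as -> by olia. auto.
    + intros x T. destruct (classic (R' s0 x)) as [K|K]; auto. right. right. right. split; auto.
      split; auto.
    + split; [|split; auto].
      * split.
        -- apply Fin_or; auto. apply (Fin_sub _ X); tauto.
        -- intros j. assert (T := proj2 HT j). etransitivity; [|exact T].
           destruct (Nat.lt_ge_cases j s0) as [Lj|Lj].
           ++ apply card_mono; [apply FinXle|]. intros v [[[? ?]|[? ?]] ?]; auto. olia.
           ++ rewrite (card_split (fun v => X v /\ fst v <= y + Z.of_nat j) inT) by apply FinXle.
              assert (card inT <= card (fun v => (X v /\ fst v <= y + Z.of_nat j) /\ inT v)).
              { apply card_mono; [apply (Fin_sub _ X); tauto|].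
                intros v (K & k & Hk & E1 & T'). repeat split; auto; [olia|]. exists k. auto. }
              assert (card (fun v => X'' v /\ fst v <= y + Z.of_nat j) <=
                card (fun v => (X v /\ fst v <= y + Z.of_nat j) /\ ~ inT v) + card caps); [|olia].
              etransitivity; [|apply card_or; auto; apply (Fin_sub _ X); tauto].
              apply card_mono; [apply Fin_or; auto; apply (Fin_sub _ X); tauto|].
              intros v [[[? ?]|?] ?]; auto.
      * assert (FCR := crd_Fin (a := a) (b := b) B y F' lo hi h FB).
        rewrite (card_split (crd B y F' lo hi h) inT) by auto.
        assert (card inT <= card (fun v => crd B y F' lo hi h v /\ inT v)).
        { apply card_mono; [apply (Fin_sub _ _ FCR); tauto|].
          intros v Hv. split; auto. destruct Hv as (K & k & Hk & E1 & T').
          destruct k; [olia|]. exists k. split; [olia|]. split; auto. split.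
          - right. destruct v; auto.
          - left. apply trap_range in T'; [olia|olia]. }
        assert (card (crd (withX D X'') y F lo hi h) <=
          card (fun v => crd B y F' lo hi h v /\ ~ inT v) + card caps); [|olia].
        etransitivity; [|apply card_or; auto; apply (Fin_sub _ _ FCR); tauto].
        apply card_mono; [apply Fin_or; auto; apply (Fin_sub _ _ FCR); tauto|].
        intros [i x] (k & Hk & Ev & Bv & C). simpl fst in *. simpl snd in *.
        destruct (classic (caps (i, x))) as [K|K]; auto. left.
        assert (Bv' : (D i x \/ X (i, x)) /\ ~ inT (i, x)).
        { destruct Bv as [Bv|[[Bv N]|Bv]]; [|split; auto|contradiction].
          split; auto. intros (_ & m & Hm & E1 & T). simpl in *.
          apply (Hfree m x); [olia| |congruence]. apply trap_range in T; olia. }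
        destruct Bv' as [Bv' NT]. split; auto.
        exists k. simpl fst. simpl snd. split; auto. split; auto. split; [exact Bv'|].
        destruct C as [C|C]; auto.
Qed.

End Trap.

Lemma exact_cell : exists X'', timed y X'' /\
  (forall x, reach (withX D X'') y F h x -> reach B y F' h x) /\
  card (crd (withX D X'') y F lo hi h) <= card (crd B y F' lo hi h).
Proof.
  destruct (survive (f - L)) as (P & P0 & PL & PP); [olia|onia|olia|].
  destruct (survive (f + 1)) as (Q & Q0 & QL & QQ); [onia|olia|olia|].
  apply (trap_case P Q); auto; olia.
Qed.

End Exact.
End Prune.

Lemma pred_ext {A} (P Q : A -> Prop) : (forall x, P x <-> Q x) -> P = Q.
Proof. intros H. apply functional_extensionality. intros x. apply propositional_extensionality, H. Qed.

(** * Subfronts that survive all admissible deletions, and small covers *)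

Section Thin.
Context {a b q : Z} {HO : Offsets a b q}.
Notation r := (a + b).
Notation ch := (ch a b).
Notation reach := (reach a b).
Notation pth := (pth a b).
Notation Good := (Good a b q).
Notation crd := (crd a b).
Notation timed := (timed q).

Definition alive (K : Z -> Prop) (D : Z -> Z -> Prop) (y : Z) (h : nat) : Prop :=
  forall X, timed y X -> exists x, reach (withX D X) y K h x.

Lemma alive_mono K K' D y h h' : (h' <= h)%nat -> (forall z, K z -> K' z) ->
  alive K D y h -> alive K' D y h'.
Proof.
  intros Hh HK H X T. destruct (H X T) as (x & Hx).
  apply (reach_ne_le _ _ _ _ h); auto. exists x. revert Hx. apply reach_mono; auto.
Qed.

(** The cells are removed one by one; the density is assumed for the final set [K], hence holds for
    every intermediate front. As [K] survives all admissible deletions, the count ends in row [h],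
    the only row for which [exact_cell] compares the fronts. *)
Lemma Good_prune F K D y lo hi h L Y (J s0 : nat) beta :
  Fin F -> FinD D -> (1 <= J <= s0)%nat -> (s0 <= h)%nat ->
  q * Z.of_nat J * (r * Z.of_nat J + 1) <= r * (Z.of_nat s0 - Z.of_nat J) ->
  r * Z.of_nat J + q * Z.of_nat J * (r * Z.of_nat J + 1) + q * Z.of_nat s0 < L ->
  L + r * Z.of_nat s0 <= Y ->
  (forall z, K z -> F z) -> alive K D y h ->
  (forall f, F f -> ~ K f ->
    (forall k x, (1 <= k <= s0)%nat -> f - Y <= x <= f + Y -> ~ D (y + Z.of_nat k) x) /\
    (forall x, f - Y <= x -> x + r * Z.of_nat J <= f + Y ->
       exists g, K g /\ x <= g <= x + r * Z.of_nat J) /\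
    lo + Y + 1 <= f <= hi - Y - 1) ->
  Good F D y lo hi h beta -> Good K D y lo hi h beta.
Proof.
  intros HF HD HJ Hs HE HL HY HK HA HP.
  assert (Main : forall l G, (forall z, K z -> G z) -> (forall z, G z -> F z) ->
    (forall z, G z -> K z \/ In z l) -> Good G D y lo hi h beta -> Good K D y lo hi h beta).
  { induction l as [|f l IH]; intros G H1 H2 H3 GG.
    - replace K with G; auto. apply pred_ext. intros z. split; auto.
      intros Hz. destruct (H3 z Hz) as [?|[]]; auto.
    - destruct (classic (G f /\ ~ K f)) as [[Gf Kf]|N].
      + apply (IH (fun z => G z /\ z <> f)).
        * intros z Hz. split; auto. congruence.
        * intros z [Hz _]; auto.
        * intros z [Hz N]. destruct (H3 z Hz) as [?|[?|?]]; auto. congruence.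
        * destruct (HP f) as (P1' & P2' & P3'); auto.
          intros X T j Hj En St.
          assert (FG : Fin G) by (apply (Fin_sub _ F); auto).
          destruct (@exact_cell a b q HO G D y lo hi h f L Y J s0 X) as (X'' & T'' & R'' & C''); auto.
          { intros x Hx1 Hx2. destruct (P2' x Hx1 Hx2) as (g & Kg & Hg). exists g.
            split; auto. split; auto. congruence. }
          assert (AG : alive (fun z => G z /\ z <> f) D y h).
          { apply (alive_mono K _ D y h h); auto. intros z Kz. split; auto. congruence. }
          assert (j = h) as ->.
          { destruct St as [St|St]; auto. exfalso.
            destruct (AG X T) as (x & Hx).
            destruct (reach_ne_le _ _ _ j h Hj (ex_intro _ x Hx)) as (x' & Hx'). apply (St x' Hx'). }
          assert (Al : alive G D y h) by (apply (alive_mono K _ D y h h); auto).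
          assert (V := GG X'' T'' h (le_n h)).
          assert (V' : beta <= card (reach (withX D X'') y G h)
            + card (crd (withX D X'') y G lo hi h) - r * Z.of_nat h).
          { apply V; auto. intros i Hi. apply (alive_mono G G D y h i); auto. lia. }
          assert (card (reach (withX D X'') y G h) <=
            card (reach (withX D X) y (fun z => G z /\ z <> f) h)); [|lia].
          apply card_mono; auto. apply reach_Fin. apply (Fin_sub _ G); tauto.
      + apply (IH G); auto. intros z Hz. destruct (H3 z Hz) as [?|[?|?]]; auto.
        subst z. left. apply NNPP. tauto. }
  destruct HF as [l Hl]. intros GF. apply (Main l F); auto.
Qed.

(* Cells that do not lead to the row [j0] only matter through keeping the front alive until it
   reaches that row. *)
Lemma Good_anc F K D y lo hi h (j0 : nat) beta :
  Fin F -> FinD D -> (j0 <= h)%nat -> (forall z, K z -> F z) ->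
  (forall f, F f -> (exists x, reach D y (eq f) j0 x) -> K f) ->
  (forall f, F f -> f - a * Z.of_nat h < lo \/ hi < f + b * Z.of_nat h -> K f) ->
  (forall i, (i < j0)%nat -> alive K D y i) ->
  Good F D y lo hi h beta -> Good K D y lo hi h beta.
Proof.
  intros HF HD Hj0 HK H1 H2 HA G X T j Hj En St.
  assert (FB : FinD (withX D X)) by (apply withX_Fin; auto; apply T).
  assert (Hjj : (j0 <= j)%nat).
  { destruct St as [->|St]; auto. destruct (Nat.le_gt_cases j0 j) as [?|L]; auto. exfalso.
    destruct (HA j L X T) as (x & Hx). apply (St x Hx). }
  assert (RE : forall i x, (j0 <= i)%nat -> reach (withX D X) y F i x -> reach (withX D X) y K i x).
  { intros i x Hi Hx. apply reach_split in Hx as (f & Ff & Hx).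
    apply reach_split. exists f. split; auto. apply H1; auto.
    destruct (reach_ne_le _ _ _ j0 i Hi (ex_intro _ x Hx)) as (x' & Hx'). exists x'.
    revert Hx'. apply reach_mono; auto. intros; left; auto. }
  assert (V : beta <= card (reach (withX D X) y F j) + card (crd (withX D X) y F lo hi j) - r * Z.of_nat j).
  { apply G; auto.
    - intros i Hi. destruct (En i Hi) as (x & Hx). exists x. revert Hx. apply reach_mono; auto.
    - destruct St as [St|St]; auto. right. intros x Hx. apply (St x), RE; auto. }
  assert (FK : Fin K) by (apply (Fin_sub _ F); auto).
  assert (card (reach (withX D X) y F j) <= card (reach (withX D X) y K j)).
  { apply card_mono; [apply reach_Fin; auto|]. intros; apply RE; auto. }
  assert (card (crd (withX D X) y F lo hi j) <= card (crd (withX D X) y K lo hi j)); [|lia].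
  apply card_mono; [apply crd_Fin; auto|].
  intros v (k & Hk & Ev & Bv & C). exists k. repeat split; auto.
  destruct C as [C|(z & Hz & Hx)]; auto.
  destruct (classic (lo <= snd v <= hi)) as [I|I]; auto. right. exists z. split; auto.
  apply reach_split in Hz as (f & Ff & Hz). apply reach_split. exists f. split; auto.
  apply H2; auto.
  assert (Rg := reach_range (withX D X) y (eq f) k z f f ltac:(intros; lia) Hz).
  assert (a * (Z.of_nat k + 1) <= a * Z.of_nat h) by (useoff; apply Z.mul_le_mono_nonneg_l; lia).
  assert (b * (Z.of_nat k + 1) <= b * Z.of_nat h) by (useoff; apply Z.mul_le_mono_nonneg_l; lia).
  lia.
Qed.

(** What the old deletions [EE] and the future ones do not shade of [U] is still reached in row [h],
    so a sufficiently large [U] gives the bound without any comparison with the unpruned front. *)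
Lemma Good_rich K U (EE : Z * Z -> Prop) D y lo hi h rho beta :
  Fin K -> FinD D -> Fin U -> Fin EE -> Z.of_nat h <= rho -> alive K D y h ->
  (forall x, U x -> ~ reach D y K h x -> exists v : Z * Z, EE v /\ x - rho <= snd v <= x + rho) ->
  beta <= card U - (2 * rho + 1) * (card EE + q * Z.of_nat h)
    + card (fun v : Z * Z => y < fst v <= y + Z.of_nat h /\ lo <= snd v <= hi /\ D (fst v) (snd v))
    - r * Z.of_nat h ->
  Good K D y lo hi h beta.
Proof.
  intros HK HD HU HEE Hrho HA HU' Hbeta X T j Hj En St.
  assert (FB : FinD (withX D X)) by (apply withX_Fin; auto; apply T).
  assert (j = h) as ->.
  { destruct St as [St|St]; auto. exfalso. destruct (HA X T) as (x & Hx).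
    destruct (reach_ne_le _ _ _ j h Hj (ex_intro _ x Hx)) as (x' & Hx'). apply (St x' Hx'). }
  assert (FXh : Fin (fun v => X v /\ fst v <= y + Z.of_nat h)) by (apply (Fin_sub _ X); [apply T|tauto]).
  assert (C1 : card U <= card (reach (withX D X) y K h) + (2 * rho + 1) * (card EE + q * Z.of_nat h)).
  { rewrite (card_split U (reach (withX D X) y K h) HU).
    assert (card (fun x => U x /\ reach (withX D X) y K h x) <= card (reach (withX D X) y K h)).
    { apply card_mono; [apply reach_Fin; auto|tauto]. }
    assert (C : card (fun x => U x /\ ~ reach (withX D X) y K h x) <= (rho + rho + 1) *
      card (fun v : Z * Z => EE v \/ (X v /\ fst v <= y + Z.of_nat h))).
    { apply (card_near snd); try lia; [apply (Fin_sub _ U); tauto|apply Fin_or; auto|].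
      intros x [Ux N]. destruct (classic (reach D y K h x)) as [R|R].
      - destruct (lost_cone _ _ _ _ _ _ R N) as (k & z & Hk & B & NB & Hz).
        exists (y + Z.of_nat (S k), z). cbn [fst snd]. split.
        + right. split; [|lia]. destruct B; tauto.
        + assert (OM := off_mul (Z.of_nat h) ltac:(lia)).
          lia.
      - destruct (HU' x Ux R) as (v & Ev & Hv). exists v. auto. }
    assert (C2 := card_or _ _ HEE FXh). assert (C3 := timed_le y X h T). cbv beta in C2.
    assert (M : (rho + rho + 1) * card (fun v : Z * Z => EE v \/ (X v /\ fst v <= y + Z.of_nat h)) <=
      (rho + rho + 1) * (card EE + q * Z.of_nat h)) by (apply Z.mul_le_mono_nonneg_l; lia).
    replace (rho + rho + 1) with (2 * rho + 1) in * by lia. lia. }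
  assert (C2 : card (fun v : Z * Z => y < fst v <= y + Z.of_nat h /\ lo <= snd v <= hi /\ D (fst v) (snd v))
    <= card (crd (withX D X) y K lo hi h)).
  { apply card_mono; [apply crd_Fin; auto|].
    intros v (H1 & H2 & H3). exists (Z.to_nat (fst v - y - 1)). split; [lia|]. split; [lia|].
    split; [left; auto|auto]. }
  lia.
Qed.

Lemma minimal_cover F D y (J : nat) : Fin F ->
  exists K, (forall z, K z -> F z) /\ (forall x, reach D y F J x -> reach D y K J x) /\
    (forall f, K f -> exists x, reach D y K J x /\ ~ reach D y (fun z => K z /\ z <> f) J x).
Proof.
  intros HF.
  assert (Main : forall n K, Fin K -> card K <= Z.of_nat n -> (forall z, K z -> F z) ->
    (forall x, reach D y F J x -> reach D y K J x) ->
    exists K', (forall z, K' z -> F z) /\ (forall x, reach D y F J x -> reach D y K' J x) /\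
    (forall f, K' f -> exists x, reach D y K' J x /\ ~ reach D y (fun z => K' z /\ z <> f) J x)).
  { induction n; intros K FK HC H1 H2.
    - exists K. split; auto. split; auto. intros f Kf. assert (C := card_pos K f FK Kf). lia.
    - destruct (classic (exists f, K f /\ forall x, reach D y K J x ->
        reach D y (fun z => K z /\ z <> f) J x)) as [(f & Kf & Hf)|N].
      + apply (IHn (fun z => K z /\ z <> f)); auto.
        * apply (Fin_sub _ K); tauto.
        * rewrite (card_split K (fun z => z <> f) FK) in HC.
          assert (1 <= card (fun z => K z /\ ~ z <> f)); [|lia].
          apply (card_pos _ f); [apply (Fin_sub _ K); tauto|tauto].
        * intros z [Kz _]; auto.
      + exists K. split; auto. split; auto. intros f Kf. apply NNPP. intros N'. apply N.
        exists f. split; auto. intros x Hx. apply NNPP. intros N''. apply N'. eauto. }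
  apply (Main (Z.to_nat (card F)) F); auto. lia.
Qed.

Lemma card_three (P : Z -> Prop) : Fin P -> 3 <= card P -> exists x1 x2 x3, x1 < x2 < x3 /\ P x1 /\ P x2 /\ P x3.
Proof.
  intros H C. destruct (card_spec P H) as (l & Hn & Hl & E).
  destruct l as [|u [|v [|w l]]]; simpl in E; try lia.
  assert (Pu : P u) by (apply Hl; simpl; auto).
  assert (Pv : P v) by (apply Hl; simpl; auto).
  assert (Pw : P w) by (apply Hl; simpl; auto).
  inversion Hn as [|? ? N1 Hn']; subst. inversion Hn' as [|? ? N2 _]; subst. simpl in *.
  assert (u <> v) by (intros ->; apply N1; auto).
  assert (u <> w) by (intros ->; apply N1; auto).
  assert (v <> w) by (intros ->; apply N2; auto).
  destruct (Z.lt_trichotomy u v) as [A|[A|A]]; [|lia|];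
  destruct (Z.lt_trichotomy u w) as [B|[B|B]]; try lia;
  destruct (Z.lt_trichotomy v w) as [C'|[C'|C']]; try lia.
  - exists u, v, w. auto.
  - exists u, w, v. auto.
  - exists w, u, v. auto.
  - exists v, u, w. auto.
  - exists v, w, u. auto.
  - exists w, v, u. auto.
Qed.

(* Every reachable or blocked cell is touched by at most two cells of a minimal cover: of three,
   the middle one would be redundant. *)
Lemma cover F D y (J : nat) : Fin F -> FinD D -> (1 <= J)%nat ->
  exists K, (forall z, K z -> F z) /\ (forall x, reach D y F J x -> reach D y K J x) /\
    card K * (r * Z.of_nat J + 1) <= 2 * (card (reach D y F J) +
      card (fun v : Z * Z => D (fst v) (snd v))).
Proof.
  intros HF HD HJ. destruct (minimal_cover F D y J HF) as (K & H1 & H2 & H3).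
  exists K. split; auto. split; auto.
  assert (FK : Fin K) by (apply (Fin_sub _ F); auto).
  assert (FR := Fin_slice (y + Z.of_nat J) _ (reach_Fin D y F J HF)).
  pose (Q := fun v : Z * Z => (fst v = y + Z.of_nat J /\ reach D y F J (snd v)) \/ D (fst v) (snd v)).
  pose (R := fun (f : Z) (v : Z * Z) => exists k, (k < J)%nat /\ fst v = y + Z.of_nat (S k) /\
    ch (reach D y (eq f) k) (snd v)).
  assert (FQ : Fin Q) by (apply Fin_or; auto).
  assert (Prv : forall f, K f -> exists p, p O = f /\ pth D y p 0 J /\
    ~ reach D y (fun z => K z /\ z <> f) J (p J)).
  { intros f Kf. destruct (H3 f Kf) as (x & Hx & N).
    destruct (pth_reach _ _ _ _ _ Hx) as (p & P0 & PJ & P). exists p.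
    rewrite PJ. split; [|split; auto].
    apply NNPP. intros E. apply N. rewrite <- PJ.
    apply (reach_pth _ _ _ p 0); auto; [lia|simpl; auto]. }
  assert (CQ : card Q <= card (reach D y F J) + card (fun v : Z * Z => D (fst v) (snd v))).
  { etransitivity; [apply card_or; auto|]. rewrite card_slice by (apply reach_Fin; auto). lia. }
  transitivity (2 * card Q); [|lia].
  apply (card_double K Q R); auto; [lia| |].
  - intros f Kf. destruct (Prv f Kf) as (p & P0 & P & _).
    assert (Ff : Fin (eq f)) by (exists [f]; intros x <-; simpl; auto).
    assert (RP : forall k, (k <= J)%nat -> reach D y (eq f) k (p k)).
    { intros k Hk. apply (reach_pth _ _ _ p 0); auto; [lia|simpl; auto|].
      intros i Hi. apply P. lia. }
    (* The interval [[1, 0]] is empty, so only blocked cells met by descendants of [f] are counted.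
       Together with the descendants in row [J] they number at least [r J + 1]. *)
    assert (G := pot_mono D y (eq f) 1 0 0 J Ff HD ltac:(lia)
      (fun k Hk => ex_intro _ (p k) (RP k ltac:(lia)))).
    rewrite card_crd_0 in G. cbn [reach] in G.
    rewrite (card_single f (eq f)) in G by (intros; split; auto).
    assert (C1 := card_slice (y + Z.of_nat J) _ (reach_Fin D y (eq f) J Ff)).
    assert (Ff' := Fin_slice (y + Z.of_nat J) _ (reach_Fin D y (eq f) J Ff)).
    assert (C2 : card (fun v : Z * Z => fst v = y + Z.of_nat J /\ reach D y (eq f) J (snd v)) +
      card (crd D y (eq f) 1 0 J) <= card (fun v => Q v /\ R f v)); [|lia].
    rewrite <- card_disj; auto; [|apply crd_Fin; auto|].
    + apply card_mono; [apply (Fin_sub _ Q); tauto|].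
      intros v [[E1 E2]|(k & Hk & Ev & Bv & C)].
      * split.
        -- left. split; auto. revert E2. apply reach_mono; auto. intros z <-; auto.
        -- destruct J as [|k]; [lia|]. exists k. split; [lia|]. split; auto. apply E2.
      * split; [right; auto|]. exists k. destruct C as [C|C]; [lia|]. auto.
    + intros v [E1 E2] (k & Hk & Ev & Bv & C). destruct J as [|j]; [lia|].
      rewrite E1 in Bv. apply (proj2 E2). auto.
  - intros v _. apply Z.nlt_ge. intros L.
    destruct (card_three (fun f => K f /\ R f v)) as (f1 & f2 & f3 & Lt & (K1 & R1) & (K2 & R2) & (K3 & R3));
      [apply (Fin_sub _ K); tauto|lia|].
    destruct R1 as (k & Hk & Ev & z1 & Hz1 & Hx1).
    destruct R3 as (k3 & Hk3 & Ev3 & z3 & Hz3 & Hx3).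
    assert (k3 = k) as -> by lia. clear R2 Ev3 Hk3.
    destruct (Prv f2 K2) as (p & P0 & P & N).
    destruct (pth_reach _ _ _ _ _ Hz1) as (p1 & P10 & P1k & PP1).
    destruct (pth_reach _ _ _ _ _ Hz3) as (p3 & P30 & P3k & PP3).
    pose (K' := fun z => K z /\ z <> f2). fold K' in N.
    assert (RR1 : forall i, (i <= k)%nat -> reach D y K' i (p1 i)).
    { intros i Hi. apply (reach_pth _ _ _ p1 0); [lia| |].
      - simpl. split; [congruence|lia].
      - intros m Hm. apply PP1. lia. }
    assert (RR3 : forall i, (i <= k)%nat -> reach D y K' i (p3 i)).
    { intros i Hi. apply (reach_pth _ _ _ p3 0); [lia| |].
      - simpl. split; [congruence|lia].
      - intros m Hm. apply PP3. lia. }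
    assert (M : forall i, (i <= k)%nat -> reach D y K' i (p i) \/ (p1 i < p i < p3 i)).
    { induction i as [|i IH]; intros Hi; [right; lia|].
      destruct (P i) as [St Nb]; [lia|].
      destruct (IH ltac:(lia)) as [W|W].
      - left. split; auto. exists (p i). auto.
      - destruct (Z.le_gt_cases (p (S i)) (p1 (S i))) as [V|V].
        + left. apply (crossing _ _ _ p1); auto; [apply RR1; lia|apply PP1; lia|]. left. split; [lia|auto].
        + destruct (Z.le_gt_cases (p3 (S i)) (p (S i))) as [V'|V'].
          * left. apply (crossing _ _ _ p3); auto; [apply RR3; lia|apply PP3; lia|]. right. split; [lia|auto].
          * right. lia. }
    apply N. apply (reach_pth _ _ _ p (S k)); [lia| |intros i Hi; apply P; lia].
    destruct (P k) as [St Nb]; [lia|]. split; auto.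
    destruct (M k (le_n k)) as [W|W]; [exists (p k); auto|].
    (* [p1 k] and [p3 k] have the common child [snd v], so their children leave no gap for a path
       running between them. *)
    destruct (Z.le_gt_cases (p (S k)) (p1 k + b)) as [V|V].
    + exists (p1 k). split; [apply RR1; lia|]. lia.
    + exists (p3 k). split; [apply RR3; lia|]. lia.
Qed.

End Thin.
Arguments alive : clear implicits.

(** * Maintaining a sparse front *)

Section Strip.
Context {a b q : Z} {HO : Offsets a b q}.
Notation r := (a + b).
Notation ch := (ch a b).
Notation reach := (reach a b).
Notation pth := (pth a b).
Notation Good := (Good a b q).
Notation crd := (crd a b).
Notation timed := (timed q).
Notation alive := (alive a b q).

Definition lend (F : Z -> Prop) (x : Z) : Prop := F x /\ ~ F (x - 1).

Definition rends (U : Z -> Z -> Prop) (i0 i1 : Z) : Z * Z -> Prop :=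
  fun v => i0 <= fst v < i1 /\ rend (U (fst v)) (snd v).

Definition lends (U : Z -> Z -> Prop) (i0 i1 : Z) : Z * Z -> Prop :=
  fun v => i0 <= fst v < i1 /\ lend (U (fst v)) (snd v).

Lemma rows_Fin (U : Z -> Z -> Prop) i0 i1 : (forall i, i0 <= i < i1 -> Fin (U i)) ->
  Fin (fun v : Z * Z => i0 <= fst v < i1 /\ U (fst v) (snd v)).
Proof.
  intros H. assert (G : forall n, (forall i, i0 <= i < i0 + Z.of_nat n -> Fin (U i)) ->
    Fin (fun v : Z * Z => i0 <= fst v < i0 + Z.of_nat n /\ U (fst v) (snd v))).
  { induction n; intros Hn.
    - apply Fin_empty. intros v [? _]. lia.
    - apply (Fin_sub _ (fun v : Z * Z => (i0 <= fst v < i0 + Z.of_nat n /\ U (fst v) (snd v)) \/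
        (fst v = i0 + Z.of_nat n /\ U (i0 + Z.of_nat n) (snd v)))).
      + apply Fin_or; [apply IHn; intros; apply Hn; lia|]. apply Fin_slice, Hn. lia.
      + intros v [L K]. assert (fst v < i0 + Z.of_nat n \/ fst v = i0 + Z.of_nat n) as [?|E] by lia.
        * left. split; auto. lia.
        * right. rewrite E in K. auto. }
  destruct (Z.le_gt_cases i1 i0).
  - apply Fin_empty. intros v [? _]. lia.
  - specialize (G (Z.to_nat (i1 - i0))). replace (i0 + Z.of_nat (Z.to_nat (i1 - i0))) with i1 in G by lia.
    auto.
Qed.

Lemma rends_Fin U i0 i1 : (forall i, i0 <= i < i1 -> Fin (U i)) -> Fin (rends U i0 i1).
Proof. intros H. apply (Fin_sub _ _ (rows_Fin U i0 i1 H)). intros v [? [? _]]. auto. Qed.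

(** No matching of the ends is needed: extending every run by one cell to the left or to the right
    gives the same set up to a shift. *)
Lemma card_lends U i0 i1 : (forall i, i0 <= i < i1 -> Fin (U i)) ->
  card (lends U i0 i1) = card (rends U i0 i1).
Proof.
  intros H. assert (FU := rows_Fin U i0 i1 H).
  set (S := fun v : Z * Z => i0 <= fst v < i1 /\ U (fst v) (snd v)) in *.
  assert (FL : Fin (lends U i0 i1)).
  { apply (Fin_sub _ S); auto. intros v [? [? _]]. split; auto. }
  assert (FRr := rends_Fin U i0 i1 H).
  assert (Sh : forall (P : Z * Z -> Prop) c, Fin P -> Fin (fun v => P (fst v, snd v + c)) /\
    card (fun v => P (fst v, snd v + c)) = card P).
  { intros P c HP. split.
    - apply (Fin_inj (fun v => (fst v, snd v + c)) _ P); auto.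
      intros [u v] [u' v'] _ _ E. simpl in E. f_equal; congruence || (injection E; lia).
    - apply (card_bij (fun v => (fst v, snd v + c)) (fun v => (fst v, snd v - c))); auto.
      + intros [u v] K. split; auto. simpl. f_equal. lia.
      + intros [u v] K. simpl. replace (v - c + c) with v by lia. auto. }
  assert (E1 : card (fun v => S v \/ lends U i0 i1 (fst v, snd v + 1)) = card S + card (lends U i0 i1)).
  { rewrite card_disj, (proj2 (Sh _ 1 FL)); auto; [apply Sh; auto|].
    intros [u v] [_ K] [_ [_ N]]. simpl in *. apply N. replace (v + 1 - 1) with v by lia. auto. }
  assert (E2 : card (fun v => S v \/ rends U i0 i1 (fst v, snd v + -1)) = card S + card (rends U i0 i1)).
  { rewrite card_disj, (proj2 (Sh _ (-1) FRr)); auto; [apply Sh; auto|].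
    intros [u v] [_ K] [_ [_ N]]. simpl in *. apply N. replace (v + -1 + 1) with v by lia. auto. }
  assert (F2 := Fin_or _ _ FU (proj1 (Sh _ (-1) FRr))).
  rewrite <- (proj2 (Sh _ 1 F2)) in E2.
  enough (E3 : card (fun v => S v \/ lends U i0 i1 (fst v, snd v + 1)) = card S + card (rends U i0 i1)) by lia.
  rewrite <- E2. apply card_ext; [apply (Sh _ 1 F2)|].
  intros [u v]. unfold S, lends, rends, lend, rend. cbn [fst snd].
  replace (v + 1 - 1) with v by lia. replace (v + 1 + -1) with v by lia. tauto.
Qed.

Lemma pot_sum Bk y F lo hi (i j : nat) : Fin F -> FinD Bk -> (i <= j)%nat ->
  (forall k, (i <= k < j)%nat -> exists x, reach Bk y F k x) ->
  card (reach Bk y F i) + card (crd Bk y F lo hi i) - r * Z.of_nat i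
    + card (rends (fun k => reach Bk y F (Z.to_nat (k - y))) (y + Z.of_nat i) (y + Z.of_nat j))
    - (Z.of_nat j - Z.of_nat i) <=
  card (reach Bk y F j) + card (crd Bk y F lo hi j) - r * Z.of_nat j.
Proof.
  intros H K L E. induction L as [|m L IH].
  - rewrite (card_empty (rends _ _ _)); [lia|]. intros v [? _]. lia.
  - assert (G := pot_grow Bk y F lo hi m H K (E m ltac:(lia))).
    specialize (IH (fun k Hk => E k ltac:(lia))).
    assert (FU : forall i, Fin (reach Bk y F i)) by (intros; apply reach_Fin; auto).
    set (U := fun k => reach Bk y F (Z.to_nat (k - y))) in *.
    assert (C : card (rends U (y + Z.of_nat i) (y + Z.of_nat (S m))) <=
      card (rends U (y + Z.of_nat i) (y + Z.of_nat m)) + card (rend (reach Bk y F m))).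
    { rewrite (card_split _ (fun v => fst v < y + Z.of_nat m)) by (apply rends_Fin; intros; apply FU).
      apply Z.add_le_mono.
      - apply card_mono; [apply rends_Fin; intros; apply FU|]. intros v [[? ?] ?]. split; auto. lia.
      - apply (card_le_inj snd); [apply rend_Fin; auto| |].
        + intros v [[L1 R] L2]. unfold U in R. replace (Z.to_nat (fst v - y)) with m in R by lia. auto.
        + intros [u v] [u' v'] [[L1 _] L2] [[L3 _] L4] E3. simpl in *. f_equal; auto. lia. }
    lia.
Qed.

Definition dcount (D : Z -> Z -> Prop) (y i lo hi : Z) : Z :=
  card (fun v : Z * Z => y < fst v <= i /\ lo <= snd v <= hi /\ D (fst v) (snd v)).

Lemma dc_Fin D y i lo hi : FinD D ->
  Fin (fun v : Z * Z => y < fst v <= i /\ lo <= snd v <= hi /\ D (fst v) (snd v)).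
Proof. intros H. apply (Fin_sub _ _ H). tauto. Qed.

Lemma card_box i0 i1 j0 j1 : i0 <= i1 + 1 -> j0 <= j1 + 1 ->
  card (fun v : Z * Z => i0 <= fst v <= i1 /\ j0 <= snd v <= j1) <= (i1 - i0 + 1) * (j1 - j0 + 1).
Proof.
  intros L1 L2.
  rewrite <- (card_interval i0 i1) by auto. rewrite (Z.mul_comm (card _)).
  apply (card_fiber _ _ (fun (v : Z * Z) i => fst v = i)).
  - apply (Fin_prod (fun i => i0 <= i <= i1) (fun i => j0 <= i <= j1)); apply Fin_interval.
  - apply Fin_interval.
  - lia.
  - intros v [? ?]. exists (fst v). auto.
  - intros i _. rewrite <- (card_interval j0 j1) by auto.
    apply (card_le_inj snd); [apply Fin_interval|tauto|].
    intros [u v] [u' v'] [_ E1] [_ E2] E3. simpl in *. congruence.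
Qed.

(** Outside of [[lo, hi]] the front touches only two triangles of height [j]. *)
Lemma crd_upper D y F lo hi (j : nat) : FinD D -> (forall x, F x -> lo <= x <= hi) ->
  card (crd D y F lo hi j) <= dcount D y (y + Z.of_nat j) lo hi + 2 * Z.of_nat j * Z.of_nat j.
Proof.
  intros HD HF. set (n := Z.of_nat j).
  set (O1 := fun v : Z * Z => y + 1 <= fst v <= y + n /\ lo - n <= snd v <= lo - 1).
  set (O2 := fun v : Z * Z => y + 1 <= fst v <= y + n /\ hi + 1 <= snd v <= hi + n).
  assert (n0 : 0 <= n) by (unfold n; lia).
  assert (F1 : Fin O1) by (apply (Fin_prod (fun i => y + 1 <= i <= y + n) (fun i => lo - n <= i <= lo - 1)); apply Fin_interval).
  assert (F2 : Fin O2) by (apply (Fin_prod (fun i => y + 1 <= i <= y + n) (fun i => hi + 1 <= i <= hi + n)); apply Fin_interval).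
  assert (B1 : card O1 <= n * n).
  { etransitivity; [apply card_box; lia|]. apply Z.eq_le_incl. ring. }
  assert (B2 : card O2 <= n * n).
  { etransitivity; [apply card_box; lia|]. apply Z.eq_le_incl. ring. }
  assert (C1 := card_or _ _ F1 F2).
  assert (C2 := card_or _ _ (dc_Fin D y (y + n) lo hi HD) (Fin_or _ _ F1 F2)).
  assert (C : card (crd D y F lo hi j) <= card (fun x => (fun v : Z * Z =>
    y < fst v <= y + n /\ lo <= snd v <= hi /\ D (fst v) (snd v)) x \/ (O1 x \/ O2 x))).
  { apply card_mono; [apply Fin_or; [apply dc_Fin; auto|apply Fin_or; auto]|].
    intros v (k & Hk & Ev & Bv & C). destruct (classic (lo <= snd v <= hi)) as [I|I].
    - left. repeat split; auto; lia.
    - right. destruct C as [C|(z & Hz & Hx)]; [contradiction|].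
      apply (reach_range _ _ _ _ _ lo hi) in Hz; auto.
      assert (OM := off_mul (Z.of_nat k) ltac:(lia)).
      assert (Z.of_nat k + 1 <= n) by (unfold n; lia). unfold O1, O2. useoff. lia. }
  unfold dcount. fold n. cbv beta in *. lia.
Qed.

Lemma crd_lower D y F lo hi (j : nat) : FinD D ->
  dcount D y (y + Z.of_nat j) lo hi <= card (crd D y F lo hi j).
Proof.
  intros HD. apply card_mono; [apply crd_Fin; auto|].
  intros v (H1 & H2 & H3). exists (Z.to_nat (fst v - y - 1)). split; [lia|]. split; [lia|].
  split; auto.
Qed.

(* The strips have length [sw w]; [w] is about the seventh root of the time. *)
Definition sw (w : Z) : Z := 13 * (w * w).
Definition w4 (w : Z) : Z := (w * w) * (w * w).
(** Twice [sw w]: at most two strips are in view, and a path moves sideways by at most one cell per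
    row. *)
Definition rho (w : Z) : Z := 26 * (w * w).

(* [F] is the front in row [y], [U i] the set of cells of row [i] that it could reach when the row
   came into view, [E1] and [E2] the later deletions (of the previous and of the current strip).
   Unless the front is about to die, either there are few interval ends in view, so that nearly all
   of the front is in regions that can be thinned out without any loss, or the front is so far ahead
   of its guaranteed size [beta] that the losses from thinning it out everywhere do not matter. *)
Record St (w y y1 lo hi : Z) (F : Z -> Prop) (D : Z -> Z -> Prop) (beta : Z)
    (U : Z -> Z -> Prop) (E1 E2 : Z * Z -> Prop) : Prop := {
  st_w : 1 <= w;
  st_y : y <= y1 <= y + sw w;
  st_F : Fin F;
  st_ne : exists x, F x;
  st_range : forall x, F x -> lo <= x <= hi;
  st_D : FinD D;
  st_good : Good F D y lo hi (Z.to_nat (y1 + sw w - y)) beta;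
  st_U : forall i, Fin (U i);
  st_b1 : forall i x, y < i <= y1 + sw w -> U i x -> D i x -> E2 (i, x) \/ (i < y1 /\ E1 (i, x));
  st_b2 : forall i x, y + w <= i <= y1 + sw w -> U i x ->
    reach D y F (Z.to_nat (i - y)) x \/
    exists v, (E2 v \/ (i < y1 /\ E1 v)) /\ x - rho w <= snd v <= x + rho w;
  st_b3 : forall i x, y < i <= y1 + sw w -> reach D y F (Z.to_nat (i - y)) x -> U i x;
  st_E1 : Fin E1;
  st_E2 : Fin E2;
  st_c1 : card E1 <= q * sw w;
  st_c2 : card E2 + q * (y1 - y) <= q * sw w;
  st_mode : (exists i, y < i <= y1 + sw w /\ forall x, ~ reach D y F (Z.to_nat (i - y)) x) \/
    ((card (rends U (y + 1) (y1 + sw w)) <= 324000 * w4 w \/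
      beta + 8300 * w4 w <= card (U (y1 + sw w)) + dcount D y (y1 + sw w) lo hi - r * (y1 + sw w - y)) /\
     (card (rends U y1 (y1 + sw w)) <= 162000 * w4 w \/
      beta + 160000 * w4 w <= card (U (y1 + sw w)) + dcount D y (y1 + sw w) lo hi - r * (y1 + sw w - y)))
}.

Global Arguments st_w {w y y1 lo hi F D beta U E1 E2}.
Global Arguments st_y {w y y1 lo hi F D beta U E1 E2}.
Global Arguments st_F {w y y1 lo hi F D beta U E1 E2}.
Global Arguments st_ne {w y y1 lo hi F D beta U E1 E2}.
Global Arguments st_range {w y y1 lo hi F D beta U E1 E2}.
Global Arguments st_D {w y y1 lo hi F D beta U E1 E2}.
Global Arguments st_good {w y y1 lo hi F D beta U E1 E2}.
Global Arguments st_U {w y y1 lo hi F D beta U E1 E2}.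
Global Arguments st_b1 {w y y1 lo hi F D beta U E1 E2}.
Global Arguments st_b2 {w y y1 lo hi F D beta U E1 E2}.
Global Arguments st_b3 {w y y1 lo hi F D beta U E1 E2}.
Global Arguments st_E1 {w y y1 lo hi F D beta U E1 E2}.
Global Arguments st_E2 {w y y1 lo hi F D beta U E1 E2}.
Global Arguments st_c1 {w y y1 lo hi F D beta U E1 E2}.
Global Arguments st_c2 {w y y1 lo hi F D beta U E1 E2}.
Global Arguments st_mode {w y y1 lo hi F D beta U E1 E2}.

Lemma sw_pos w : 1 <= w -> 13 <= sw w.
Proof. unfold sw. nia. Qed.

(** The view [U] is not updated. Cells of it that are lost through [E] are attributed to [E2], whose
    budget [st_c2] reserves [q] cells for each row left in the strip. *)
Lemma St_advance w y y1 lo hi F D beta U E1 E2 D' E lo' hi' :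
  St w y y1 lo hi F D beta U E1 E2 -> y < y1 -> Fin E -> card E <= q ->
  (forall i x, D' i x <-> D i x \/ E (i, x)) -> lo' <= lo -> hi <= hi' ->
  (exists x, reach D' y F 1 x) -> (forall x, reach D' y F 1 x -> lo' <= x <= hi') ->
  St w (y + 1) y1 lo' hi' (reach D' y F 1) D' (beta + r - card (crow a b D' y F lo hi 0))
    U E1 (fun v => E2 v \/ E v).
Proof.
  intros S Hy FE CE HD' Hlo Hhi NE Rg. destruct S.
  assert (SW := sw_pos w st_w0).
  assert (FD' : FinD D').
  { apply (Fin_sub _ (fun v => D (fst v) (snd v) \/ E v)); [apply Fin_or; auto|].
    intros [i x] K. apply HD' in K. auto. }
  assert (Sh : forall i x, y + 1 <= i -> (reach D' (y + 1) (reach D' y F 1) (Z.to_nat (i - (y + 1))) x <->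
    reach D' y F (Z.to_nat (i - y)) x)).
  { intros i x Hi. replace (Z.to_nat (i - y)) with (1 + Z.to_nat (i - (y + 1)))%nat by lia.
    rewrite reach_comp. reflexivity. }
  assert (Sub : forall i x, reach D' y F i x -> reach D y F i x).
  { intros i x. apply reach_mono; auto. intros j z _ K. apply HD'. auto. }
  assert (CR : dcount D' y (y + 1) lo hi <= card (crow a b D' y F lo hi 0)).
  { apply (card_le_inj snd); [apply crow_Fin; auto| |].
    - intros v (K1 & K2 & K3). split; auto. replace (y + Z.of_nat 1) with (fst v) by lia. auto.
    - intros [u v] [u' v'] (K1 & _) (K2 & _) E3. simpl in *. f_equal; lia. }
  assert (DC : dcount D y (y1 + sw w) lo hi <= dcount D' y (y + 1) lo hi + dcount D' (y + 1) (y1 + sw w) lo' hi').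
  { unfold dcount. rewrite <- card_disj.
    - apply card_mono; [apply Fin_or; apply dc_Fin; auto|].
      intros [u v] (K1 & K2 & K3). simpl in *. assert (D' u v) by (apply HD'; auto).
      destruct (Z.le_gt_cases u (y + 1)); [left|right]; repeat split; auto; lia.
    - apply dc_Fin; auto.
    - apply dc_Fin; auto.
    - intros v (K1 & _) (K2 & _). lia. }
  constructor; auto.
  - lia.
  - apply reach_Fin; auto.
  - replace (Z.to_nat (y1 + sw w - y)) with (S (Z.to_nat (y1 + sw w - (y + 1)))) in st_good0 by lia.
    apply (Good_step F D D' E y lo hi lo' hi' beta); auto.
  - intros i x Hi Ux Dx. apply HD' in Dx as [Dx|Dx]; auto.
    destruct (st_b4 i x) as [K|K]; auto. lia.
  - intros i x Hi Ux. rewrite Sh by lia.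
    destruct (st_b5 i x) as [K|(v & [K1|K1] & K2)]; auto; try lia; try (right; exists v; tauto).
    destruct (classic (reach D' y F (Z.to_nat (i - y)) x)) as [W|W]; auto. right.
    destruct (lost_cone _ _ _ _ _ _ K W) as (k & z & Hk & B1 & B2 & Hz).
    apply HD' in B1 as [B1|B1]; [contradiction|].
    exists (y + Z.of_nat (S k), z). split; auto. cbn [snd].
    assert (OM := off_mul (Z.of_nat (Z.to_nat (i - y))) ltac:(lia)).
    unfold rho, sw in *. lia.
  - intros i x Hi K. apply st_b6; [lia|]. apply Sub. apply Sh; auto. lia.
  - apply Fin_or; auto.
  - assert (C := card_or _ _ st_E4 FE). cbv beta in C. useoff.
    assert (card (fun v => E2 v \/ E v) <= card E2 + card E) by exact C. nia.
  - destruct st_mode0 as [(i & Hi & K)|[M1 M2]].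
    (* The empty row has to lie beyond the new front row [y + 1]; rows after an empty one are
       empty. *)
    + left. exists (Z.max i (y + 2)). split; [lia|]. intros x Hx. apply Sh in Hx; [|lia]. apply Sub in Hx.
      destruct (reach_ne_le D y F (Z.to_nat (i - y)) (Z.to_nat (Z.max i (y + 2) - y)) ltac:(lia) (ex_intro _ x Hx)) as (x' & Hx').
      apply (K x' Hx').
    + right. split.
      * destruct M1 as [M1|M1].
        -- left. etransitivity; [|exact M1]. apply card_mono; [apply rends_Fin; auto|].
           intros v [? ?]. split; auto. lia.
        -- right. lia.
      * destruct M2 as [M2|M2]; auto. right. lia.
Qed.

(** The second strip becomes the first and keeps its [U]; beyond it the view starts afresh with what
    [F] can still reach. The second part of [st_mode] is a reserve for this moment: 160000 covers 16
    times 8300, as [w] may double, the shadows of [E2] (2067), 16 times the triangles of [crd_upper]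
    (1352) and the length of the strip. *)
Lemma St_change w w' y lo hi F D beta U E1 E2 :
  St w y y lo hi F D beta U E1 E2 -> w <= w' <= 2 * w ->
  exists U', St w' y (y + sw w) lo hi F D beta U' E2 (fun _ => False).
Proof.
  intros S Hw. destruct S.
  assert (SW := sw_pos w st_w0). assert (SW' := sw_pos w' ltac:(lia)).
  assert (SM : sw w <= sw w') by (unfold sw; nia).
  assert (RM : rho w <= rho w') by (unfold rho; nia).
  set (H := y + sw w) in *. set (H' := H + sw w').
  set (R := fun i => reach D y F (Z.to_nat (i - y))) in *.
  assert (FR : forall i, Fin (R i)) by (intros i; apply reach_Fin; auto).
  exists (fun i x => (i < H /\ U i x) \/ (H <= i /\ R i x)).
  set (U' := fun i x => (i < H /\ U i x) \/ (H <= i /\ R i x)).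
  assert (FU' : forall i, Fin (U' i)) by (intros i; apply Fin_or; [apply (Fin_sub _ (U i))|apply (Fin_sub _ (R i))]; auto; tauto).
  constructor; auto.
  - lia.
  - lia.
  - replace (H + sw w' - y) with (H' - y) by (unfold H'; lia).
    apply (Good_extend F D y lo hi (Z.to_nat (H - y))); auto. lia.
  - intros i x Hi [[L Ux]|[L Rx]] Dx.
    + right. split; auto. destruct (st_b4 i x) as [K|[K _]]; auto; lia.
    + exfalso. unfold R in Rx. replace (Z.to_nat (i - y)) with (S (Z.to_nat (i - y - 1))) in Rx by lia.
      apply (proj2 Rx). replace (y + Z.of_nat (S (Z.to_nat (i - y - 1)))) with i by lia. auto.
  - intros i x Hi [[L Ux]|[L Rx]]; auto.
    destruct (st_b5 i x) as [K|(v & [K|[K _]] & K2)]; auto; try lia.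
    right. exists v. split; auto. lia.
  - intros i x Hi K. destruct (Z.lt_ge_cases i H).
    + left. split; auto. apply st_b6; auto. lia.
    + right. split; auto.
  - apply Fin_empty; auto.
  - useoff. nia.
  - rewrite card_empty by auto. useoff. unfold H. nia.
  - destruct (classic (exists i, y < i <= H' /\ forall x, ~ R i x)) as [K|K]; [left; exact K|].
    right. destruct st_mode0 as [(i & Hi & K')|[_ M2]].
    { exfalso. apply K. exists i. unfold H' in *. split; [lia|exact K']. }
    assert (NE : forall j : nat, (j <= Z.to_nat (H' - y))%nat -> exists x, reach D y F j x).
    { intros j Hj. destruct j; auto. apply NNPP. intros N. apply K.
      exists (y + Z.of_nat (S j)). split; [lia|]. intros x Hx. apply N. exists x.
      unfold R in Hx. replace (Z.to_nat (y + Z.of_nat (S j) - y)) with (S j) in Hx by lia. auto. }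
    set (h := Z.to_nat (H - y)) in *. set (h' := Z.to_nat (H' - y)) in *.
    assert (PS := pot_sum D y F lo hi h h' st_F0 st_D0 ltac:(lia) (fun k Hk => NE k ltac:(lia))).
    assert (CU := crd_upper D y F lo hi h' st_D0 st_range0).
    assert (CL := crd_lower D y F lo hi h st_D0).
    replace (y + Z.of_nat h) with H in * by lia. replace (y + Z.of_nat h') with H' in * by lia.
    assert (T0 : timed y (fun _ => False)).
    { split; [apply Fin_empty; auto|]. intros j. rewrite card_empty by tauto. olia. }
    assert (G := st_good0 _ T0 h (le_n h)).
    assert (Bk0 : withX D (fun _ => False) = D).
    { apply functional_extensionality. intros i. apply pred_ext. unfold withX. tauto. }
    rewrite Bk0 in G. specialize (G (fun i Hi => NE i ltac:(lia)) (or_introl eq_refl)).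
    assert (AU : card (U H) <= card (reach D y F h) + (2 * rho w + 1) * card E2).
    { rewrite (card_split (U H) (reach D y F h) (st_U0 H)).
      apply Z.add_le_mono; [apply card_mono; [apply reach_Fin; auto|tauto]|].
      replace (2 * rho w + 1) with (rho w + rho w + 1) by lia.
      apply (card_near snd); auto; try (unfold rho; nia).
      - apply (Fin_sub _ (U H)); auto. tauto.
      - intros x [Ux N].
        assert (RH : y + w <= H <= y + sw w) by (unfold H, sw; nia).
        destruct (st_b5 H x RH Ux) as [W|(v & [W|[W _]] & K2)]; [contradiction| |lia].
        + exists v. auto. }
    set (en := card (rends (fun k => reach D y F (Z.to_nat (k - y))) H H')) in *.
    assert (EN : card (rends U' H H') = en).
    { unfold en. apply (card_ext (A := Z * Z)); [apply rends_Fin; intros; apply FR|]. intros v.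
      assert (W : H <= fst v -> forall x, U' (fst v) x <-> R (fst v) x).
      { intros L x. unfold U'. split; [intros [[? _]|[_ K']]; [lia|exact K']|auto]. }
      unfold rends, rend. split; intros [L K']; (split; [exact L|]);
        rewrite ?(W (proj1 L)) in *; exact K'. }
    assert (UH : card (U' H') = card (reach D y F h')).
    { apply card_ext; [apply reach_Fin; auto|]. intros x. unfold U', R. fold h'.
      assert (H <= H') by (unfold H'; lia). split; [intros [[? _]|[_ K']]; [lia|exact K']|auto]. }
    assert (WH : card (rends U' (y + 1) H') <= card (rends U y H) + en).
    { rewrite <- EN. rewrite (card_split _ (fun v => fst v < H)) by (apply rends_Fin; auto).
      apply Z.add_le_mono; (apply card_mono; [apply rends_Fin; auto|]).
      - intros v [[L [W1 W2]] L2]. split; [lia|]. unfold rend, U' in *.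
        split; [destruct W1 as [[_ ?]|[? _]]; [auto|lia]|]. intros W3. apply W2. auto.
      - intros v [[L W] L2]. split; auto. lia. }
    replace (Z.of_nat h') with (H' - y) in * by lia. replace (Z.of_nat h) with (H - y) in * by lia.
    assert (Hh' : H' - y <= 26 * (w' * w')) by (unfold H', H, sw in *; lia).
    assert (Q1 : 2 * (H' - y) * (H' - y) <= 1352 * w4 w').
    { unfold w4. nia. }
    assert (Q2 : sw w' <= 13 * w4 w') by (unfold sw, w4; nia).
    assert (Q3 : (2 * rho w + 1) * card E2 <= 2067 * w4 w).
    { assert (card E2 <= 39 * (w * w)) by (unfold sw in *; useoff; nia).
      assert (0 <= card E2) by (apply card_nonneg; auto).
      unfold rho, w4. nia. }
    assert (Q4 : w4 w <= w4 w').
    { unfold w4. assert (w * w <= w' * w') by nia. nia. }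
    assert (Q5 : w4 w' <= 16 * w4 w).
    { unfold w4. assert (w' * w' <= 4 * (w * w)) by nia. nia. }
    change (H + sw w') with H'. rewrite UH, EN.
    assert (H' - H = sw w') by (unfold H'; lia).
    assert (0 <= w4 w) by (unfold w4; nia).
    assert (0 <= en) by (apply card_nonneg, rends_Fin; intros; apply FR).
    (* With few ends in the new strip, the alternative of the old second strip is inherited, and
       twice 162000 is 324000. With many, [pot_sum] gains at least [162000 - 13 - 1352 > 160000]
       times [w4 w'], so the front is rich in both senses. *)
    destruct (Z.le_gt_cases en (162000 * w4 w')) as [Le|Gt].
    + split; [|auto]. destruct M2 as [M2|M2]; [left; lia|right; lia].
    + split; right; lia.
Qed.

End Strip.

(** * Thinning out a front that gets small, is far ahead, or has few ends in view *)

Section Prune.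
Context {a b q : Z} {HO : Offsets a b q}.
Notation r := (a + b).
Notation ch := (ch a b).
Notation reach := (reach a b).
Notation Good := (Good a b q).
Notation timed := (timed q).
Notation alive := (alive a b q).
Notation St := (St (a := a) (b := b) (q := q)).

Lemma Fin_single {T} (f : T) : Fin (fun z => z = f).
Proof. exists [f]. simpl. auto. Qed.

(** Greedy choice: a cell is added only if it brings a new cell of row [j]. *)
Lemma sample F D y (j m : nat) : Fin F -> Z.of_nat m <= card (reach D y F j) ->
  exists S, (forall z, S z -> F z) /\ card S <= Z.of_nat m /\ Z.of_nat m <= card (reach D y S j).
Proof.
  intros HF. induction m; intros Hm.
  - exists (fun _ => False). split; [tauto|]. split; [rewrite card_empty; auto; lia|].
    apply card_nonneg, reach_Fin, Fin_empty. auto.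
  - destruct IHm as (S & H1 & H2 & H3); [lia|].
    assert (FS : Fin S) by (apply (Fin_sub _ F); auto).
    destruct (Z.le_gt_cases (Z.of_nat (Datatypes.S m)) (card (reach D y S j))) as [L|L].
    { exists S. split; auto. split; auto. lia. }
    assert (exists x, reach D y F j x /\ ~ reach D y S j x) as (x & Fx & Sx).
    { apply NNPP. intros N. assert (card (reach D y F j) <= card (reach D y S j)); [|lia].
      apply card_mono; [apply reach_Fin; auto|]. intros x Hx. apply NNPP. intros N'. apply N. eauto. }
    apply reach_split in Fx as (f & Ff & Fx).
    exists (fun z => S z \/ z = f). split; [|split].
    + intros z [?| ->]; auto.
    + assert (C := card_or S (fun z => z = f) FS (Fin_single f)).
      rewrite (card_single f (fun z => z = f)) in C by tauto. lia.
    + assert (C : card (fun z => reach D y S j z \/ z = x) <= card (reach D y (fun z => S z \/ z = f) j)).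
      { apply card_mono.
        - apply reach_Fin. apply Fin_or; auto. apply Fin_single.
        - intros z [Hz| ->].
          + revert Hz. apply reach_mono; auto.
          + revert Fx. apply reach_mono; auto. }
      rewrite card_disj in C.
      * rewrite (card_single x (fun z => z = x)) in C by tauto. lia.
      * apply reach_Fin; auto.
      * apply Fin_single.
      * intros z Hz ->. auto.
Qed.

(** That the subset reaches the same cells of row [y + w] suffices because [st_b2] makes no claim
    about earlier rows; this is the room in which a cover of the front can be sparse. *)
Lemma St_sub w y y1 lo hi F F' D beta U E1 E2 :
  St w y y1 lo hi F D beta U E1 E2 -> (forall z, F' z -> F z) -> (exists z, F' z) ->
  (forall x, reach D y F (Z.to_nat w) x -> reach D y F' (Z.to_nat w) x) ->
  Good F' D y lo hi (Z.to_nat (y1 + sw w - y)) beta ->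
  St w y y1 lo hi F' D beta U E1 E2.
Proof.
  intros S Sub NE Same G. constructor; try apply S; auto.
  - apply (Fin_sub _ F); [apply S|auto].
  - intros x Hx. apply (st_range S). auto.
  - intros i x Hi Ux. destruct (st_b2 S i x Hi Ux) as [K|K]; auto. left.
    assert (Hw := st_w S).
    replace (Z.to_nat (i - y)) with (Z.to_nat w + Z.to_nat (i - y - w))%nat in * by lia.
    rewrite reach_comp in *. revert K. apply reach_mono; auto.
  - intros i x Hi K. apply (st_b3 S); auto. revert K. apply reach_mono; auto.
  - destruct (st_mode S) as [(i & Hi & K)|K]; [left|right; auto].
    exists i. split; auto. intros x Hx. apply (K x). revert Hx. apply reach_mono; auto.
Qed.

Lemma run (P : Z -> Prop) u v x : P x -> u <= x <= v ->
  (forall z, u <= z <= v -> ~ rend P z) -> (forall z, u <= z <= v -> ~ lend P z) ->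
  forall z, u <= z <= v -> P z.
Proof.
  intros Px Hx NR NL.
  assert (R : forall n : nat, x + Z.of_nat n <= v -> P (x + Z.of_nat n)).
  { induction n; intros L; [replace (x + Z.of_nat 0) with x by lia; auto|].
    apply NNPP. intros N. apply (NR (x + Z.of_nat n)); [lia|]. split; [apply IHn; lia|].
    replace (x + Z.of_nat n + 1) with (x + Z.of_nat (S n)) by lia. auto. }
  assert (L : forall n : nat, u <= x - Z.of_nat n -> P (x - Z.of_nat n)).
  { induction n; intros L; [replace (x - Z.of_nat 0) with x by lia; auto|].
    apply NNPP. intros N. apply (NL (x - Z.of_nat n)); [lia|]. split; [apply IHn; lia|].
    replace (x - Z.of_nat n - 1) with (x - Z.of_nat (S n)) by lia. auto. }
  intros z Hz. destruct (Z.le_gt_cases x z).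
  - replace z with (x + Z.of_nat (Z.to_nat (z - x))) by lia. apply R. lia.
  - replace z with (x - Z.of_nat (Z.to_nat (x - z))) by lia. apply L. lia.
Qed.

Lemma anc_card D y F j : Fin F ->
  card (fun f => F f /\ exists x, reach D y (eq f) j x) <= (2 * Z.of_nat j + 1) * card (reach D y F j).
Proof.
  intros HF. replace (2 * Z.of_nat j + 1) with (Z.of_nat j + Z.of_nat j + 1) by ring.
  apply (card_near (fun x => x)); try lia; [apply (Fin_sub _ F); tauto|apply reach_Fin; auto|].
  intros f (Ff & x & Hx). exists x. split; [apply reach_split; eauto|].
  apply (reach_range _ _ _ _ _ f f) in Hx; [|intros; lia].
  assert (OM := off_mul (Z.of_nat j) ltac:(lia)). lia.
Qed.

Definition w6 (w : Z) : Z := w4 w * (w * w).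

Section Main.
Context (A w y y1 lo hi : Z) (F : Z -> Prop) (D : Z -> Z -> Prop) (beta : Z)
  (U : Z -> Z -> Prop) (E1 E2 : Z * Z -> Prop).
Context (S : St w y y1 lo hi F D beta U E1 E2) (HA : 0 <= A)
  (Size : hi - lo + 1 + card (fun v : Z * Z => D (fst v) (snd v)) <= A * (w6 w * w)).
Context (K0 : Z -> Prop) (K0F : forall z, K0 z -> F z)
  (K0J : forall x, reach D y F (Z.to_nat w) x -> reach D y K0 (Z.to_nat w) x)
  (K0c : card K0 * (r * Z.of_nat (Z.to_nat w) + 1) <= 2 * (card (reach D y F (Z.to_nat w)) +
      card (fun v : Z * Z => D (fst v) (snd v)))).
Notation h := (Z.to_nat (y1 + sw w - y)).
Notation Y := (80 * (w * w)).
Notation M := (4200 * w4 w).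
(** These cells are always kept: descendants of the others stay over [[lo, hi]] within the view,
    where [crd] counts blocked cells regardless of the front. *)
Definition NE f := F f /\ (f < lo + Y + 1 \/ hi - Y - 1 < f).

Lemma pr_w : 1 <= w. Proof. apply S. Qed.
Lemma pr_F : Fin F. Proof. apply S. Qed.
Lemma pr_D : FinD D. Proof. apply S. Qed.

Lemma pr_h : 13 * (w * w) <= Z.of_nat h <= 26 * (w * w).
Proof. assert (Hw := pr_w). assert (K := st_y S). assert (K2 := sw_pos w Hw). unfold sw in *. lia. Qed.

Lemma pr_pow : 1 <= w * w /\ w * w <= w4 w /\ w4 w <= w6 w.
Proof.
  assert (Hw := pr_w). assert (1 <= w * w) by nia.
  assert (w * w <= w4 w) by (unfold w4; nia). split; [|split]; auto. unfold w6. nia.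
Qed.

Lemma K0_card : card K0 <= 2 * A * w6 w + 4.
Proof.
  assert (Hw := pr_w). assert (N0 : 0 <= card K0) by (apply card_nonneg, (Fin_sub _ F); auto; apply pr_F).
  assert (C : card (reach D y F (Z.to_nat w)) <= hi - lo + 1 + 2 * w).
  { destruct (st_ne S) as (x0 & Hx0). assert (R0 := st_range S x0 Hx0).
    assert (OM := off_mul w ltac:(lia)).
    replace (hi - lo + 1 + 2 * w) with ((hi + w) - (lo - w) + 1) by ring.
    apply card_interval_le; [lia|]. intros x Hx.
    apply (reach_range _ _ _ _ _ lo hi) in Hx; [|apply (st_range S)].
    rewrite Z2Nat.id in Hx by lia. useoff. lia. }
  rewrite Z2Nat.id in K0c by lia.
  assert (w <= r * w + 1) by onia.
  assert (card K0 * w <= card K0 * (r * w + 1)) by (apply Z.mul_le_mono_nonneg_l; auto).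
  assert (card K0 * w <= (2 * A * w6 w + 4) * w) by nia.
  nia.
Qed.

Lemma NE_card : card NE <= 162 * (w * w).
Proof.
  assert (Hw := pr_pow). assert (Hw' := pr_w).
  assert (C : card NE <= card (fun x => lo <= x <= lo + Y \/ hi - Y <= x <= hi)).
  { apply card_mono; [apply Fin_or; apply Fin_interval|].
    intros x [Fx K]. assert (R0 := st_range S x Fx). lia. }
  assert (C2 := card_or _ _ (Fin_interval lo (lo + Y)) (Fin_interval (hi - Y) hi)). cbv beta in C2.
  rewrite !card_interval in C2 by lia. lia.
Qed.

Lemma NE_Fin : Fin NE.
Proof. apply (Fin_sub _ F); [apply pr_F|]. intros x []; auto. Qed.

Lemma K0_Fin : Fin K0.
Proof. apply (Fin_sub _ F); [apply pr_F|auto]. Qed.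

Lemma same_reach K j x : (forall z, K0 z -> K z) -> (Z.to_nat w <= j)%nat ->
  reach D y F j x -> reach D y K j x.
Proof.
  intros HK L. replace j with (Z.to_nat w + (j - Z.to_nat w))%nat by lia.
  rewrite !reach_comp. apply reach_mono; auto. intros z Hz. apply K0J in Hz.
  revert Hz. apply reach_mono; auto.
Qed.

(** At most [78 w^2] deletions within the view shade at most [53 w^2] cells each, and
    [53 * 78 = 4134 < 4200]. *)
Lemma big_alive K j : Fin K -> (j <= h)%nat -> M <= card (reach D y K j) -> alive K D y j.
Proof.
  intros FK Hj C X T. apply card_ex; [apply reach_Fin; auto|].
  assert (KB := kill_bound D X y K j FK T). assert (Hh := pr_h). assert (Hp := pr_pow).
  assert (L : (r * Z.of_nat j + 1) * (q * Z.of_nat j) < M); [|lia].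
  assert (Z.of_nat j <= 26 * (w * w)) by lia.
  assert (0 <= q * Z.of_nat j <= 78 * (w * w)) by (useoff; nia).
  assert (0 <= r * Z.of_nat j + 1 <= 53 * (w * w)) by (useoff; nia).
  assert ((r * Z.of_nat j + 1) * (q * Z.of_nat j) <= (53 * (w * w)) * (78 * (w * w))) by (apply Z.mul_le_mono_nonneg; lia).
  unfold w4 in *. nia.
Qed.

(** Row [j0] is the first in which too few cells remain to be safe from future deletions. From there
    on only its ancestors matter, at most [53 w^2] for each of its fewer than [M] cells. Before it,
    a sample with [M] descendants in the preceding row guarantees survival. *)
Lemma prune_thin (j0 : nat) : (j0 <= h)%nat -> card (reach D y F j0) < M ->
  (forall j, (j < j0)%nat -> M <= card (reach D y F j)) ->
  exists F', (forall z, F' z -> F z) /\ St w y y1 lo hi F' D beta U E1 E2 /\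
    card F' <= (2 * A + 300000) * w6 w /\ forall f, NE f -> F' f.
Proof.
  intros Hj Cj Mj. assert (Hp := pr_pow). assert (Hh := pr_h). assert (Hw := pr_w). assert (FF := pr_F).
  destruct j0 as [|j0].
  { exists F. split; auto. split; auto. split; [cbn [reach] in Cj; nia|]. intros f []; auto. }
  specialize (Mj j0 ltac:(lia)).
  destruct (sample F D y j0 (Z.to_nat M) pr_F) as (Sm & S1 & S2 & S3); [lia|].
  rewrite Z2Nat.id in S2, S3 by lia.
  set (An := fun f => F f /\ exists x, reach D y (eq f) (Datatypes.S j0) x).
  assert (FAn : Fin An) by (apply (Fin_sub _ F); auto; intros x []; auto).
  assert (FSm : Fin Sm) by (apply (Fin_sub _ F); auto).
  set (K := fun f => (K0 f \/ NE f) \/ (An f \/ Sm f)).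
  assert (KF : forall z, K z -> F z) by (intros z [[?|[? _]]|[[? _]|?]]; auto).
  assert (F1 : Fin (fun f => K0 f \/ NE f)) by (apply Fin_or; [apply K0_Fin|apply NE_Fin]).
  assert (F2 : Fin (fun f => An f \/ Sm f)) by (apply Fin_or; auto).
  assert (FK : Fin K) by (apply Fin_or; auto).
  assert (AL : forall i, (i < Datatypes.S j0)%nat -> alive K D y i).
  { intros i Hi. apply (alive_mono Sm K D y j0 i); [lia|unfold K; auto|]. apply big_alive; auto. lia. }
  exists K. split; [exact KF|]. split; [|split].
  - apply (St_sub _ _ _ _ _ F); auto.
    + apply (card_ex K FK). assert (1 <= card Sm).
      { destruct (card_ex (reach D y Sm j0)) as (x & Hx); [apply reach_Fin; auto|lia|].
        apply reach_split in Hx as (f & Hf & _). apply (card_pos _ f); auto. }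
      assert (card Sm <= card K) by (apply card_mono; auto; unfold K; auto). lia.
    + intros x Hx. apply (same_reach K); auto. unfold K; auto.
    + apply (Good_anc F K D y lo hi h (Datatypes.S j0)); auto.
      * apply pr_D.
      * intros f Ff E. right. left. split; auto.
      * intros f Ff E. left. right. split; auto.
        assert (OM := off_mul (Z.of_nat h) ltac:(lia)).
        lia.
      * apply S.
  - assert (C1 := card_or _ _ F1 F2). assert (C2 := card_or _ _ K0_Fin NE_Fin).
    assert (C3 := card_or _ _ FAn FSm). assert (C4 := K0_card). assert (C5 := NE_card).
    assert (C6 : card An <= (2 * Z.of_nat (Datatypes.S j0) + 1) * card (reach D y F (Datatypes.S j0))) by (apply anc_card; auto).
    change (card K <= card (fun f => K0 f \/ NE f) + card (fun f => An f \/ Sm f)) in C1. cbv beta in *.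
    assert (0 <= card (reach D y F (Datatypes.S j0))) by (apply card_nonneg, reach_Fin; auto).
    assert (card An <= (53 * (w * w)) * M).
    { etransitivity; [exact C6|]. apply Z.mul_le_mono_nonneg; lia. }
    assert ((53 * (w * w)) * M = 222600 * w6 w) by (unfold w6; ring). lia.
  - unfold K; auto.
Qed.

Section Robust.
Context (Rob : M <= card (reach D y F h)).

Lemma rob_alive K : (forall z, K0 z -> K z) -> (forall z, K z -> F z) -> alive K D y h.
Proof.
  intros H1 H2. assert (Hp := pr_pow). assert (Hh := pr_h). assert (Hw := pr_w).
  apply big_alive; auto; [apply (Fin_sub _ F); auto; apply pr_F|].
  etransitivity; [exact Rob|]. apply card_mono; [apply reach_Fin, (Fin_sub _ F); auto; apply pr_F|].
  intros x. apply same_reach; auto. nia.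
Qed.

Lemma rob_ne K : (forall z, K0 z -> K z) -> (forall z, K z -> F z) -> exists z, K z.
Proof.
  intros H1 H2.
  assert (T0 : timed y (fun _ => False)).
  { split; [apply Fin_empty; auto|]. intros j. rewrite card_empty by tauto. olia. }
  destruct (rob_alive K H1 H2 _ T0) as (x & Hx). apply reach_split in Hx as (f & Hf & _). eauto.
Qed.

(** The margin 8300 exceeds [53 * 117]: shadows have width at most [53 w^2], and [E2] and the future
    contribute at most [117 w^2] deletions. [E1] does no harm, since in the last row of the view
    [st_b2] attributes losses to [E2] alone. *)
Lemma prune_rich :
  beta + 8300 * w4 w <= card (U (y1 + sw w)) + dcount D y (y1 + sw w) lo hi - r * (y1 + sw w - y) ->
  exists F', (forall z, F' z -> F z) /\ St w y y1 lo hi F' D beta U E1 E2 /\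
    card F' <= (2 * A + 300000) * w6 w /\ forall f, NE f -> F' f.
Proof.
  intros Rich. assert (Hp := pr_pow). assert (Hh := pr_h). assert (Hw := pr_w). assert (FF := pr_F).
  set (K := fun f => K0 f \/ NE f).
  assert (KF : forall z, K z -> F z) by (intros z [?|[? _]]; auto).
  assert (FK : Fin K) by (apply Fin_or; [apply K0_Fin|apply NE_Fin]).
  assert (K0K : forall z, K0 z -> K z) by (unfold K; auto).
  assert (Hsy := st_y S). assert (SW := sw_pos w Hw).
  exists K. split; [exact KF|]. split; [|split].
  - apply (St_sub _ _ _ _ _ F); auto.
    + apply rob_ne; auto.
    + intros x Hx. apply (same_reach K); auto.
    + apply (Good_rich K (U (y1 + sw w)) E2 D y lo hi h (rho w)); auto.
      * apply pr_D.
      * apply S.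
      * apply S.
      * unfold rho. lia.
      * apply rob_alive; auto.
      * intros x Ux N. destruct (st_b2 S (y1 + sw w) x) as [R|(v & [R|[R _]] & B)]; auto.
        -- unfold sw in *. nia.
        -- exfalso. apply N. apply same_reach; auto. nia.
        -- exists v. auto.
        -- lia.
      * assert (C2 := st_c2 S). unfold dcount in Rich.
        replace (Z.of_nat h) with (y1 + sw w - y) in * by lia.
        replace (y + (y1 + sw w - y)) with (y1 + sw w) by ring.
        assert (0 <= card E2) by (apply card_nonneg, S).
        assert (W : (2 * rho w + 1) * (card E2 + q * (y1 + sw w - y)) <= 8300 * w4 w); [|lia].
        assert (card E2 + q * (y1 + sw w - y) <= 117 * (w * w)) by (unfold sw in *; useoff; nia).
        assert (0 <= card E2 + q * (y1 + sw w - y)) by (useoff; nia).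
        assert (2 * rho w + 1 <= 53 * (w * w)) by (unfold rho; lia).
        assert (0 <= 2 * rho w + 1) by (unfold rho; lia).
        assert ((2 * rho w + 1) * (card E2 + q * (y1 + sw w - y)) <= (53 * (w * w)) * (117 * (w * w)))
          by (apply Z.mul_le_mono_nonneg; auto).
        unfold w4. nia.
  - assert (C2 := card_or _ _ K0_Fin NE_Fin). assert (C4 := K0_card). assert (C5 := NE_card).
    change (card K <= card K0 + card NE) in C2. nia.
  - unfold K; auto.
Qed.

(** A cell far from all ends and deletions whose path runs through the view has full rows of [U]
    around this path. These rows contain no deleted cell, and row [y + w] of them is reached from
    the cover [K0], which is therefore dense near the cell. *)
Lemma prune_poor : card (rends U (y + 1) (y1 + sw w)) <= 324000 * w4 w ->
  exists F', (forall z, F' z -> F z) /\ St w y y1 lo hi F' D beta U E1 E2 /\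
    card F' <= (2 * A + 110000000) * w6 w /\ forall f, NE f -> F' f.
Proof.
  intros Poor. assert (Hp := pr_pow). assert (Hh := pr_h). assert (Hw := pr_w). assert (FF := pr_F).
  assert (Hsy := st_y S). assert (SW := sw_pos w Hw).
  set (ends := fun v => rends U (y + 1) (y1 + sw w) v \/ lends U (y + 1) (y1 + sw w) v).
  set (EE := fun v => E1 v \/ E2 v).
  set (B1 := fun f => F f /\ exists v, ends v /\ f - Y <= snd v <= f + Y).
  set (B2 := fun f => F f /\ exists v, EE v /\ f - (Y + rho w) <= snd v <= f + (Y + rho w)).
  set (An := fun f => F f /\ exists x, reach D y (eq f) h x).
  assert (FUr : forall i, y + 1 <= i < y1 + sw w -> Fin (U i)) by (intros; apply S).
  assert (Fr := rends_Fin U _ _ FUr).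
  assert (Fl : Fin (lends U (y + 1) (y1 + sw w))).
  { apply (Fin_sub _ _ (rows_Fin U _ _ FUr)). intros v [? [? _]]. auto. }
  assert (Fends : Fin ends) by (apply Fin_or; auto).
  assert (FEE : Fin EE) by (apply Fin_or; apply S).
  assert (FB1 : Fin B1) by (apply (Fin_sub _ F); auto; intros x []; auto).
  assert (FB2 : Fin B2) by (apply (Fin_sub _ F); auto; intros x []; auto).
  assert (CB1 : card B1 <= 161 * (w * w) * (648000 * w4 w)).
  { assert (C : card B1 <= (Y + Y + 1) * card ends).
    { apply (card_near snd); auto; try lia. intros x [_ K]. exact K. }
    assert (C2 := card_or _ _ Fr Fl). rewrite card_lends in C2 by auto.
    change (card ends <= card (rends U (y + 1) (y1 + sw w)) + card (rends U (y + 1) (y1 + sw w))) in C2.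
    assert (0 <= card ends) by (apply card_nonneg; auto).
    etransitivity; [exact C|]. apply Z.mul_le_mono_nonneg; lia. }
  assert (CB2 : card B2 <= 213 * (w * w) * (78 * w4 w)).
  { assert (C : card B2 <= ((Y + rho w) + (Y + rho w) + 1) * card EE).
    { apply (card_near snd); auto; try (unfold rho; lia). intros x [_ K]. exact K. }
    assert (C2 := card_or _ _ (st_E1 S) (st_E2 S)).
    change (card EE <= card E1 + card E2) in C2.
    assert (0 <= card EE) by (apply card_nonneg; auto).
    assert (c1 := st_c1 S). assert (c2 := st_c2 S).
    assert (card EE <= 78 * (w * w)) by (unfold sw in *; useoff; nia).
    etransitivity; [exact C|]. apply Z.mul_le_mono_nonneg; unfold rho; lia. }
  (* The cells that do not lead to row [h] are dropped first, by [Good_anc]; the local argument for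
     the others starts from a path of length [h]. *)
  set (K1 := fun f => (K0 f \/ NE f) \/ An f).
  set (K := fun f => (K0 f \/ NE f) \/ (B1 f \/ B2 f) /\ An f).
  assert (K1F : forall z, K1 z -> F z) by (intros z [[?|[? _]]|[? _]]; auto).
  assert (KK1 : forall z, K z -> K1 z) by (intros z [?|[_ ?]]; [left|right]; auto).
  assert (KF : forall z, K z -> F z) by auto.
  assert (K0K : forall z, K0 z -> K z) by (unfold K; auto).
  assert (K0K1 : forall z, K0 z -> K1 z) by (unfold K1; auto).
  assert (FK : Fin K) by (apply (Fin_sub _ F); auto).
  assert (FK1 : Fin K1) by (apply (Fin_sub _ F); auto).
  assert (OM := off_mul (Z.of_nat h) ltac:(lia)).
  assert (G1 : Good K1 D y lo hi h beta).
  { apply (Good_anc F K1 D y lo hi h h); auto.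
    - apply pr_D.
    - intros f Ff E. right. split; auto.
    - intros f Ff E. left. right. split; auto. lia.
    - intros i Hi. apply (alive_mono K1 K1 D y h i); auto; [lia|]. apply rob_alive; auto.
    - apply S. }
  exists K. split; [exact KF|]. split; [|split].
  - apply (St_sub _ _ _ _ _ F); auto.
    + apply rob_ne; auto.
    + intros x Hx. apply (same_reach K); auto.
    (* With [J = w], [q <= 3] and [r <= 2], the term [q w (r w + 1)] is at most [6 w^2 + 3 w]. With
       [12 w^2] rows, the window must exceed [42 w^2 + 5 w], and [48 w^2] does; adding the drift
       [24 w^2] leaves [72 w^2 <= Y]. *)
    + apply (Good_prune K1 K D y lo hi h (48 * (w * w)) Y (Z.to_nat w) (Z.to_nat (12 * (w * w)))); auto.
      * apply pr_D.
      * nia.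
      * lia.
      * rewrite !Z2Nat.id by lia. assert (q * w * (r * w + 1) <= 3 * w * (r * w + 1)) by (useoff; nia).
        useoff. nia.
      * rewrite !Z2Nat.id by lia. assert (q * w * (r * w + 1) <= 3 * w * (r * w + 1)) by (useoff; nia).
        assert (r * w <= 2 * w) by (useoff; nia).
        assert (q * (12 * (w * w)) <= 3 * (12 * (w * w))) by (useoff; nia). nia.
      * rewrite !Z2Nat.id by lia. useoff. nia.
      * apply rob_alive; auto.
      * intros f Kf NKf.
        assert (N1 : ~ NE f) by (intros E; apply NKf; left; auto).
        assert (Af : An f) by (destruct Kf as [[E|E]|E]; auto; exfalso; apply NKf; left; auto).
        assert (Ff : F f) by apply Af.
        assert (NB1 : ~ B1 f) by (intros E; apply NKf; right; auto).
        assert (NB2 : ~ B2 f) by (intros E; apply NKf; right; auto).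
        destruct Af as (_ & x0 & Hx0). apply pth_reach in Hx0 as (p & P0 & _ & P).
        assert (Full : forall k x, (1 <= k <= Z.to_nat (12 * (w * w)))%nat -> f - Y <= x <= f + Y ->
          U (y + Z.of_nat k) x).
        { intros k x Hk Hx.
          assert (Rg := pth_range _ _ _ _ _ k P ltac:(lia)). rewrite Nat.sub_0_r, <- P0 in Rg.
          assert (OMk := off_mul (Z.of_nat k) ltac:(lia)).
          apply (run _ (f - Y) (f + Y) (p k)); auto.
          - apply (st_b3 S); [lia|]. replace (Z.to_nat (y + Z.of_nat k - y)) with k by lia.
            apply (reach_pth _ _ _ _ 0); [lia|cbn [reach]; rewrite <- P0; auto|].
            apply (pth_sub _ _ _ _ _ _ _ _ P); auto; lia.
          - useoff. lia.
          - intros z Hz E. apply NB1. split; auto. exists (y + Z.of_nat k, z). cbn [snd].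
            split; [|lia]. left. split; auto. cbn [fst]. lia.
          - intros z Hz E. apply NB1. split; auto. exists (y + Z.of_nat k, z). cbn [snd].
            split; [|lia]. right. split; auto. cbn [fst]. lia. }
        split; [|split].
        -- intros k x Hk Hx Dx. apply NB2. split; auto. exists (y + Z.of_nat k, x).
           cbn [snd]. split; [|unfold rho; lia].
           destruct (st_b1 S (y + Z.of_nat k) x ltac:(lia) (Full k x Hk Hx) Dx) as [E|[_ E]]; unfold EE; auto.
        -- rewrite Z2Nat.id by lia. intros x Hx1 Hx2.
           assert (0 <= b * w <= r * w) by (useoff; nia).
           (* The shift by [b w] is chosen so that the cells of row [y] that may lead to this
              position form exactly [[x, x + r w]]. *)
           assert (Ux := Full (Z.to_nat w) (x + b * w) ltac:(nia) ltac:(lia)).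
           rewrite Z2Nat.id in Ux by lia.
           destruct (st_b2 S (y + w) (x + b * w)) as [R|(v & Ev & Hv)]; auto.
           ++ unfold sw in *. nia.
           ++ replace (Z.to_nat (y + w - y)) with (Z.to_nat w) in R by lia.
              apply K0J in R. apply reach_split in R as (g & Kg & R). exists g. split; auto.
              apply (reach_range _ _ _ _ _ g g) in R; [|intros; lia].
              rewrite Z2Nat.id in R by lia. lia.
           ++ exfalso. apply NB2. split; auto. exists v. split; [unfold EE; tauto|lia].
        -- assert (~ (f < lo + Y + 1 \/ hi - Y - 1 < f)) by (intros E; apply N1; split; auto). lia.
  - assert (C1 := card_or _ _ (Fin_or _ _ K0_Fin NE_Fin) (Fin_or _ _ FB1 FB2)).
    assert (C2 := card_or _ _ K0_Fin NE_Fin). assert (C3 := card_or _ _ FB1 FB2).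
    assert (C4 := K0_card). assert (C5 := NE_card). cbv beta in *.
    assert (C6 : card K <= card (fun x => (K0 x \/ NE x) \/ (B1 x \/ B2 x))).
    { apply card_mono; [apply Fin_or; apply Fin_or; auto; [apply K0_Fin|apply NE_Fin]|].
      intros x [?|[? _]]; auto. }
    assert (161 * (w * w) * (648000 * w4 w) = 104328000 * w6 w) by (unfold w6; ring).
    assert (213 * (w * w) * (78 * w4 w) = 16614 * w6 w) by (unfold w6; ring).
    nia.
  - unfold K; auto.
Qed.
End Robust.
End Main.

Lemma St_prune A w y y1 lo hi F D beta U E1 E2 :
  St w y y1 lo hi F D beta U E1 E2 -> 0 <= A ->
  hi - lo + 1 + card (fun v : Z * Z => D (fst v) (snd v)) <= A * (w6 w * w) ->
  exists F', (forall z, F' z -> F z) /\ St w y y1 lo hi F' D beta U E1 E2 /\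
    card F' <= (2 * A + 110000000) * w6 w /\
    forall f, F f -> f <= lo \/ hi <= f -> F' f.
Proof.
  intros S HA Size. assert (Hw := st_w S). assert (Hsy := st_y S). assert (SW := sw_pos w Hw).
  destruct (cover F D y (Z.to_nat w) (st_F S) (st_D S) ltac:(lia)) as (K0 & H1 & H2 & H3).
  assert (W6 : 0 <= w6 w) by (unfold w6, w4; nia).
  assert (Main : forall c, c <= 2 * A + 110000000 ->
    (exists F', (forall z, F' z -> F z) /\ St w y y1 lo hi F' D beta U E1 E2 /\
      card F' <= c * w6 w /\ forall f, NE w lo hi F f -> F' f) ->
    exists F', (forall z, F' z -> F z) /\ St w y y1 lo hi F' D beta U E1 E2 /\
      card F' <= (2 * A + 110000000) * w6 w /\ forall f, F f -> f <= lo \/ hi <= f -> F' f).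
  { intros c Hc (F' & Q1 & Q2 & Q3 & Q4). exists F'. split; auto. split; auto. split; [nia|].
    intros f Ff E. apply Q4. split; auto. assert (0 <= w * w) by nia. lia. }
  set (h := Z.to_nat (y1 + sw w - y)).
  assert (Rb : (forall j, (j <= h)%nat -> 4200 * w4 w <= card (reach D y F j)) \/
    exists j, (j <= h)%nat /\ card (reach D y F j) < 4200 * w4 w /\
      forall i, (i < j)%nat -> 4200 * w4 w <= card (reach D y F i)).
  { clearbody h. induction h as [|n IHn].
    - destruct (Z.le_gt_cases (4200 * w4 w) (card (reach D y F 0))).
      + left. intros j Hj. assert (j = 0)%nat as -> by lia. auto.
      + right. exists 0%nat. split; auto. split; auto. intros; lia.
    - destruct IHn as [I|(j & I1 & I2)]; [|right; exists j; split; [lia|auto]].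
      destruct (Z.le_gt_cases (4200 * w4 w) (card (reach D y F (Datatypes.S n)))).
      + left. intros j Hj. assert (j <= n \/ j = Datatypes.S n)%nat as [?| ->] by lia; auto.
      + right. exists (Datatypes.S n). split; auto. split; auto. intros; apply I; lia. }
  destruct Rb as [Rb|(j & Rb1 & Rb2 & Rb3)].
  - destruct (st_mode S) as [(i & Hi & K)|[[P|R] _]].
    + exfalso. specialize (Rb (Z.to_nat (i - y)) ltac:(unfold h; lia)).
      rewrite (card_empty (reach D y F _)) in Rb by auto.
      assert (1 <= w * w) by nia. unfold w4 in Rb. nia.
    + apply (Main (2 * A + 110000000)); [lia|]. apply (prune_poor A _ _ _ _ _ _ _ _ _ _ _ S Size K0); auto.
    + apply (Main (2 * A + 300000)); [lia|]. apply (prune_rich A _ _ _ _ _ _ _ _ _ _ _ S Size K0); auto.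
  - apply (Main (2 * A + 300000)); [lia|]. apply (prune_thin A _ _ _ _ _ _ _ _ _ _ _ S HA Size K0 H1 H2 H3 j); auto.
Qed.

End Prune.

(** * Fronts at the scale of the current time *)

Section Front.
Context {a b q : Z} {HO : Offsets a b q}.
Notation r := (a + b).
Notation ch := (ch a b).
Notation reach := (reach a b).
Notation Good := (Good a b q).
Notation St := (St (a := a) (b := b) (q := q)).

Lemma reach_card_le D y F j : Fin F -> card (reach D y F j) <= (2 * Z.of_nat j + 1) * card F.
Proof.
  intros HF. replace (2 * Z.of_nat j + 1) with (Z.of_nat j + Z.of_nat j + 1) by ring.
  apply (card_near (fun x => x)); try lia; [apply reach_Fin; auto|auto|].
  intros x Hx. apply reach_split in Hx as (f & Ff & Hx). exists f. split; auto.
  apply (reach_range _ _ _ _ _ f f) in Hx; [|intros; lia].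
  assert (OM := off_mul (Z.of_nat j) ltac:(lia)). lia.
Qed.

Lemma rends_le U i0 i1 m : (forall i, i0 <= i < i1 -> Fin (U i) /\ card (U i) <= m) ->
  i0 <= i1 -> 0 <= m -> card (rends U i0 i1) <= m * (i1 - i0).
Proof.
  intros H L Hm. replace (i1 - i0) with (i1 - 1 - i0 + 1) by ring.
  rewrite <- card_interval by lia.
  apply (card_fiber _ _ (fun (v : Z * Z) i => fst v = i)); auto.
  - apply rends_Fin. apply H.
  - apply Fin_interval.
  - intros v [? _]. exists (fst v). split; auto. lia.
  - intros i Hi. destruct (H i ltac:(lia)) as [H1 H2]. etransitivity; [|exact H2].
    apply (card_le_inj snd); auto.
    + intros v [[_ [K _]] <-]. auto.
    + intros [u v] [u' v'] [_ K1] [_ K2] E. simpl in *. congruence.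
Qed.

(** A front of at most 10 cells can reach only [530 w^2] cells of each row in view, so it cannot
    have too many ends. *)
Lemma St_init w y lo hi F D beta : 1 <= w -> Fin F -> (exists x, F x) ->
  (forall x, F x -> lo <= x <= hi) -> FinD D -> beta <= card F -> card F <= 10 ->
  exists U, St w y (y + sw w) lo hi F D beta U (fun _ => False) (fun _ => False).
Proof.
  intros Hw HF NE Rg HD Hb Hc. assert (SW := sw_pos w Hw).
  set (U := fun i => reach D y F (Z.to_nat (i - y))).
  assert (FU : forall i, Fin (U i)) by (intros; apply reach_Fin; auto).
  assert (Hw2 : 1 <= w * w) by nia.
  assert (RE : forall i0, y <= i0 <= y + sw w + sw w ->
    card (rends U i0 (y + sw w + sw w)) <= 162000 * w4 w).
  { intros i0 Hi.
    assert (C : card (rends U i0 (y + sw w + sw w)) <= (530 * (w * w)) * (y + sw w + sw w - i0)).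
    { apply rends_le; try lia. intros i Hi'. split; auto. etransitivity; [apply reach_card_le; auto|].
      assert (0 <= card F) by (apply card_nonneg; auto).
      assert (Z.of_nat (Z.to_nat (i - y)) <= 26 * (w * w)) by (unfold sw in *; lia).
      nia. }
    unfold sw, w4 in *. nia. }
  exists U. constructor; auto.
  - lia.
  - apply (Good_le F D y lo hi _ (card F)); auto. apply Good_init; auto.
  - intros i x Hi K Dx. exfalso. unfold U in K.
    replace (Z.to_nat (i - y)) with (S (Z.to_nat (i - y - 1))) in K by lia.
    apply (proj2 K). replace (y + Z.of_nat (S (Z.to_nat (i - y - 1)))) with i by lia. auto.
  - apply Fin_empty; auto.
  - apply Fin_empty; auto.
  - rewrite card_empty by auto. useoff. nia.
  - rewrite card_empty by auto. useoff. nia.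
  - right. assert (0 <= w4 w) by (unfold w4; nia).
    split; left; [specialize (RE (y + 1) ltac:(lia))|specialize (RE (y + sw w) ltac:(lia))]; lia.
Qed.

Definition w7 (w : Z) : Z := w6 w * w.

(** By the first inequality the scale keeps up with time if it grows by at most one per strip; by
    the second, with [128 = 2^7], a scale is not far behind when its successor is due. *)
Lemma w7_S w : 1 <= w -> w7 w + sw w <= w7 (w + 1) <= 128 * w7 w.
Proof.
  intros Hw. unfold w7, w6, w4, sw. set (s := w * w). set (s' := (w + 1) * (w + 1)).
  assert (Hs : 1 <= w <= s /\ s + 3 <= s' <= 4 * s) by (unfold s, s'; nia). clearbody s s'.
  assert (E1 : (s + 3) * (s + 3) <= s' * s') by (apply Z.mul_le_mono_nonneg; lia).
  assert (E2 : s' * s' <= (4 * s) * (4 * s)) by (apply Z.mul_le_mono_nonneg; lia).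
  assert (E3 : 1 * 1 <= s * s) by (apply Z.mul_le_mono_nonneg; lia).
  assert (D1 : (s + 3) * (s + 3) * (s + 3) <= s' * s' * s') by (apply Z.mul_le_mono_nonneg; lia).
  assert (D2 : s' * s' * s' <= (4 * s) * (4 * s) * (4 * s)) by (apply Z.mul_le_mono_nonneg; lia).
  assert (D3 : 1 * s <= s * s * s) by (apply Z.mul_le_mono_nonneg; lia).
  set (u := s * s * s) in *. set (v := s' * s' * s') in *.
  assert (u + 27 * s <= v <= 64 * u) by lia. clearbody u v.
  assert ((u + 27 * s) * (w + 1) <= v * (w + 1)) by (apply Z.mul_le_mono_nonneg_r; lia).
  assert (v * (w + 1) <= (64 * u) * (2 * w)) by (apply Z.mul_le_mono_nonneg; lia).
  assert (0 * 0 <= s * w) by (apply Z.mul_le_mono_nonneg; lia). lia.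
Qed.

Lemma scale_ex t : 1 <= t -> exists w, 1 <= w /\ w7 w <= t < w7 (w + 1).
Proof.
  intros Ht. replace t with (Z.of_nat (Z.to_nat (t - 1)) + 1) by lia.
  induction (Z.to_nat (t - 1)) as [|n (w & H1 & H2 & H3)].
  - exists 1. split; [lia|]. unfold w7, w6, w4. simpl. lia.
  - destruct (Z.lt_ge_cases (Z.of_nat (S n) + 1) (w7 (w + 1))).
    + exists w. split; auto. split; auto. lia.
    + exists (w + 1). split; [lia|]. assert (G := w7_S (w + 1) ltac:(lia)).
      assert (S' := sw_pos (w + 1) ltac:(lia)). lia.
Qed.

(* [t] is the current time; the scale [w] is adapted to it at the end of each strip. *)
Definition Front (t y lo hi : Z) (F : Z -> Prop) (D : Z -> Z -> Prop) (beta : Z) : Prop :=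
  1 <= beta /\ exists w y1 U E1 E2, St w y y1 lo hi F D beta U E1 E2 /\ w7 w <= t /\
    t + (y1 - y) <= 128 * w7 w + sw w.

(* The constant of [St_prune] for [A = 20 * 141], since [t <= 141 * w7 w]. *)
Definition KC : Z := 110005640.

Lemma Front_init t y lo hi F D beta : 1 <= t -> Fin F -> (exists x, F x) ->
  (forall x, F x -> lo <= x <= hi) -> FinD D -> 1 <= beta <= card F -> card F <= 10 ->
  Front t y lo hi F D beta.
Proof.
  intros Ht HF NE Rg HD Hb Hc. split; [lia|].
  destruct (scale_ex t Ht) as (w & Hw & W1 & W2).
  destruct (St_init w y lo hi F D beta) as (U & HS); auto; [lia|].
  assert (G := w7_S w Hw).
  exists w, (y + sw w), U, (fun _ => False), (fun _ => False). split; auto. lia.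
Qed.

Lemma Front_die t y lo hi F D beta D' E : Front t y lo hi F D beta -> Fin E -> card E <= q ->
  (forall i x, D' i x <-> D i x \/ E (i, x)) -> (forall x, ~ reach D' y F 1 x) ->
  beta + r <= card (crow a b D' y F lo hi 0).
Proof.
  intros (_ & w & y1 & U & E1 & E2 & S & _) FE CE HD' N.
  assert (G := st_good S). assert (SW := sw_pos w (st_w S)). assert (Hy := st_y S).
  replace (Z.to_nat (y1 + sw w - y)) with (Datatypes.S (Z.to_nat (y1 + sw w - (y + 1)))) in G by lia.
  apply (Good_die F D D' E y lo hi beta (Z.to_nat (y1 + sw w - (y + 1)))); auto; apply S.
Qed.

Lemma Front_step t y lo hi F D beta D' E lo' hi' : Front t y lo hi F D beta -> 1 <= t ->
  Fin E -> card E <= q -> (forall i x, D' i x <-> D i x \/ E (i, x)) -> lo' <= lo -> hi <= hi' ->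
  (exists x, reach D' y F 1 x) -> (forall x, reach D' y F 1 x -> lo' <= x <= hi') ->
  hi' - lo' + 1 + card (fun v : Z * Z => D' (fst v) (snd v)) <= 20 * t ->
  exists F' beta', (forall x, F' x -> reach D' y F 1 x) /\
    Front (t + 1) (y + 1) lo' hi' F' D' beta' /\
    beta + r - card (crow a b D' y F lo hi 0) <= beta' /\
    (exists w, 1 <= w /\ w7 w <= t /\ card F' <= KC * w6 w) /\
    (forall x, reach D' y F 1 x -> x <= lo' \/ hi' <= x -> F' x).
Proof.
  intros (Hb & w0 & y0 & U0 & A1 & A2 & S0 & W0 & T0) Ht FE CE HD' Hlo Hhi NE Rg Size.
  assert (exists w y1 U E1 E2, St w y y1 lo hi F D beta U E1 E2 /\ y < y1 /\ w7 w <= t /\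
    t + (y1 - y) <= 128 * w7 w + sw w) as (w & y1 & U & E1 & E2 & S & Hy & W & T).
  { assert (Hw0 := st_w S0). assert (Hy0 := st_y S0). assert (G := w7_S w0 Hw0).
    assert (SW := sw_pos w0 Hw0).
    destruct (Z.eq_dec y y0) as [<-|N]; [|exists w0, y0, U0, A1, A2; split; auto; lia].
    destruct (Z.le_gt_cases (w7 (w0 + 1)) t).
    - destruct (St_change w0 (w0 + 1) y lo hi F D beta U0 A1 A2 S0 ltac:(lia)) as (U' & S').
      exists (w0 + 1), (y + sw w0), U', A2, (fun _ => False). split; auto. split; [lia|]. split; [lia|].
      unfold sw in *. nia.
    - destruct (St_change w0 w0 y lo hi F D beta U0 A1 A2 S0 ltac:(lia)) as (U' & S').
      exists w0, (y + sw w0), U', A2, (fun _ => False). split; auto. split; lia. }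
  assert (Hw := st_w S). assert (SW := sw_pos w Hw).
  set (F1 := reach D' y F 1) in *.
  assert (FF1 : Fin F1) by (apply reach_Fin, S).
  assert (FD' : FinD D').
  { apply (Fin_sub _ (fun v => D (fst v) (snd v) \/ E v)); [apply Fin_or; auto; apply S|].
    intros [i x] K. apply HD' in K. auto. }
  set (beta1 := beta + r - card (crow a b D' y F lo hi 0)).
  (* If the bound is used up while the front still has cells, the front is restarted from at most
     three of them, the two extreme positions included where reached. *)
  destruct (Z.lt_ge_cases beta1 1) as [L|L].
  - destruct NE as (x0 & Hx0).
    set (F' := fun x => F1 x /\ (x = lo' \/ (x = hi' \/ x = x0))).
    assert (FF' : Fin F') by (apply (Fin_sub _ F1); auto; intros x []; auto).
    assert (C1 : 1 <= card F') by (apply (card_pos _ x0); auto; split; auto).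
    assert (C2 : card F' <= 3).
    { assert (G1 := card_or _ _ (Fin_single hi') (Fin_single x0)).
      assert (G2 := card_or _ _ (Fin_single lo') (Fin_or _ _ (Fin_single hi') (Fin_single x0))).
      assert (One : forall u : Z, card (fun z => z = u) = 1) by (intros u; apply (card_single u); tauto).
      cbv beta in *. rewrite !One in G1. rewrite One in G2.
      assert (card F' <= card (fun x => x = lo' \/ x = hi' \/ x = x0)); [|lia].
      apply card_mono; [|intros x []; auto].
      apply Fin_or; [apply Fin_single|apply Fin_or; apply Fin_single]. }
    destruct (scale_ex t Ht) as (w' & H1 & H2).
    exists F', 1. split; [intros x []; auto|]. split; [|split; [|split]].
    + apply Front_init; auto; try lia.
      * exists x0. split; auto.
      * intros x []; auto.
    + lia.
    + exists w'. split; auto. split; [lia|]. assert (1 <= w' * w') by nia.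
      assert (1 <= w6 w') by (unfold w6, w4; nia). unfold KC. lia.
    + intros x Hx B. split; auto. apply Rg in Hx. lia.
  - assert (S1 : St w (y + 1) y1 lo' hi' F1 D' beta1 U E1 (fun v => E2 v \/ E v)).
    { apply (St_advance w y y1 lo hi F D beta U E1 E2 D' E); auto. }
    assert (W7 : sw w <= 13 * w7 w).
    { unfold sw, w7, w6, w4. assert (1 <= w * w) by nia. set (s := w * w) in *.
      assert (s <= s * s) by nia. assert (s <= s * s * s) by nia. nia. }
    destruct (St_prune 2820 w (y + 1) y1 lo' hi' F1 D' beta1 U E1 _ S1) as (F' & Q1 & Q2 & Q3 & Q4).
    + lia.
    + change (w6 w * w) with (w7 w). lia.
    + exists F', beta1. split; auto. split; [|split; [|split]]; auto; try lia.
      * split; [lia|]. exists w, y1, U, E1, (fun v => E2 v \/ E v). split; auto. lia.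
      * exists w. split; auto.
Qed.

(** Within its sideways speed a front has no room for more than [hi - lo + 1] cells beyond its free
    growth. A larger [beta] must therefore be backed by deleted cells ahead that can still be
    charged. *)
Lemma Front_bound t y lo hi F D beta : Front t y lo hi F D beta ->
  exists j, beta <= hi - lo + 1 + card (crd a b D y F lo hi j).
Proof.
  intros (_ & w & y1 & U & E1 & E2 & S & _).
  assert (T0 : timed q y (fun _ => False)).
  { split; [apply Fin_empty; auto|]. intros j. rewrite card_empty by tauto. olia. }
  assert (Bk0 : withX D (fun _ => False) = D).
  { apply functional_extensionality. intros i. apply pred_ext. unfold withX. tauto. }
  assert (G := st_good S _ T0). rewrite Bk0 in G.
  set (h := Z.to_nat (y1 + sw w - y)) in *.
  assert (exists j, (j <= h)%nat /\ (forall i, (i < j)%nat -> exists x, reach D y F i x) /\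
    (j = h \/ forall x, ~ reach D y F j x)) as (j & H1 & H2 & H3).
  { assert (M : (forall i, (i < h)%nat -> exists x, reach D y F i x) \/
      exists j, (j < h)%nat /\ (forall i, (i < j)%nat -> exists x, reach D y F i x) /\
        forall x, ~ reach D y F j x).
    { clear G. clearbody h. induction h as [|n IHn]; [left; intros; lia|].
      destruct IHn as [I|(j & I1 & I2)]; [|right; exists j; split; [lia|auto]].
      destruct (classic (exists x, reach D y F n x)) as [K|K].
      - left. intros i Hi. assert (i < n \/ i = n)%nat as [?| ->] by lia; auto.
      - right. exists n. split; auto. split; auto. intros x Hx. apply K. eauto. }
    destruct M as [M|(j & M1 & M2 & M3)].
    - exists h. auto.
    - exists j. split; [lia|]. auto. }
  exists j. specialize (G j H1 H2 H3).
  destruct (st_ne S) as (x0 & Hx0). assert (R0 := st_range S x0 Hx0).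
  assert (card (reach D y F j) <= hi - lo + 1 + r * Z.of_nat j); [|lia].
  replace (hi - lo + 1 + r * Z.of_nat j) with ((hi + b * Z.of_nat j) - (lo - a * Z.of_nat j) + 1) by ring.
  apply card_interval_le; [useoff; nia|]. intros x Hx.
  apply (reach_range _ _ _ _ _ lo hi) in Hx; [auto|apply (st_range S)].
Qed.

Lemma Front_props t y lo hi F D beta : Front t y lo hi F D beta ->
  1 <= beta /\ Fin F /\ (exists x, F x) /\ (forall x, F x -> lo <= x <= hi) /\ FinD D.
Proof. intros (Hb & w & y1 & U & E1 & E2 & S & _). destruct S. auto. Qed.

End Front.

(** * Playing against a strategy of Container *)

Definition extends (G : Graph) (g : spreading) (t : nat) (D B B' : vset) : Prop :=
  (forall v, B v -> B' v) /\
  (forall v, B' v -> B v \/ (inV G v /\ ~ D v /\ exists u, B u /\ adj G u v)) /\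
  match g t with
  | Some k => card_le (fun v => B' v /\ ~ B v) k
  | None => True
  end.

Section Play.
Context (G : Graph) (g : spreading) (sigma : cstrategy) (B0 : vset)
  (Inv : nat -> vset -> vset -> Prop).

Definition good (t : nat) (D B B' : vset) : Prop :=
  extends G g t D B B' /\ Inv t D B' /\ exists v, B' v /\ ~ B v.

Definition reply (t : nat) (D B : vset) : vset :=
  epsilon (inhabits B) (fun B' => good t D B B' \/ ((forall B'', ~ good t D B B'') /\ B' = B)).

Fixpoint play (n : nat) : vset * vset * list vset :=
  match n with
  | O => ((fun _ => False), B0, [B0])
  | S m => let '(D, B, l) := play m in
      let D' := fun v => D v \/ sigma (S m) l v in
      let B' := reply (S m) D' B in (D', B', l ++ [B'])
  end.

Definition fire (n : nat) : vset := snd (fst (play n)).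

Lemma play_hist n : snd (play n) = hist fire (S n).
Proof.
  induction n; [reflexivity|]. unfold hist in *. rewrite seq_S, map_app, <- IHn.
  change (snd (play (S n)) = snd (play n) ++ [snd (fst (play (S n)))]).
  cbn [play]. destruct (play n) as [[D B] l]. reflexivity.
Qed.

Lemma play_S n : fst (fst (play (S n))) = (fun v => fst (fst (play n)) v \/ sigma (S n) (hist fire (S n)) v).
Proof. rewrite <- play_hist. cbn [play]. destruct (play n) as [[D B] l]. reflexivity. Qed.

Lemma fire_S n : fire (S n) = reply (S n) (fst (fst (play (S n)))) (fire n).
Proof. unfold fire. cbn [play]. destruct (play n) as [[D B] l]. reflexivity. Qed.

Lemma play_del n v : fst (fst (play n)) v <-> deleted sigma fire n v.
Proof.
  unfold deleted. induction n.
  - simpl. split; [tauto|]. intros (s & L & _). lia.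
  - rewrite play_S, IHn. split.
    + intros [(s & L & K)|K]; [exists s|exists (S n)]; (split; [lia|auto]).
    + intros (s & L & K). assert (s <= n \/ s = S n)%nat as [L'| ->] by lia; [left; exists s|right]; auto.
      split; [lia|auto].
Qed.

Lemma reply_spec t D B : good t D B (reply t D B) \/
  ((forall B'', ~ good t D B B'') /\ reply t D B = B).
Proof.
  unfold reply. match goal with |- context [epsilon ?i ?Q] => apply (epsilon_spec i Q) end.
  destruct (classic (exists B'', good t D B B'')) as [(B'' & K)|N].
  - exists B''. auto.
  - exists B. right. split; auto. intros B'' K. apply N. eauto.
Qed.
End Play.

Lemma spreader_wins G q g B0 (Inv : nat -> vset -> vset -> Prop) :
  Inv 0%nat (fun _ => False) B0 ->
  (forall n D B X, Inv n D B -> card_le X (budget q (S n)) ->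
    exists B', extends G g (S n) (fun v => D v \/ X v) B B' /\
      Inv (S n) (fun v => D v \/ X v) B' /\ exists v, B' v /\ ~ B v) ->
  ~ container_wins_from G q g B0.
Proof.
  intros H0 Hs [sigma W].
  set (B := fire G g sigma B0 Inv).
  assert (PD := play_del G g sigma B0 Inv). fold B in PD.
  assert (PS := play_S G g sigma B0 Inv). fold B in PS.
  destruct (W B) as (CL & T & HT).
  - intros v. reflexivity.
  - intros t Ht. destruct t as [|n]; [lia|]. unfold spreader_legal.
    replace (S n - 1)%nat with n by lia.
    assert (E : B (S n) = reply G g Inv (S n) (fst (fst (play G g sigma B0 Inv (S n)))) (B n)) by apply fire_S.
    destruct (reply_spec G g Inv (S n) (fst (fst (play G g sigma B0 Inv (S n)))) (B n)) as [[(E1 & E2 & E3) _]|[_ K]].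
    + rewrite E. split; auto. split; auto. intros v Hv. destruct (E2 v Hv) as [K|(K1 & K2 & K3)]; auto.
      right. split; auto. split; auto. rewrite <- PD. auto.
    + rewrite K in E. rewrite E. split; auto. split; auto. destruct (g (S n)); auto.
      exists []. split; [simpl; lia|]. tauto.
  - assert (Stp : forall n, Inv n (fst (fst (play G g sigma B0 Inv n))) (B n) ->
      good G g Inv (S n) (fst (fst (play G g sigma B0 Inv (S n)))) (B n) (B (S n))).
    { intros n I. specialize (CL (S n) ltac:(lia)). destruct CL as [CL _].
      destruct (Hs n _ _ _ I CL) as (B' & X).
      assert (E : B (S n) = reply G g Inv (S n) (fst (fst (play G g sigma B0 Inv (S n)))) (B n)) by apply fire_S.
      rewrite E, PS in *.
      destruct (reply_spec G g Inv (S n) (fun v => fst (fst (play G g sigma B0 Inv n)) v \/ sigma (S n) (hist B (S n)) v) (B n))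
        as [K|[K _]]; auto.
      exfalso. apply (K B'). auto. }
    assert (I : forall n, Inv n (fst (fst (play G g sigma B0 Inv n))) (B n)).
    { induction n; [exact H0|]. apply Stp; auto. }
    destruct (Stp T (I T)) as (_ & _ & v & K1 & K2).
    apply K2. apply (HT (S T)); auto.
Qed.

Lemma budget_le q t (m : Z) : (q <= IZR m)%R -> 0 <= m -> (1 <= t)%nat -> Z.of_nat (budget q t) <= m.
Proof.
  intros Hq Hm Ht. unfold budget.
  assert (E : INR t = (INR (t - 1) + 1)%R) by (rewrite <- S_INR; f_equal; lia).
  rewrite E. set (u := INR (t - 1)) in *. replace ((u + 1) * q)%R with (u * q + q)%R by ring.
  destruct (base_Int_part (u * q)) as [A1 A2]. destruct (base_Int_part (u * q + q)) as [B1 B2].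
  assert (Int_part (u * q + q) < Int_part (u * q) + m + 1); [|lia].
  apply lt_IZR. rewrite !plus_IZR. lra.
Qed.

Lemma card_le_card (P : vset) k : Fin P -> card P <= Z.of_nat k -> card_le P k.
Proof.
  intros H C. destruct (card_spec P H) as (l & _ & Hl & E). exists l. split; [lia|].
  intros x Hx. apply Hl; auto.
Qed.

Lemma card_le_Fin (P : vset) k : card_le P k -> Fin P /\ card P <= Z.of_nat k.
Proof.
  intros (l & L & H). assert (F : Fin P) by (exists l; auto). split; auto.
  destruct (card_spec P F) as (m & N & Hm & ->). apply inj_le.
  etransitivity; [|exact L]. apply NoDup_incl_length; auto. intros x Hx. apply H, Hm, Hx.
Qed.

Lemma pow_budget m C w (t : nat) n : 0 <= m -> (IZR m < C)%R -> 1 <= w -> w7 w <= Z.of_nat t ->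
  n <= m * w6 w -> n <= Z.of_nat (Z.to_nat (Int_part (C * Rpower (INR t) (6 / 7)))).
Proof.
  intros Hm HC Hw Ht Hn.
  assert (W : (1 <= IZR w)%R) by (apply IZR_le; auto).
  assert (E6 : IZR (w6 w) = (IZR w ^ 6)%R) by (unfold w6, w4; rewrite !mult_IZR; ring).
  assert (E7 : IZR (w7 w) = (IZR w ^ 7)%R) by (unfold w7; rewrite mult_IZR, E6; ring).
  assert (P : (IZR (w6 w) <= Rpower (INR t) (6 / 7))%R).
  { apply Rle_trans with (Rpower (IZR w ^ 7) (6 / 7)).
    - rewrite E6, <- !Rpower_pow by lra. rewrite Rpower_mult. apply Req_le. f_equal. simpl. field.
    - apply Rle_Rpower_l; [lra|]. rewrite <- E7. split.
      + rewrite E7. apply pow_lt. lra.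
      + rewrite INR_IZR_INZ. apply IZR_le; auto. }
  assert (P0 : (0 <= IZR (w6 w))%R) by (rewrite E6; apply pow_le; lra).
  assert (L : (IZR n <= C * Rpower (INR t) (6 / 7))%R).
  { apply Rle_trans with (IZR m * IZR (w6 w))%R; [rewrite <- mult_IZR; apply IZR_le; auto|].
    apply Rmult_le_compat; auto; [apply IZR_le; auto|lra]. }
  destruct (base_Int_part (C * Rpower (INR t) (6 / 7))) as [_ B].
  assert (n < Int_part (C * Rpower (INR t) (6 / 7)) + 1); [|lia].
  apply lt_IZR. rewrite plus_IZR. lra.
Qed.

Definition crd_of (ax : bool) (v : vtx) : Z := if ax then fst v else snd v.
Definition sgn (s : bool) : Z := if s then 1 else -1.

(* The side [(ax, s)] of a box faces the direction [sgn s] of the axis [ax] ([true] for x,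
   [false] for y); a cell is given by its row, counted outwards, and its position in the row. *)
Definition fr (ax s : bool) (i x : Z) : vtx := if ax then (sgn s * i, x) else (x, sgn s * i).

Definition view (ax s : bool) (D : vset) : Z -> Z -> Prop := fun i x => D (fr ax s i x).

Lemma fr_crd ax s i x : crd_of ax (fr ax s i x) = sgn s * i /\ crd_of (negb ax) (fr ax s i x) = x.
Proof. unfold fr, sgn. destruct ax, s; cbn [fst snd negb crd_of]; lia. Qed.

Lemma fr_inv ax s v : fr ax s (sgn s * crd_of ax v) (crd_of (negb ax) v) = v.
Proof. unfold fr, crd_of, sgn. destruct ax, s, v; cbn [fst snd negb]; f_equal; lia. Qed.

Lemma sgn2 s x : sgn s * (sgn s * x) = x.
Proof. unfold sgn. destruct s; lia. Qed.

Lemma fr_inj ax s i x j y : fr ax s i x = fr ax s j y -> i = j /\ x = y.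
Proof. unfold fr, sgn. destruct ax, s; intros E; assert (E1 := f_equal fst E); assert (E2 := f_equal snd E); cbn [fst snd] in *; lia. Qed.

Lemma view_Fin ax s D : Fin D -> Fin (fun v : Z * Z => view ax s D (fst v) (snd v)).
Proof.
  intros H. apply (Fin_inj (fun v => fr ax s (fst v) (snd v)) _ D); auto.
  intros [i x] [j y] _ _ E. simpl fst in E; simpl snd in E. apply fr_inj in E as [-> ->]. auto.
Qed.

Lemma view_card ax s (D : vset) : Fin D ->
  card (fun v : Z * Z => view ax s D (fst v) (snd v)) = card D.
Proof.
  intros H. apply (card_bij (fun v => fr ax s (fst v) (snd v))
    (fun v => (sgn s * crd_of ax v, crd_of (negb ax) v))); auto.
  - intros [i x] K. split; auto. destruct (fr_crd ax s i x) as [E1 E2].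
    cbn [fst snd]. rewrite E1, E2, sgn2. auto.
  - intros v Hv. unfold view. cbn [fst snd]. rewrite fr_inv. auto.
Qed.

(** * Spreader in the eighth plane *)

Lemma off8 : Offsets 0 1 1. Proof. unfold Offsets. lia. Qed.

Definition inv8 (n : nat) (D B : vset) : Prop :=
  exists F beta (Ch : vset),
    Front (a := 0) (b := 1) (q := 1) (Z.of_nat n + 1) (Z.of_nat n) 0 (Z.of_nat n) F (view false true D) beta /\
    (forall x, F x -> B (x, Z.of_nat n)) /\ (forall v, B v -> snd v <= Z.of_nat n) /\ Fin D /\
    (forall v, Ch v -> D v /\ snd v <= Z.of_nat n) /\ 1 + card D - card Ch <= beta /\
    card D <= Z.of_nat n.

Lemma view_8 D i x : view false true D i x <-> D (x, i).
Proof. unfold view, fr, sgn. replace (1 * i) with i by lia. tauto. Qed.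

Lemma eighth_spreader C q : (IZR (KC) < C)%R -> (q <= 1)%R ->
  ~ container_wins_from Eighth q (g_pow C) (fun v => v = (0, 0)).
Proof.
  intros HC Hq. assert (HO := off8). apply (spreader_wins _ _ _ _ inv8).
  - exists (fun x => x = 0), 1, (fun _ => False).
    assert (Fin (fun _ : vtx => False)) by (apply Fin_empty; auto).
    split; [|split; [|split; [|split; [|split; [|split]]]]]; auto.
    + apply Front_init; try rewrite (card_single 0) by tauto; try lia.
      * apply Fin_single.
      * eauto.
      * apply view_Fin; auto.
    + intros x ->. auto.
    + intros v ->. simpl. lia.
    + tauto.
    + rewrite !card_empty by auto. lia.
    + rewrite !card_empty by auto. lia.
  - intros n D B X (F & beta & Ch & HF & FB & BB & FD & HCh & Hb & HD) HX.
    apply card_le_Fin in HX as [FX CX].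
    assert (BL := budget_le q (S n) 1 Hq ltac:(lia) ltac:(lia)).
    set (D' := fun v => D v \/ X v).
    assert (FD' : Fin D') by (apply Fin_or; auto).
    assert (CD' : card D' <= card D + card X) by (apply card_or; auto).
    destruct (Front_props _ _ _ _ _ _ _ HF) as (_ & FinF & NeF & RgF & _).
    set (N := Z.of_nat n) in *.
    set (c := card (crow 0 1 (view false true D') N F 0 N 0)).
    set (Ch' := fun v => Ch v \/ (snd v = N + 1 /\ crow 0 1 (view false true D') N F 0 N 0 (fst v))).
    assert (FDv : FinD (view false true D')) by (apply view_Fin; auto).
    assert (HCh' : forall v, Ch' v -> D' v /\ snd v <= N + 1).
    { intros [x i] [K|[E [K _]]]; simpl fst in *; simpl snd in *.
      - apply HCh in K as [K1 K2]. split; [left; auto|simpl in *; lia].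
      - apply view_8 in K. replace (N + Z.of_nat 1) with i in K by lia. split; auto. lia. }
    assert (CCh : card Ch' = card Ch + c).
    { unfold Ch'. rewrite card_disj.
      - f_equal. apply (card_bij fst (fun x => (x, N + 1))).
        + apply crow_Fin; auto.
        + intros [x i] [E K]. simpl in *. subst i. auto.
        + intros x K. simpl. auto.
      - apply (Fin_sub _ D); auto. intros v K. apply HCh; auto.
      - apply (Fin_sub _ D'); auto. intros v K. apply HCh'. right. auto.
      - intros v K1 [K2 _]. apply HCh in K1. lia. }
    assert (CLe : card Ch' <= card D') by (apply card_mono; auto; intros v K; apply HCh'; auto).
    set (E := fun v : Z * Z => X (snd v, fst v)).
    assert (FE : Fin E).
    { apply (Fin_inj (fun v => (snd v, fst v)) _ X); auto.
      intros [u v] [u' v'] _ _ K. simpl in K. injection K. intros; subst; auto. }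
    assert (CE : card E <= 1).
    { etransitivity; [|etransitivity; [exact CX|exact BL]].
      apply (card_le_inj (fun v => (snd v, fst v))); auto.
      intros [u v] [u' v'] _ _ K. simpl in K. injection K. intros; subst; auto. }
    assert (HDE : forall i x, view false true D' i x <-> view false true D i x \/ E (i, x)).
    { intros i x. rewrite !view_8. unfold D', E. simpl. tauto. }
    (* To die, the front would have to be charged [beta + 1] cells at once, but at most
       [card D + 1 - card Ch <= beta] deleted cells are uncharged. *)
    assert (NE : exists x, reach 0 1 (view false true D') N F 1 x).
    { apply NNPP. intros NE.
      assert (K := Front_die _ _ _ _ _ _ _ _ _ HF FE CE HDE ltac:(intros x Hx; apply NE; eauto)).
      fold c in K. lia. }
    destruct (Front_step _ _ _ _ _ _ _ _ _ 0 (N + 1) HF ltac:(lia) FE CE HDE ltac:(lia) ltac:(lia) NE)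
      as (F' & beta' & S1 & S2 & S3 & (w & W1 & W2 & W3) & _).
    { intros x [(z & Hz & Hx) _]. apply RgF in Hz. lia. }
    { rewrite view_card by auto. lia. }
    fold c in S3.
    exists (fun v => B v \/ (snd v = N + 1 /\ F' (fst v))).
    assert (FF' : Fin F') by apply (Front_props _ _ _ _ _ _ _ S2).
    split; [split; [|split]|split].
    + auto.
    + intros [x i] [K|[E1 K]]; auto. right. simpl in E1. subst i. simpl in K.
      apply S1 in K as [(z & Hz & Hx) K]. rewrite view_8 in K.
      replace (N + Z.of_nat 1) with (N + 1) in K by lia.
      simpl in Hz. assert (Rz := RgF z Hz).
      split; [simpl; lia|]. split; [exact K|]. exists (z, N). split; [apply FB; auto|].
      unfold adj. simpl. lia.
    + apply card_le_card.
      * apply (Fin_inj fst _ F'); auto.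
        -- intros v [[K|[_ K]] K']; [contradiction|auto].
        -- intros [x i] [x' i'] [[K|[E1 _]] K'] [[L|[E2 _]] L'] E3; try contradiction. simpl in *. congruence.
      * etransitivity; [|apply (pow_budget KC C w (S n) (card F')); auto; [unfold KC; lia|lia]].
        apply (card_le_inj fst); auto.
        -- intros v [[K|[_ K]] K']; [contradiction|auto].
        -- intros [x i] [x' i'] [[K|[E1 _]] K'] [[L|[E2 _]] L'] E3; try contradiction. simpl in *. congruence.
    + exists F', beta', Ch'.
      replace (Z.of_nat (S n)) with (N + 1) by lia.
      split; [exact S2|]. split; [|split; [|split; [|split; [|split]]]]; auto; try lia.
      * intros v [K|[K _]]; [apply BB in K; lia|lia].
    + destruct (Front_props _ _ _ _ _ _ _ S2) as (_ & _ & (x & Hx) & _).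
      exists (x, N + 1). split; [right; auto|]. intros K. apply BB in K. simpl in K. lia.
Qed.

(** * Spreader on the strong grid *)

Lemma offK : Offsets 1 1 3. Proof. unfold Offsets. lia. Qed.

Definition b2z (P : Prop) : Z := if decb P then 1 else 0.

Lemma b2z_case P : (P /\ b2z P = 1) \/ (~ P /\ b2z P = 0).
Proof. unfold b2z. destruct (decb P) eqn:E; [left|right]; rewrite <- (decb_true P), E; auto. Qed.

Ltac b2z_cases := match goal with |- context [b2z ?P] => destruct (b2z_case P) as [[? ->]|[? ->]] end.

Lemma b2z_range P : 0 <= b2z P <= 1.
Proof. b2z_cases; lia. Qed.

Lemma card_pair (P : Z -> Prop) (A B : Prop) u v : Fin P -> u <> v -> (A -> P u) -> (B -> P v) ->
  b2z A + b2z B <= card P.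
Proof.
  intros F N HA HB. assert (C0 := card_nonneg P F).
  destruct (b2z_case A) as [[a ->]|[_ ->]]; destruct (b2z_case B) as [[b ->]|[_ ->]].
  - assert (C : card (fun x => x = u \/ x = v) <= card P) by (apply card_mono; auto; intros x [->| ->]; auto).
    rewrite card_disj in C by (try apply Fin_single; intros; congruence).
    rewrite (card_single u (fun x => x = u)), (card_single v (fun x => x = v)) in C by tauto. lia.
  - assert (C := card_pos P u F (HA a)). lia.
  - assert (C := card_pos P v F (HB b)). lia.
  - lia.
Qed.

Notation front := (Front (a := 1) (b := 1) (q := 3)).
Notation reach1 D y F := (reach 1 1 D y F 1).

Definition al (Fr : bool -> bool -> Z -> Prop) (ax s : bool) : Z := b2z (exists x, Fr ax s x).

Definition sum4 (f : bool -> bool -> Z) : Z :=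
  f true true + f true false + (f false true + f false false).

(* The corner of the box between the sides [(true, s1)] and [(false, s2)] is occupied by both fronts. *)
Definition kap (ext : bool -> bool -> Z) (Fr : bool -> bool -> Z -> Prop) (s1 s2 : bool) : Z :=
  b2z (Fr true s1 (sgn s2 * ext false s2) /\ Fr false s2 (sgn s1 * ext true s1)).

(* The fire is contained in the box of extents [ext]; every side of it is dead or has a front in
   it. [Ch] are the deleted cells that were charged to a front. While three sides are alive, the
   right-hand sides of [k_phi] and [k_th] increase at least as fast as the number of uncharged
   deleted cells; and these inequalities do not allow two dead sides. *)
Record KInv (n : Z) (D B : vset) (ext : bool -> bool -> Z) (Fr : bool -> bool -> Z -> Prop)
    (beta : bool -> bool -> Z) (Ch : vset) : Prop := {
  k_n : 0 <= n;
  k_ext : forall ax s, 1 <= ext ax s <= n + 1;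
  k_side : forall ax s,
    front (n + 1) (ext ax s) (- ext (negb ax) false) (ext (negb ax) true) (Fr ax s) (view ax s D) (beta ax s) \/
    ((forall x, ~ Fr ax s x) /\ beta ax s = 0);
  k_corner : forall ax s s', (exists x, Fr ax s x) -> (exists x, Fr (negb ax) s' x) ->
    Fr ax s (sgn s' * ext (negb ax) s') -> Fr (negb ax) s' (sgn s * ext ax s);
  k_B : forall v ax s, B v -> sgn s * crd_of ax v <= ext ax s;
  k_FB : forall ax s x, Fr ax s x -> B (fr ax s (ext ax s) x);
  k_D : Fin D;
  k_Dc : card D <= 3 * n;
  k_Ch : forall v, Ch v -> D v;
  k_Chp : forall v ax s, Ch v -> sgn s * crd_of ax v <= ext ax s + 1 - al Fr ax s;
  k_phi : 6 + card D - card Ch <= sum4 beta - sum4 (kap ext Fr) - sum4 ext + sum4 (al Fr);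
  k_th : forall ax, 6 + card D - card Ch <= beta ax true + beta ax false
    + ext (negb ax) true + ext (negb ax) false - ext ax true - ext ax false
}.

Arguments k_n {n D B ext Fr beta Ch}.
Arguments k_ext {n D B ext Fr beta Ch}.
Arguments k_side {n D B ext Fr beta Ch}.
Arguments k_corner {n D B ext Fr beta Ch}.
Arguments k_B {n D B ext Fr beta Ch}.
Arguments k_FB {n D B ext Fr beta Ch}.
Arguments k_D {n D B ext Fr beta Ch}.
Arguments k_Dc {n D B ext Fr beta Ch}.
Arguments k_Ch {n D B ext Fr beta Ch}.
Arguments k_Chp {n D B ext Fr beta Ch}.
Arguments k_phi {n D B ext Fr beta Ch}.
Arguments k_th {n D B ext Fr beta Ch}.

(** A front moves sideways by at most one cell per row, so the extreme cell of row [k] is reached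
    only through the extreme cells of all rows before. *)
Lemma diag D y (F : Z -> Prop) e s k x : (forall f, F f -> sgn s * f <= e) ->
  reach 1 1 D y F k x -> sgn s * x <= e + Z.of_nat k /\
  (sgn s * x = e + Z.of_nat k -> forall i : nat, (1 <= i <= k)%nat ->
    ~ D (y + Z.of_nat i) (sgn s * (e + Z.of_nat i))).
Proof.
  intros HF. revert x. induction k; intros x.
  - cbn [reach]. intros Hx. apply HF in Hx. split; [lia|]. intros _ i Hi. lia.
  - intros [(z & Hz & Hx) N]. apply IHk in Hz as [Hz1 Hz2].
    assert (sgn s * x <= sgn s * z + 1) by (destruct s; unfold sgn in *; lia).
    split; [lia|]. intros E i Hi. assert (i <= k \/ i = S k)%nat as [L| ->] by lia.
    + apply Hz2; lia.
    + rewrite <- E, sgn2. auto.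
Qed.

Section King.
Context (n : Z) (D B : vset) (ext : bool -> bool -> Z) (Fr : bool -> bool -> Z -> Prop)
  (beta : bool -> bool -> Z) (Ch : vset) (K : KInv n D B ext Fr beta Ch).
Notation lo ax := (- ext (negb ax) false).
Notation hi ax := (ext (negb ax) true).

Lemma alive_front ax s : (exists x, Fr ax s x) ->
  front (n + 1) (ext ax s) (lo ax) (hi ax) (Fr ax s) (view ax s D) (beta ax s).
Proof. intros (x & Hx). destruct (k_side K ax s) as [F|[F _]]; auto. exfalso. apply (F x Hx). Qed.

Lemma Fr_range ax s x : Fr ax s x -> forall s', sgn s' * x <= ext (negb ax) s'.
Proof.
  intros Hx. destruct (Front_props _ _ _ _ _ _ _ (alive_front ax s (ex_intro _ x Hx))) as (_ & _ & _ & R & _).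
  apply R in Hx. intros s'. destruct s'; unfold sgn; lia.
Qed.

Lemma Ch_Fin : Fin Ch.
Proof. apply (Fin_sub _ D); [apply K|apply K]. Qed.

(* The deleted cells that an alive front can be charged for later. *)
Lemma look_ex ax s : exists L : vset, (forall v, L v -> D v /\ ~ Ch v) /\
  beta ax s <= ext (negb ax) true + ext (negb ax) false + 1 + card L /\
  (forall v, L v -> 1 <= sgn s * crd_of ax v - ext ax s /\
    forall s', sgn s' * crd_of (negb ax) v - ext (negb ax) s' <= sgn s * crd_of ax v - ext ax s /\
      (sgn s' * crd_of (negb ax) v - ext (negb ax) s' = sgn s * crd_of ax v - ext ax s ->
       forall i : nat, 1 <= Z.of_nat i < sgn s * crd_of ax v - ext ax s ->
         ~ D (fr ax s (ext ax s + Z.of_nat i) (sgn s' * (ext (negb ax) s' + Z.of_nat i))))).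
Proof.
  assert (E1 := k_ext K).
  destruct (classic (exists x, Fr ax s x)) as [A|A].
  - assert (F := alive_front ax s A). destruct (Front_bound (HO := offK) _ _ _ _ _ _ _ F) as (j & Hj).
    assert (FD : FinD (view ax s D)) by (apply view_Fin, K).
    set (L := fun v : vtx => crd 1 1 (view ax s D) (ext ax s) (Fr ax s) (lo ax) (hi ax) j
      (sgn s * crd_of ax v, crd_of (negb ax) v)).
    assert (CL : card L = card (crd 1 1 (view ax s D) (ext ax s) (Fr ax s) (lo ax) (hi ax) j)).
    { apply (card_bij (fun v => (sgn s * crd_of ax v, crd_of (negb ax) v)) (fun v => fr ax s (fst v) (snd v))).
      - apply crd_Fin; auto.
      - intros v Hv. split; auto. cbn [fst snd]. apply fr_inv.
      - intros [i x] Hv. cbn [fst snd]. unfold L. destruct (fr_crd ax s i x) as [-> ->].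
        rewrite sgn2. auto. }
    exists L. split; [|split].
    + intros v (k & H1 & H2 & H3 & _). unfold view in H3. cbn [fst snd] in H2, H3. rewrite fr_inv in H3.
      split; auto. intros C. apply (k_Chp K v ax s) in C.
      unfold al in C. destruct (b2z_case (exists x, Fr ax s x)) as [[_ X]|[X _]]; [lia|contradiction].
    + rewrite CL. lia.
    + intros v (k & H1 & H2 & H3 & H4). cbn [fst snd] in H2, H3, H4. split; [lia|]. intros s'.
      assert (HF : forall f, Fr ax s f -> sgn s' * f <= ext (negb ax) s') by (intros f Hf; apply Fr_range with s; auto).
      destruct H4 as [H4|(z & Hz & Hx)].
      * assert (sgn s' * crd_of (negb ax) v <= ext (negb ax) s') by (destruct s'; unfold sgn; lia).
        split; lia.
      * apply (diag _ _ _ (ext (negb ax) s') s') in Hz as [Hz1 Hz2]; auto.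
        assert (sgn s' * crd_of (negb ax) v <= sgn s' * z + 1) by (destruct s'; unfold sgn in *; lia).
        split; [lia|]. intros E i Hi. apply (Hz2 ltac:(lia) i). lia.
  - exists (fun _ => False). split; [tauto|]. split; [|tauto].
    rewrite card_empty by auto. destruct (k_side K ax s) as [F|[_ ->]].
    + exfalso. apply A. apply (Front_props _ _ _ _ _ _ _ F).
    + specialize (E1 (negb ax)). assert (X1 := E1 true). assert (X2 := E1 false). lia.
Qed.

(** By [look_ex], [beta] of a live side is at most its length plus its share of the [U] uncharged
    cells. Shares of opposite sides are disjoint, shares of adjacent sides have at most one common
    cell. Two adjacent dead sides would turn [k_phi] into [6 + U <= U + 5], whence the constant 6.
    With two opposite dead sides, [k_phi] and [k_th] contradict each other about which dimension of
    the box is larger. *)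
Lemma three_alive : 3 <= sum4 (al Fr).
Proof.
  assert (E := k_ext K).
  assert (CF := Ch_Fin). assert (FD := k_D K).
  destruct (look_ex true true) as (L1 & A1 & B1 & C1). destruct (look_ex true false) as (L2 & A2 & B2 & C2).
  destruct (look_ex false true) as (L3 & A3 & B3 & C3). destruct (look_ex false false) as (L4 & A4 & B4 & C4).
  cbn [negb] in *.
  set (U := card D - card Ch).
  assert (EU : card (fun v => D v /\ ~ Ch v) = U).
  { unfold U. rewrite (card_split D Ch FD).
    rewrite (card_ext (fun x => D x /\ Ch x) Ch CF); [lia|].
    intros v. split; [tauto|]. intros H. split; auto. apply (k_Ch K); auto. }
  assert (FU : Fin (fun v => D v /\ ~ Ch v)) by (apply (Fin_sub _ D); tauto).
  assert (FL : forall L : vset, (forall v, L v -> D v /\ ~ Ch v) -> Fin L) by (intros L H; apply (Fin_sub _ _ FU); auto).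
  assert (One : forall L : vset, (forall v, L v -> D v /\ ~ Ch v) -> 0 <= card L <= U).
  { intros L H. split; [apply card_nonneg; auto|]. rewrite <- EU. apply card_mono; auto. }
  assert (Opp : forall L L' : vset, (forall v, L v -> D v /\ ~ Ch v) -> (forall v, L' v -> D v /\ ~ Ch v) ->
    (forall v, L v -> L' v -> False) -> card L + card L' <= U).
  { intros L L' H H' N. rewrite <- card_disj; auto. rewrite <- EU. apply card_mono; auto.
    intros v [?|?]; auto. }
  assert (Adj : forall s1 s2 (L L' : vset), (forall v, L v -> D v /\ ~ Ch v) -> (forall v, L' v -> D v /\ ~ Ch v) ->
    (forall v, L v -> 1 <= sgn s1 * fst v - ext true s1 /\ forall s',
      sgn s' * snd v - ext false s' <= sgn s1 * fst v - ext true s1 /\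
      (sgn s' * snd v - ext false s' = sgn s1 * fst v - ext true s1 ->
       forall i : nat, 1 <= Z.of_nat i < sgn s1 * fst v - ext true s1 ->
         ~ D (fr true s1 (ext true s1 + Z.of_nat i) (sgn s' * (ext false s' + Z.of_nat i))))) ->
    (forall v, L' v -> 1 <= sgn s2 * snd v - ext false s2 /\ forall s',
      sgn s' * fst v - ext true s' <= sgn s2 * snd v - ext false s2) ->
    card L + card L' <= U + 1).
  { intros s1 s2 L L' H H' P P'.
    assert (FLL : Fin (fun v => L v /\ L' v)) by (apply (Fin_sub _ L); [auto|tauto]).
    assert (X : card L + card L' <= U + card (fun v => L v /\ L' v)).
    { rewrite (card_split L L' (FL L H)).
      assert (card (fun v => (L v /\ ~ L' v) \/ L' v) <= U).
      { rewrite <- EU. apply card_mono; auto. intros v [[? _]|?]; auto. }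
      rewrite card_disj in H0; auto; [lia|apply (Fin_sub _ L); [auto|tauto]|tauto]. }
    assert (card (fun v => L v /\ L' v) <= 1); [|lia].
    (* A common cell lies on the diagonal through the common corner and has no deleted cell before
       it there, so it is the first deleted cell of this diagonal. *)
    assert (On : forall v, L v /\ L' v -> v = fr true s1 (sgn s1 * fst v) (sgn s2 * (ext false s2 + (sgn s1 * fst v - ext true s1))) /\
       forall i : nat, 1 <= Z.of_nat i < sgn s1 * fst v - ext true s1 ->
         ~ D (fr true s1 (ext true s1 + Z.of_nat i) (sgn s2 * (ext false s2 + Z.of_nat i)))).
    { intros v [Lv Lv']. destruct (P v Lv) as [_ Q]. destruct (Q s2) as [Q1 Q2].
      destruct (P' v Lv') as [_ Q']. specialize (Q' s1).
      split; [|apply Q2; lia]. assert (Ev : sgn s2 * snd v = ext false s2 + (sgn s1 * fst v - ext true s1)) by lia.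
      rewrite <- Ev, sgn2. rewrite <- (fr_inv true s1 v) at 1. reflexivity. }
    assert (Uq : forall v v', L v /\ L' v -> L v' /\ L' v' -> sgn s1 * fst v < sgn s1 * fst v' -> False).
    { intros v v' Hv Hv' Lt. destruct (On v Hv) as [Ev _]. destruct (On v' Hv') as [_ Nv].
      destruct (P v (proj1 Hv)) as [Pv _].
      apply (Nv (Z.to_nat (sgn s1 * fst v - ext true s1))); [lia|].
      rewrite Z2Nat.id by lia. replace (ext true s1 + (sgn s1 * fst v - ext true s1)) with (sgn s1 * fst v) by ring.
      rewrite <- Ev. apply H. apply Hv. }
    destruct (classic (exists v, L v /\ L' v)) as [(v & Hv)|N].
    - rewrite (card_single v); [lia|]. intros v'. split; [|intros ->; auto]. intros Hv'.
      assert (sgn s1 * fst v = sgn s1 * fst v').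
      { destruct (Z.lt_trichotomy (sgn s1 * fst v) (sgn s1 * fst v')) as [Q|[Q|Q]]; auto;
          exfalso; [apply (Uq v v')|apply (Uq v' v)]; auto. }
      destruct (On v Hv) as [-> _]. destruct (On v' Hv') as [-> _]. rewrite H0. reflexivity.
    - rewrite card_empty; [lia|]. intros v Hv. apply N. eauto. }
  assert (P1 := One L1 A1). assert (P2 := One L2 A2). assert (P3 := One L3 A3). assert (P4 := One L4 A4).
  assert (P12 : card L1 + card L2 <= U).
  { apply Opp; auto. intros v H1 H2. apply C1 in H1 as [H1 _]. apply C2 in H2 as [H2 _].
    unfold sgn in *. assert (X1 := E true true). assert (X2 := E true false). cbn [crd_of] in *. lia. }
  assert (P34 : card L3 + card L4 <= U).
  { apply Opp; auto. intros v H1 H2. apply C3 in H1 as [H1 _]. apply C4 in H2 as [H2 _].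
    unfold sgn in *. assert (X1 := E false true). assert (X2 := E false false). cbn [crd_of] in *. lia. }
  assert (C3' : forall v, L3 v -> 1 <= sgn true * snd v - ext false true /\ forall s',
      sgn s' * fst v - ext true s' <= sgn true * snd v - ext false true).
  { intros v H. destruct (C3 v H) as [X Y]. split; auto. intros s'. apply (Y s'). }
  assert (C4' : forall v, L4 v -> 1 <= sgn false * snd v - ext false false /\ forall s',
      sgn s' * fst v - ext true s' <= sgn false * snd v - ext false false).
  { intros v H. destruct (C4 v H) as [X Y]. split; auto. intros s'. apply (Y s'). }
  assert (P13 := Adj true true L1 L3 A1 A3 C1 C3'). assert (P14 := Adj true false L1 L4 A1 A4 C1 C4').
  assert (P23 := Adj false true L2 L3 A2 A3 C2 C3'). assert (P24 := Adj false false L2 L4 A2 A4 C2 C4').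
  assert (Phi := k_phi K). assert (T1 := k_th K true).
  assert (T2 := k_th K false). cbn [negb] in T1, T2.
  assert (Kp : forall s1 s2, 0 <= kap ext Fr s1 s2).
  { intros s1 s2. apply b2z_range. }
  assert (Al : forall ax s, al Fr ax s = 1 \/ (al Fr ax s = 0 /\ beta ax s = 0)).
  { intros ax s. unfold al. destruct (b2z_case (exists x, Fr ax s x)) as [[_ X]|[N X]]; auto.
    right. split; auto. destruct (k_side K ax s) as [F|[_ X']]; auto.
    exfalso. apply N. apply (Front_props _ _ _ _ _ _ _ F). }
  assert (K1 := Kp true true). assert (K2 := Kp true false). assert (K3 := Kp false true). assert (K4 := Kp false false).
  assert (Q1 := Al true true). assert (Q2 := Al true false). assert (Q3 := Al false true). assert (Q4 := Al false false).
  unfold sum4 in *. fold U in Phi, T1, T2. lia.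
Qed.
End King.

(** [Front_step] lets every front have its own scale; this brings the four sides to a common one. *)
Lemma w7_lt u w t : 1 <= u -> 1 <= w -> w7 u <= t < w7 (w + 1) -> w6 u <= w6 w.
Proof.
  intros Hu Hw H.
  assert (M : forall x y, 1 <= x <= y -> x * x <= y * y /\ w4 x <= w4 y /\ w6 x <= w6 y /\ w7 x <= w7 y).
  { intros x y L. assert (0 <= x * x <= y * y) by nia.
    assert (0 <= w4 x <= w4 y) by (unfold w4; nia).
    assert (0 <= w6 x <= w6 y) by (unfold w6; nia). split; [lia|split; [lia|split; [lia|]]]. unfold w7; nia. }
  destruct (Z.le_gt_cases u w); [apply M; lia|].
  destruct (M (w + 1) u ltac:(lia)) as (_ & _ & _ & M'). lia.
Qed.

(** * One turn on the four sides of the box *)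

Section Step.
Context (n : Z) (D B : vset) (ext : bool -> bool -> Z) (Fr : bool -> bool -> Z -> Prop)
  (beta : bool -> bool -> Z) (Ch : vset) (K : KInv n D B ext Fr beta Ch)
  (X : vset) (FX : Fin X) (CX : card X <= 3).
Notation lo ax := (- ext (negb ax) false).
Notation hi ax := (ext (negb ax) true).
Notation D' := (fun v => D v \/ X v).
Notation R ax s := (reach1 (view ax s D') (ext ax s) (Fr ax s)).
Notation live ax s := (exists x, Fr ax s x).

(* The new corner between the sides [(ax, s)] and [(negb ax, s')] is at position [cn (negb ax) s'] of
   the former. *)
Definition cn (ax s : bool) : Z := sgn s * (ext ax s + 1).

(* The new front before thinning out; a dead side revives when a neighbour reaches its corner. *)
Definition Gf (ax s : bool) (x : Z) : Prop :=
  R ax s x \/ (~ live ax s /\ exists s', x = cn (negb ax) s' /\ R (negb ax) s' (cn ax s)).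

Definition grow (ax s : bool) : Prop := exists x, Gf ax s x.
Definition ext' (ax s : bool) : Z := ext ax s + b2z (grow ax s).

Lemma Hext ax s : 1 <= ext ax s <= n + 1.
Proof. apply K. Qed.

Lemma ext'_grow ax s : grow ax s -> ext' ax s = ext ax s + 1.
Proof. intros H. unfold ext'. destruct (b2z_case (grow ax s)) as [[_ ->]|[N _]]; auto. contradiction. Qed.

Lemma ext'_le ax s : ext ax s <= ext' ax s <= ext ax s + 1.
Proof. unfold ext'. destruct (b2z_case (grow ax s)) as [[_ ->]|[_ ->]]; lia. Qed.

Lemma cn_inj ax s s' : cn ax s = cn ax s' -> s = s'.
Proof.
  unfold cn. assert (H1 := Hext ax true). assert (H2 := Hext ax false).
  destruct s, s'; unfold sgn; auto; lia.
Qed.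

Lemma R_live ax s x : R ax s x -> live ax s.
Proof. intros [(z & Hz & _) _]. exists z. auto. Qed.

Lemma R_par ax s x : R ax s x -> (exists z, Fr ax s z /\ z - 1 <= x <= z + 1) /\ ~ D' (fr ax s (ext ax s + 1) x).
Proof. intros [(z & Hz & Hx) N]. split; [exists z; auto|exact N]. Qed.

Lemma corner_eq ax s s' : fr ax s (ext ax s + 1) (cn (negb ax) s') = fr (negb ax) s' (ext (negb ax) s' + 1) (cn ax s).
Proof. destruct ax; reflexivity. Qed.

Lemma end_par ax s s' z : Fr ax s z -> z - 1 <= cn (negb ax) s' <= z + 1 -> Fr ax s (sgn s' * ext (negb ax) s').
Proof.
  intros Hz Hx. assert (G := Fr_range _ _ _ _ _ _ _ K ax s z Hz s').
  replace (sgn s' * ext (negb ax) s') with z; auto. unfold cn in Hx. destruct s'; unfold sgn in *; lia.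
Qed.

Lemma R_corner ax s s' : R ax s (cn (negb ax) s') -> Gf (negb ax) s' (cn ax s).
Proof.
  intros H. destruct (classic (live (negb ax) s')) as [L|L].
  - left. apply R_par in H as [(z & Hz & Hx) N]. assert (E := end_par ax s s' z Hz Hx).
    apply (k_corner K) in E; auto; [|exists z; auto].
    split.
    + exists (sgn s * ext ax s). split; auto. unfold cn. destruct s; unfold sgn; lia.
    + intros C. apply N. rewrite corner_eq. exact C.
  - right. split; auto. exists s. rewrite Bool.negb_involutive. auto.
Qed.

Lemma Gf_corner ax s s' : Gf ax s (cn (negb ax) s') -> Gf (negb ax) s' (cn ax s).
Proof.
  intros [H|(L & s'' & E & H)]; [apply R_corner; auto|].
  apply cn_inj in E. subst s''. left. auto.
Qed.

Lemma Gf_range ax s x : Gf ax s x -> forall s', sgn s' * x <= ext' (negb ax) s'.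
Proof.
  intros H s'. assert (E := ext'_le (negb ax) s'). destruct H as [H|(L & s'' & -> & H)].
  - destruct (R_par _ _ _ H) as [(z & Hz & Hx) _]. assert (G := Fr_range _ _ _ _ _ _ _ K ax s z Hz s').
    destruct (Z.eq_dec x (cn (negb ax) s')) as [->|N].
    + rewrite ext'_grow by (exists (cn ax s); apply R_corner; auto). unfold cn. rewrite sgn2. lia.
    + unfold cn in N. destruct s'; unfold sgn in *; lia.
  - assert (E'' := ext'_le (negb ax) s''). assert (H0 := Hext (negb ax) s''). assert (H1 := Hext (negb ax) s').
    destruct (Bool.bool_dec s' s'') as [->|N].
    + rewrite ext'_grow by (exists (cn ax s); left; auto). unfold cn. rewrite sgn2. lia.
    + unfold cn. destruct s', s''; try congruence; unfold sgn; lia.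
Qed.

Definition crw (ax s : bool) (x : Z) : Prop :=
  live ax s /\ crow 1 1 (view ax s D') (ext ax s) (Fr ax s) (lo ax) (hi ax) 0 x.
(** [c] counts the cells charged to a side in this turn. [nc] is 1 if the dead side [(ax, s)] is
    revived at its corner with [s']. *)
Definition c (ax s : bool) : Z := card (crw ax s).
Definition nc (ax s s' : bool) : Z := b2z (~ live ax s /\ R (negb ax) s' (cn ax s)).

Lemma FD' : Fin D'.
Proof. apply Fin_or; auto. apply K. Qed.

Lemma crw_Fin ax s : Fin (crw ax s).
Proof.
  apply (Fin_sub _ (crow 1 1 (view ax s D') (ext ax s) (Fr ax s) (lo ax) (hi ax) 0)).
  - apply crow_Fin. apply view_Fin, FD'.
  - intros x []; auto.
Qed.

Lemma CD' : card D' <= card D + 3.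
Proof. assert (H := card_or D X (k_D K) FX). lia. Qed.

(** The four cases are advance, death, revival and staying dead. A dying side is charged at least
    three cells, because its [beta] is at least 1; [k_th] depends on this. *)
Definition kept (ax s : bool) (F' : Z -> Prop) (b' : Z) : Prop :=
  (forall x, F' x -> Gf ax s x) /\
  (front (n + 1 + 1) (ext' ax s) (- ext' (negb ax) false) (ext' (negb ax) true) F' (view ax s D') b' \/
    ((forall x, ~ F' x) /\ b' = 0)) /\
  (grow ax s -> exists x, F' x) /\
  (forall s', Gf ax s (cn (negb ax) s') -> F' (cn (negb ax) s')) /\
  ((live ax s /\ grow ax s /\ beta ax s + 2 - c ax s <= b') \/
   (live ax s /\ ~ grow ax s /\ 3 <= beta ax s + 2 <= c ax s /\ b' = 0) \/
   (~ live ax s /\ grow ax s /\ beta ax s = 0 /\ c ax s = 0 /\ nc ax s true + nc ax s false <= b' /\ 1 <= b') \/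
   (~ live ax s /\ ~ grow ax s /\ beta ax s = 0 /\ c ax s = 0 /\ b' = 0)) /\
  (forall w, 1 <= w -> w7 w <= n + 1 < w7 (w + 1) -> card F' <= KC * w6 w).

Lemma w6_pos w : 1 <= w -> 1 <= w6 w.
Proof. intros H. unfold w6, w4. assert (1 <= w * w) by nia. assert (1 <= w * w * (w * w)) by nia. nia. Qed.

Lemma side_step ax s : exists F' b', kept ax s F' b'.
Proof.
  assert (HO := offK). assert (Hn := k_n K).
  assert (FDv : FinD (view ax s D')) by (apply view_Fin, FD').
  assert (HR : forall x, Gf ax s x -> - ext' (negb ax) false <= x <= ext' (negb ax) true).
  { intros x Hx. assert (G := Gf_range ax s x Hx). assert (G1 := G true). assert (G2 := G false).
    unfold sgn in *. lia. }
  assert (Ends : forall s', Gf ax s (cn (negb ax) s') ->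
    cn (negb ax) s' <= - ext' (negb ax) false \/ ext' (negb ax) true <= cn (negb ax) s').
  { intros s' H. assert (E : ext' (negb ax) s' = ext (negb ax) s' + 1)
      by (apply ext'_grow; exists (cn ax s); apply Gf_corner; auto).
    unfold cn. rewrite <- E. destruct s'; unfold sgn; lia. }
  destruct (classic (live ax s)) as [L|L].
  - assert (F := alive_front _ _ _ _ _ _ _ K ax s L).
    assert (B1 := proj1 (Front_props _ _ _ _ _ _ _ F)).
    set (E := fun v : Z * Z => view ax s X (fst v) (snd v)).
    assert (FE : Fin E) by (apply view_Fin; auto).
    assert (CE : card E <= 3) by (unfold E; rewrite view_card; auto).
    assert (HDE : forall i x, view ax s D' i x <-> view ax s D i x \/ E (i, x)) by (intros; unfold view, E; simpl; tauto).
    assert (Ec : c ax s = card (crow 1 1 (view ax s D') (ext ax s) (Fr ax s) (lo ax) (hi ax) 0)).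
    { apply card_ext; [apply crow_Fin; auto|]. intros x. unfold crw. tauto. }
    assert (GR : forall x, Gf ax s x <-> R ax s x).
    { intros x. split; [intros [?|[? _]]; [auto|contradiction]|left; auto]. }
    destruct (classic (grow ax s)) as [G|G].
    + destruct (Front_step _ _ _ _ _ _ _ (view ax s D') E (- ext' (negb ax) false) (ext' (negb ax) true) F)
        as (F' & b' & S1 & S2 & S3 & (w & W1 & W2 & W3) & S5); auto.
      * lia.
      * assert (H := ext'_le (negb ax) false). lia.
      * apply (ext'_le (negb ax) true).
      * destruct G as (x & Hx). exists x. apply GR; auto.
      * intros x Hx. apply HR, GR; auto.
      * rewrite view_card by apply FD'. assert (C := CD'). assert (C2 := k_Dc K).
        assert (H1 := ext'_le (negb ax) false). assert (H2 := ext'_le (negb ax) true).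
        assert (H3 := Hext (negb ax) false). assert (H4 := Hext (negb ax) true). lia.
      * exists F', b'. split; [|split; [|split; [|split; [|split]]]].
        -- intros x Hx. apply GR; auto.
        -- left. rewrite (ext'_grow ax s G). auto.
        -- intros _. apply (Front_props _ _ _ _ _ _ _ S2).
        -- intros s' H. apply S5; [apply GR; auto|apply Ends; auto].
        -- left. split; auto. split; auto. lia.
        -- intros w' H1 H2. assert (w6 w <= w6 w') by (apply (w7_lt w w' (n + 1)); lia). unfold KC in *. lia.
    + assert (Dd := Front_die _ _ _ _ _ _ _ _ E F FE CE HDE ltac:(intros x Hx; apply G; exists x; apply GR; auto)).
      exists (fun _ => False), 0. split; [|split; [|split; [|split; [|split]]]]; auto; try tauto.
      * intros s' H. apply G. exists (cn (negb ax) s'). auto.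
      * right. left. split; auto. split; auto. lia.
      * intros w H1 H2. rewrite card_empty by auto. assert (H3 := w6_pos w H1). unfold KC. lia.
  - assert (Bd : beta ax s = 0).
    { destruct (k_side K ax s) as [F|[_ ->]]; auto. exfalso. apply L. apply (Front_props _ _ _ _ _ _ _ F). }
    assert (Ec : c ax s = 0) by (apply card_empty; intros x []; auto).
    assert (GG : forall x, Gf ax s x -> x = cn (negb ax) true \/ x = cn (negb ax) false).
    { intros x [H|(_ & s' & -> & _)]; [apply R_live in H; contradiction|destruct s'; auto]. }
    assert (F2 : Fin (fun x => x = cn (negb ax) true \/ x = cn (negb ax) false)) by (apply Fin_or; apply Fin_single).
    assert (FG : Fin (Gf ax s)) by (apply (Fin_sub _ _ F2); auto).
    assert (C2 : card (Gf ax s) <= 2).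
    { etransitivity; [apply (card_mono _ _ F2 GG)|]. etransitivity; [apply card_or; apply Fin_single|].
      rewrite (card_single (cn (negb ax) true) (fun x => x = _)), (card_single (cn (negb ax) false) (fun x => x = _)) by tauto. lia. }
    destruct (classic (grow ax s)) as [G|G].
    + exists (Gf ax s), (card (Gf ax s)). destruct G as (x0 & Hx0).
      assert (C1 := card_pos _ x0 FG Hx0).
      split; [|split; [|split; [|split; [|split]]]]; auto.
      * left. apply Front_init; auto; try lia. exists x0; auto.
      * right. right. left. split; [auto|]. split; [exists x0; auto|]. split; [auto|]. split; [auto|].
        split; [|auto].
        apply (card_pair _ _ _ (cn (negb ax) true) (cn (negb ax) false)); auto.
        -- intros E. apply cn_inj in E. discriminate.
        -- intros [_ H]. right. split; auto. exists true. auto.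
        -- intros [_ H]. right. split; auto. exists false. auto.
      * intros w H1 H2. assert (H3 := w6_pos w H1). unfold KC. lia.
    + exists (fun _ => False), 0. split; [|split; [|split; [|split; [|split]]]]; auto; try tauto.
      * intros s' H. apply G. exists (cn (negb ax) s'). auto.
      * intros w H1 H2. rewrite card_empty by auto. assert (H3 := w6_pos w H1). unfold KC. lia.
Qed.

Definition CS (ax s : bool) (v : vtx) : Prop :=
  sgn s * crd_of ax v = ext ax s + 1 /\ crw ax s (crd_of (negb ax) v).

Definition Ch' (v : vtx) : Prop :=
  Ch v \/ ((CS true true v \/ CS true false v) \/ (CS false true v \/ CS false false v)).

(** The deleted corner cell is charged to both adjacent sides, although it is only one cell. *)
Definition dbl (s1 s2 : bool) : Z := b2z (crw true s1 (cn false s2) /\ crw false s2 (cn true s1)).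

Lemma CS_D ax s v : CS ax s v -> D' v.
Proof.
  intros (H1 & _ & H2 & _). unfold view in H2.
  replace (ext ax s + Z.of_nat 1) with (sgn s * crd_of ax v) in H2 by lia. rewrite fr_inv in H2. exact H2.
Qed.

Lemma CS_Fin ax s : Fin (CS ax s).
Proof. apply (Fin_sub _ D'); [apply FD'|apply CS_D]. Qed.

Lemma CS_card ax s : card (CS ax s) = c ax s.
Proof.
  apply (card_bij (crd_of (negb ax)) (fun x => fr ax s (ext ax s + 1) x)).
  - apply crw_Fin.
  - intros v [H1 H2]. split; auto. rewrite <- H1. apply fr_inv.
  - intros x Hx. unfold CS. destruct (fr_crd ax s (ext ax s + 1) x) as [-> ->]. rewrite sgn2. auto.
Qed.

Lemma crw_range ax s x s' : crw ax s x -> sgn s' * x <= ext (negb ax) s' + 1.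
Proof.
  intros (_ & _ & [H|(z & Hz & H)]).
  - destruct s'; unfold sgn; lia.
  - cbn [reach] in Hz. assert (G := Fr_range _ _ _ _ _ _ _ K ax s z Hz s'). destruct s'; unfold sgn in *; lia.
Qed.

Lemma crw_end ax s s' : crw ax s (cn (negb ax) s') -> Fr ax s (sgn s' * ext (negb ax) s').
Proof.
  intros (_ & _ & [H|(z & Hz & H)]).
  - exfalso. unfold cn in H. assert (H1 := Hext (negb ax) true). assert (H2 := Hext (negb ax) false).
    destruct s'; unfold sgn in *; lia.
  - cbn [reach] in Hz. apply (end_par ax s s' z); auto.
Qed.

Lemma Ch'_D v : Ch' v -> D' v.
Proof.
  intros [H|[[H|H]|[H|H]]]; try (apply CS_D in H; auto). left. apply (k_Ch K); auto.
Qed.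

Lemma Ch'_pos v ax s : Ch' v -> sgn s * crd_of ax v <= ext ax s + 1.
Proof.
  assert (G : forall ax0 s0, CS ax0 s0 v -> sgn s * crd_of ax v <= ext ax s + 1).
  { intros ax0 s0 [H1 H2]. destruct (Bool.bool_dec ax ax0) as [->|N].
    - assert (E1 := Hext ax0 true). assert (E2 := Hext ax0 false). destruct s, s0; unfold sgn in *; lia.
    - replace ax with (negb ax0) by (destruct ax, ax0; auto; congruence). apply (crw_range ax0 s0); auto. }
  intros [H|[[H|H]|[H|H]]]; try (apply G in H; auto; fail).
  apply (k_Chp K v ax s) in H. unfold al in H.
  destruct (b2z_case (live ax s)) as [[_ E]|[_ E]]; rewrite E in H; lia.
Qed.

(** The charges of this turn are new, since [k_Chp] keeps earlier ones out of the row in front of a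
    live side. Among themselves they overlap only in the corner cells. *)
Lemma Ch'_card : card Ch + sum4 c - sum4 dbl <= card Ch'.
Proof.
  assert (FC := CS_Fin).
  assert (Fa := Fin_or _ _ (FC true true) (FC true false)). assert (Fb := Fin_or _ _ (FC false true) (FC false false)).
  assert (Opp : forall ax, card (fun v => CS ax true v \/ CS ax false v) = c ax true + c ax false).
  { intros ax. rewrite card_disj, !CS_card; auto. intros v [H1 _] [H2 _].
    assert (E1 := Hext ax true). assert (E2 := Hext ax false). unfold sgn in *. lia. }
  assert (Dj : forall ax s v, Ch v -> ~ CS ax s v).
  { intros ax s v H [H1 [L _]]. apply (k_Chp K v ax s) in H. unfold al in H.
    destruct (b2z_case (live ax s)) as [[_ E]|[N _]]; [rewrite E in H; lia|contradiction]. }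
  unfold Ch'. rewrite card_disj.
  - set (P := fun v => CS true true v \/ CS true false v) in *. set (Q := fun v => CS false true v \/ CS false false v) in *.
    assert (E : card P + card Q <= card (fun v => P v \/ Q v) + card (fun v => P v /\ Q v)).
    { rewrite (card_split P Q Fa).
      assert (card (fun v => (P v /\ ~ Q v) \/ Q v) <= card (fun v => P v \/ Q v)).
      { apply card_mono; [apply Fin_or; auto|]. intros v [[? _]|?]; auto. }
      rewrite card_disj in H; auto; [lia|apply (Fin_sub _ P); [auto|tauto]|tauto]. }
    assert (Db : forall s1 s2, card (fun v => CS true s1 v /\ CS false s2 v) <= dbl s1 s2).
    { intros s1 s2.
      assert (Eq : forall v, CS true s1 v /\ CS false s2 v -> v = (cn true s1, cn false s2) /\
        crw true s1 (cn false s2) /\ crw false s2 (cn true s1)).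
      { intros [x y] [[H1 H2] [H3 H4]]. cbn [crd_of negb fst snd] in *.
        assert (x = cn true s1) by (unfold cn; rewrite <- H1, sgn2; auto).
        assert (y = cn false s2) by (unfold cn; rewrite <- H3, sgn2; auto). subst. auto. }
      unfold dbl. destruct (b2z_case (crw true s1 (cn false s2) /\ crw false s2 (cn true s1))) as [[_ ->]|[N ->]].
      - rewrite <- (card_single (cn true s1, cn false s2) (fun v => v = (cn true s1, cn false s2))) by tauto.
        apply card_mono; [apply Fin_single|]. intros v Hv. apply (Eq v Hv).
      - rewrite card_empty; [lia|]. intros v Hv. apply N. apply (Eq v Hv). }
    assert (FI : forall s1 s2, Fin (fun v => CS true s1 v /\ CS false s2 v)).
    { intros s1 s2. apply (Fin_sub _ (CS true s1)); auto. tauto. }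
    assert (I : card (fun v => P v /\ Q v) <= sum4 dbl).
    { assert (C1 := card_or _ _ (FI true true) (FI true false)). assert (C2 := card_or _ _ (FI false true) (FI false false)).
      assert (C3 := card_or _ _ (Fin_or _ _ (FI true true) (FI true false)) (Fin_or _ _ (FI false true) (FI false false))).
      cbv beta in *. assert (D1 := Db true true). assert (D2 := Db true false). assert (D3 := Db false true). assert (D4 := Db false false).
      unfold sum4. etransitivity; [|etransitivity; [exact C3|lia]].
      apply card_mono; [apply Fin_or; apply Fin_or; auto|]. unfold P, Q. intros v. tauto. }
    assert (O1 := Opp true). assert (O2 := Opp false).
    change (card P = c true true + c true false) in O1. change (card Q = c false true + c false false) in O2.
    change (card Ch + sum4 c - sum4 dbl <= card Ch + card (fun v => P v \/ Q v)). unfold sum4 in *. lia.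
  - apply (Fin_sub _ D'); [apply FD'|]. intros v H. apply Ch'_D. left; auto.
  - apply (Fin_sub _ D'); [apply FD'|]. intros v H. apply Ch'_D. right; auto.
  - intros v H [[H1|H1]|[H1|H1]]; apply (Dj _ _ _ H H1).
Qed.

Section New.
Context (F' : bool -> bool -> Z -> Prop) (b' : bool -> bool -> Z)
  (HK : forall ax s, kept ax s (F' ax s) (b' ax s)).

Lemma F'_grow ax s x : F' ax s x -> grow ax s.
Proof. intros H. exists x. apply HK; auto. Qed.

Lemma al' ax s : al F' ax s = b2z (grow ax s).
Proof.
  unfold al. destruct (b2z_case (exists x, F' ax s x)) as [[(x & Hx) ->]|[N ->]];
    destruct (b2z_case (grow ax s)) as [[G ->]|[G ->]]; auto; exfalso.
  - apply G. apply (F'_grow ax s x Hx).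
  - apply N. apply HK; auto.
Qed.

Lemma dbl_range s1 s2 : 0 <= dbl s1 s2 <= 1.
Proof. apply b2z_range. Qed.

Lemma nc_nonneg ax s s' : 0 <= nc ax s s'.
Proof. apply b2z_range. Qed.

(** A corner is newly shared only when a dead side revives there; otherwise it was shared before. If
    it was charged twice, then it was shared and is now deleted, so the double charge is paid for by
    the loss of [kap]. *)
Lemma kap_step s1 s2 :
  kap ext' F' s1 s2 <= kap ext Fr s1 s2 - dbl s1 s2 + nc true s1 s2 + nc false s2 s1.
Proof.
  assert (N1 := nc_nonneg true s1 s2). assert (N2 := nc_nonneg false s2 s1).
  assert (DK : dbl s1 s2 <= kap ext Fr s1 s2).
  { unfold dbl, kap. destruct (b2z_case (crw true s1 (cn false s2) /\ crw false s2 (cn true s1))) as [[[H1 H2] ->]|[_ ->]].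
    - apply (crw_end true s1 s2) in H1. apply (crw_end false s2 s1) in H2. cbn [negb] in *.
      b2z_cases; [lia|tauto].
    - apply b2z_range. }
  unfold kap at 1.
  match goal with |- b2z ?P <= _ => destruct (b2z_case P) as [[[H1 H2] ->]|[_ ->]]; [|lia] end.
  rewrite (ext'_grow false s2 (F'_grow _ _ _ H2)) in H1. rewrite (ext'_grow true s1 (F'_grow _ _ _ H1)) in H2.
  apply HK in H1. apply HK in H2. fold (cn false s2) in H1. fold (cn true s1) in H2.
  destruct H1 as [H1|(L & s & E & H1)].
  - destruct H2 as [H2|(L & s & E & H2)].
    + destruct (R_par _ _ _ H1) as [(z1 & Z1 & X1) N]. destruct (R_par _ _ _ H2) as [(z2 & Z2 & X2) _].
      assert (E1 := end_par true s1 s2 z1 Z1 X1). assert (E2 := end_par false s2 s1 z2 Z2 X2). cbn [negb] in *.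
      assert (kap ext Fr s1 s2 = 1).
      { unfold kap. b2z_cases; [lia|tauto]. }
      assert (dbl s1 s2 = 0); [|lia].
      unfold dbl. match goal with |- b2z ?P = 0 => destruct (b2z_case P) as [[[(_ & C & _) _] _]|[_ ->]]; [exfalso|lia] end.
      apply N. exact C.
    + apply cn_inj in E. subst s. cbn [negb] in *.
      assert (nc false s2 s1 = 1); [|lia].
      unfold nc. b2z_cases; [lia|tauto].
  - apply cn_inj in E. subst s. cbn [negb] in *.
    assert (nc true s1 s2 = 1); [|lia].
    unfold nc. b2z_cases; [lia|tauto].
Qed.

Definition B' (v : vtx) : Prop :=
  B v \/ exists ax s, F' ax s (crd_of (negb ax) v) /\ sgn s * crd_of ax v = ext ax s + 1.

(** A live side gains two cells and gives one to its extent. The second [al Fr ax s] of the first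
    inequality is this net gain; the first one balances [al F' ax s]. *)
Lemma side_facts ax s :
  b' ax s - ext' ax s + al F' ax s >= beta ax s - ext ax s + al Fr ax s + al Fr ax s - c ax s
    + nc ax s true + nc ax s false /\
  b' ax s - ext' ax s >= beta ax s - ext ax s + al Fr ax s - c ax s /\
  (ext' ax s = ext ax s + 1 \/ (ext' ax s = ext ax s /\ (al Fr ax s = 0 \/ 3 <= c ax s))) /\
  0 <= al Fr ax s <= 1 /\ (al Fr ax s = 0 -> c ax s = 0).
Proof.
  destruct (HK ax s) as (_ & _ & _ & _ & H & _). rewrite al'. unfold ext', al.
  assert (NL : live ax s -> nc ax s true = 0 /\ nc ax s false = 0).
  { intros L. unfold nc. split; match goal with |- b2z ?P = 0 => destruct (b2z_case P) as [[[N _] _]|[_ ->]]; [contradiction|lia] end. }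
  assert (N1 := nc_nonneg ax s true). assert (N2 := nc_nonneg ax s false).
  assert (NG : ~ grow ax s -> nc ax s true = 0 /\ nc ax s false = 0).
  { intros G. unfold nc. split; match goal with |- b2z ?P = 0 => destruct (b2z_case P) as [[[N W] _]|[_ ->]]; [|lia] end;
      exfalso; apply G; [exists (cn (negb ax) true)|exists (cn (negb ax) false)]; right; split; auto;
      [exists true|exists false]; auto. }
  destruct (b2z_case (live ax s)) as [[L ->]|[L ->]]; destruct (b2z_case (grow ax s)) as [[G ->]|[G ->]];
    destruct H as [(H1 & H2 & H)|[(H1 & H2 & H)|[(H1 & H2 & H)|(H1 & H2 & H)]]]; try contradiction.
  - specialize (NL L). lia.
  - specialize (NL L). lia.
  - lia.
  - specialize (NG G). lia.
Qed.

Lemma dbl_le_x s : dbl s true + dbl s false <= c true s.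
Proof.
  apply (card_pair _ _ _ (cn false true) (cn false false)); [apply crw_Fin| | |].
  - intros E. apply cn_inj in E. discriminate.
  - intros [H _]; auto.
  - intros [H _]; auto.
Qed.

Lemma dbl_le_y s : dbl true s + dbl false s <= c false s.
Proof.
  apply (card_pair _ _ _ (cn true true) (cn true false)); [apply crw_Fin| | |].
  - intros E. apply cn_inj in E. discriminate.
  - intros [_ H]; auto.
  - intros [_ H]; auto.
Qed.

Lemma new_box v ax s : B' v -> sgn s * crd_of ax v <= ext' ax s.
Proof.
  intros [H|(ax0 & s0 & H1 & H2)].
  - apply (k_B K v ax s) in H. assert (E := ext'_le ax s). lia.
  - destruct (Bool.bool_dec ax ax0) as [->|N].
    + assert (E := ext'_grow ax0 s0 (F'_grow _ _ _ H1)). assert (E1 := Hext ax0 s0). assert (E2 := Hext ax0 s).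
      assert (E3 := ext'_le ax0 s).
      destruct (Bool.bool_dec s s0) as [->|N]; [lia|]. destruct s, s0; try congruence; unfold sgn in *; lia.
    + replace ax with (negb ax0) by (destruct ax, ax0; auto; congruence).
      apply (Gf_range ax0 s0). apply HK; auto.
Qed.

Lemma KInv_step : KInv (n + 1) D' B' ext' F' b' Ch'.
Proof.
  assert (Hn := k_n K).
  assert (CC := Ch'_card). assert (CD := CD').
  assert (T3 := three_alive _ _ _ _ _ _ _ K).
  assert (S1 := side_facts true true). assert (S2 := side_facts true false).
  assert (S3 := side_facts false true). assert (S4 := side_facts false false).
  constructor.
  - lia.
  - intros ax s. assert (E := ext'_le ax s). assert (E1 := Hext ax s). lia.
  - intros ax s. destruct (HK ax s) as (_ & H & _). exact H.
  - intros ax s s' (x & Hx) (x' & Hx') H.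
    assert (G1 := F'_grow _ _ _ Hx). assert (G2 := F'_grow _ _ _ Hx').
    rewrite (ext'_grow ax s G1). rewrite (ext'_grow _ _ G2) in H.
    destruct (HK (negb ax) s') as (_ & _ & _ & Kp & _).
    specialize (Kp s). rewrite Bool.negb_involutive in Kp. apply Kp. apply Gf_corner. apply HK. exact H.
  - apply new_box.
  - intros ax s x H. right. exists ax, s. rewrite (ext'_grow ax s (F'_grow _ _ _ H)).
    destruct (fr_crd ax s (ext ax s + 1) x) as [-> ->]. rewrite sgn2. auto.
  - apply FD'.
  - assert (C := k_Dc K). lia.
  - apply Ch'_D.
  - intros v ax s H. apply (Ch'_pos v ax s) in H. rewrite al'. unfold ext'. lia.
  (* The net gain is one per live side, hence at least the three deletions. The terms [nc] cancel
     between [side_facts] and [kap_step], the terms [dbl] between [kap_step] and [Ch'_card]. *)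
  - assert (P := k_phi K).
    assert (K1 := kap_step true true). assert (K2 := kap_step true false).
    assert (K3 := kap_step false true). assert (K4 := kap_step false false).
    unfold sum4 in *. lia.
  (* The live sides of the axis gain one each, and so do the extents of the live perpendicular
     sides. A perpendicular side that dies adds no extent, but its charge of at least 3 exceeds its
     at most 2 doubly charged corners. *)
  - assert (P1 := k_th K true). assert (P2 := k_th K false).
    assert (X1 := dbl_le_x true). assert (X2 := dbl_le_x false). assert (X3 := dbl_le_y true). assert (X4 := dbl_le_y false).
    assert (Y1 := dbl_range true true). assert (Y2 := dbl_range true false).
    assert (Y3 := dbl_range false true). assert (Y4 := dbl_range false false).
    cbn [negb] in P1, P2. unfold sum4 in *. intros [|]; cbn [negb]; lia.
Qed.

End New.
End Step.

Definition square (v : vtx) : Prop := -1 <= fst v <= 1 /\ -1 <= snd v <= 1.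

(** The square satisfies [k_th] with equality, [3 + 3 = 6], and [k_phi] since
    [12 - 4 - 4 + 4 = 8]. *)
Lemma KInv_init : KInv 0 (fun _ => False) square (fun _ _ => 1) (fun _ _ x => -1 <= x <= 1) (fun _ _ => 3) (fun _ => False).
Proof.
  assert (F0 : Fin (fun _ : vtx => False)) by (apply Fin_empty; auto).
  assert (A1 : forall ax s, al (fun _ _ x => -1 <= x <= 1) ax s = 1).
  { intros ax s. unfold al. destruct (b2z_case (exists x : Z, -1 <= x <= 1)) as [[_ ->]|[N _]]; auto.
    exfalso. apply N. exists 0. lia. }
  assert (Kp : forall s1 s2, kap (fun _ _ => 1) (fun _ _ x => -1 <= x <= 1) s1 s2 <= 1).
  { intros s1 s2. apply b2z_range. }
  constructor; try tauto; try lia.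
  - intros ax s. left. apply (Front_init (HO := offK)); try lia.
    + apply Fin_interval.
    + exists 0. lia.
    + apply view_Fin; auto.
    + rewrite card_interval; lia.
    + rewrite card_interval; lia.
  - intros ax s s' _ _ _. destruct s; unfold sgn; lia.
  - intros [x y] ax s [H1 H2]. destruct ax, s; unfold sgn; cbn [fst snd crd_of] in *; lia.
  - intros ax s x H. unfold square, fr, sgn. destruct ax, s; cbn [fst snd]; lia.
  - rewrite card_empty; [lia|auto].
  - rewrite card_empty by auto. assert (K1 := Kp true true). assert (K2 := Kp true false).
    assert (K3 := Kp false true). assert (K4 := Kp false false). unfold sum4. rewrite !A1. lia.
Qed.

Lemma king_spreader C q : (IZR (4 * KC) < C)%R -> (q <= 3)%R ->
  ~ container_wins_from King q (g_pow C) square.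
Proof.
  intros HC Hq.
  apply (spreader_wins _ _ _ _ (fun n D B => exists ext Fr beta Ch, KInv (Z.of_nat n) D B ext Fr beta Ch)).
  - exists (fun _ _ => 1), (fun _ _ x => -1 <= x <= 1), (fun _ _ => 3), (fun _ => False). apply KInv_init.
  - intros n D B X (ext & Fr & beta & Ch & K) HX.
    apply card_le_Fin in HX as [FX CX].
    assert (BL := budget_le q (S n) 3 Hq ltac:(lia) ltac:(lia)).
    assert (CX3 : card X <= 3) by lia.
    set (kp := kept (Z.of_nat n) D ext Fr beta X).
    set (f := fun ax s => epsilon (inhabits ((fun _ : Z => False), 0)) (fun p => kp ax s (fst p) (snd p))).
    assert (HK : forall ax s, kp ax s (fst (f ax s)) (snd (f ax s))).
    { intros ax s. unfold f. apply (epsilon_spec (inhabits ((fun _ : Z => False), 0)) (fun p => kp ax s (fst p) (snd p))).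
      destruct (side_step _ _ _ _ _ _ _ K X FX CX3 ax s) as (F' & b' & H). exists (F', b'). exact H. }
    set (F' := fun ax s => fst (f ax s)). set (b' := fun ax s => snd (f ax s)).
    change (forall ax s, kp ax s (F' ax s) (b' ax s)) in HK. clearbody F' b'. clear f.
    assert (K' := KInv_step _ _ _ _ _ _ _ K X FX CX3 F' b' HK).
    set (N := fun v => exists ax s, F' ax s (crd_of (negb ax) v) /\ sgn s * crd_of ax v = ext ax s + 1).
    assert (NB : forall v, N v -> ~ B v).
    { intros v (ax & s & _ & H) C'. apply (k_B K v ax s) in C'. lia. }
    assert (HR : forall ax s x, Gf D ext Fr X ax s x -> exists ax2 s2 x2,
      fr ax s (ext ax s + 1) x = fr ax2 s2 (ext ax2 s2 + 1) x2 /\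
      reach1 (view ax2 s2 (fun v => D v \/ X v)) (ext ax2 s2) (Fr ax2 s2) x2).
    { intros ax s x [H|(_ & s' & -> & H)]; [exists ax, s, x; auto|].
      exists (negb ax), s', (cn ext ax s). split; auto. apply corner_eq. }
    exists (B' B ext F'). split; [split; [|split]|split].
    + intros v Hv. left. auto.
    + intros v [Hv|(ax & s & H1 & H2)]; auto. right. split; [exact I|].
      apply HK in H1. apply HR in H1 as (ax2 & s2 & x2 & E & Rx).
      rewrite <- H2, fr_inv in E. subst v.
      destruct (R_par _ _ _ _ _ _ _ Rx) as [(z & Hz & Hx) Nd]. split; [exact Nd|].
      exists (fr ax2 s2 (ext ax2 s2) z). split; [apply (k_FB K); auto|].
      unfold adj, fr, sgn. destruct ax2, s2; cbn [fst snd]; lia.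
    + assert (FF : forall ax s, Fin (F' ax s)).
      { intros ax s. destruct (HK ax s) as (_ & [H|[H _]] & _).
        - apply (Front_props _ _ _ _ _ _ _ H).
        - apply Fin_empty; auto. }
      set (P := fun ax s v => F' ax s (crd_of (negb ax) v) /\ sgn s * crd_of ax v = ext ax s + 1).
      assert (Pi : forall ax s v v', P ax s v -> P ax s v' -> crd_of (negb ax) v = crd_of (negb ax) v' -> v = v').
      { intros ax s v v' [_ E1] [_ E2] E3. rewrite <- (fr_inv ax s v), <- (fr_inv ax s v'). congruence. }
      assert (FP : forall ax s, Fin (P ax s)).
      { intros ax s. apply (Fin_inj (crd_of (negb ax)) _ (F' ax s)); auto; [intros v []; auto|]. intros; eapply Pi; eauto. }
      destruct (scale_ex (Z.of_nat (S n))) as (w & W1 & W2); [lia|].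
      assert (CP : forall ax s, card (P ax s) <= KC * w6 w).
      { intros ax s. etransitivity.
        - apply (card_le_inj (crd_of (negb ax)) _ (F' ax s)); auto; [intros v []; auto|]. intros; eapply Pi; eauto.
        - apply HK; auto. replace (Z.of_nat n + 1) with (Z.of_nat (S n)) by lia. auto. }
      assert (Sub : forall v, B' B ext F' v /\ ~ B v ->
        (P true true v \/ P true false v) \/ (P false true v \/ P false false v)).
      { intros v [[H|(ax & s & H)] Nv]; [contradiction|]. destruct ax, s; auto. }
      assert (FS : Fin (fun v => (P true true v \/ P true false v) \/ (P false true v \/ P false false v)))
        by (apply Fin_or; apply Fin_or; auto).
      apply card_le_card; [apply (Fin_sub _ _ FS); auto|].
      apply (pow_budget (4 * KC) C w); auto; [unfold KC; lia|lia|].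
      etransitivity; [apply (card_mono _ _ FS Sub)|].
      assert (C1 := card_or _ _ (FP true true) (FP true false)). assert (C2 := card_or _ _ (FP false true) (FP false false)).
      assert (C3 := card_or _ _ (Fin_or _ _ (FP true true) (FP true false)) (Fin_or _ _ (FP false true) (FP false false))).
      cbv beta in *. assert (D1 := CP true true). assert (D2 := CP true false).
      assert (D3 := CP false true). assert (D4 := CP false false). lia.
    + replace (Z.of_nat (S n)) with (Z.of_nat n + 1) by lia. eauto.
    + assert (T := three_alive _ _ _ _ _ _ _ K').
      assert (exists ax s x, F' ax s x) as (ax & s & x & Hx).
      { apply NNPP. intros Nx.
        assert (Z0 : forall ax s, al F' ax s = 0).
        { intros ax s. unfold al. destruct (b2z_case (exists x, F' ax s x)) as [[(x & Hx) _]|[_ ->]]; auto.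
          exfalso. apply Nx. eauto. }
        unfold sum4 in T. rewrite !Z0 in T. lia. }
      exists (fr ax s (ext ax s + 1) x).
      assert (Nv : N (fr ax s (ext ax s + 1) x)).
      { exists ax, s. destruct (fr_crd ax s (ext ax s + 1) x) as [-> ->]. rewrite sgn2. auto. }
      split; [right; exact Nv|auto].
Qed.

(** * Container *)

(** A vertex with the largest [d] gets the last rank, and the others are ranked by induction. *)
Lemma rank_ex (P : vset) (d : vtx -> Z) : Fin P -> exists idx : vtx -> Z,
  (forall u v, P u -> P v -> idx u = idx v -> u = v) /\
  (forall v, P v -> 0 <= idx v < card (fun u => P u /\ d u <= d v)).
Proof.
  intros HP. remember (Z.to_nat (card P)) as k eqn:Ek. revert P HP Ek.
  induction k; intros P HP Ek; assert (C0 := card_nonneg P HP).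
  - exists (fun _ => 0). split.
    + intros u v Pu. assert (C := card_pos P u HP Pu). lia.
    + intros v Pv. assert (C := card_pos P v HP Pv). lia.
  - destruct (card_ex P HP ltac:(lia)) as (v0 & Hv0).
    destruct (Fin_max (fun z => exists v, P v /\ z = d v)) as (z & (m & Pm & ->) & Hm); [|eauto|].
    { destruct HP as [l Hl]. exists (map d l). intros z (v & Pv & ->). apply in_map; auto. }
    set (P' := fun v => P v /\ v <> m).
    assert (FP' : Fin P') by (apply (Fin_sub _ P); auto; intros v []; auto).
    assert (CP : card P = card P' + 1).
    { rewrite (card_split P (fun v => v <> m) HP). f_equal. apply (card_single m).
      intros v. split; [intros [_ N]; apply NNPP; auto|intros ->; tauto]. }
    destruct (IHk P' FP' ltac:(lia)) as (idx & I1 & I2).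
    assert (Lt : forall v, P' v -> 0 <= idx v < card P').
    { intros v Hv. destruct (I2 v Hv) as [A1 A2]. split; auto. eapply Z.lt_le_trans; [exact A2|].
      apply card_mono; auto. tauto. }
    exists (fun v => if eqd v m then card P' else idx v). split.
    + intros u v Pu Pv. destruct (eqd u m) as [->|Nu], (eqd v m) as [->|Nv]; auto.
      * intros E. assert (L := Lt v (conj Pv Nv)). lia.
      * intros E. assert (L := Lt u (conj Pu Nu)). lia.
      * apply I1; split; auto.
    + intros v Pv. destruct (eqd v m) as [->|Nv].
      * rewrite (card_ext (fun u => P u /\ d u <= d m) P HP).
        -- assert (0 <= card P') by (apply card_nonneg; auto). lia.
        -- intros u. split; [tauto|]. intros Pu. split; auto. apply Hm. eauto.
      * destruct (I2 v (conj Pv Nv)) as [A1 A2]. split; auto. eapply Z.lt_le_trans; [exact A2|].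
        apply card_mono; [apply (Fin_sub _ P); tauto|]. intros u [[? _] ?]. auto.
Qed.

Lemma card_full {A} (P Q : A -> Prop) : Fin Q -> (forall x, P x -> Q x) -> card Q <= card P ->
  forall x, Q x -> P x.
Proof.
  intros FQ S C x Qx. apply NNPP. intros N.
  assert (C1 := card_pos (fun x => Q x /\ ~ P x) x ltac:(apply (Fin_sub _ Q); tauto) (conj Qx N)).
  assert (C2 := card_split Q P FQ).
  assert (card P <= card (fun x => Q x /\ P x)); [|lia].
  apply card_mono; [apply (Fin_sub _ Q); tauto|auto].
Qed.

Notation quota q t := (Int_part (INR t * q)).

Lemma quota_mono q s t : (0 < q)%R -> (s <= t)%nat -> quota q s <= quota q t.
Proof.
  intros Hq L. apply le_INR in L.
  destruct (base_Int_part (INR s * q)) as [A1 A2]. destruct (base_Int_part (INR t * q)) as [B1 B2].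
  assert (INR s * q <= INR t * q)%R by (apply Rmult_le_compat_r; lra).
  assert (quota q s < quota q t + 1); [|lia]. apply lt_IZR. rewrite plus_IZR. lra.
Qed.

Lemma quota_0 q : quota q 0 = 0.
Proof.
  simpl. rewrite Rmult_0_l. destruct (base_Int_part 0) as [A1 A2].
  assert (Int_part 0 < 1) by (apply lt_IZR; lra). assert (-1 < Int_part 0) by (apply lt_IZR; lra). lia.
Qed.

(* Delete the barrier [P] around [Reg] in the order of the times [d v] at which the fire could
   arrive at [v]. *)
Lemma barrier_wins G q g (B0 P Reg : vset) (d : vtx -> Z) : (0 < q)%R -> Fin P -> Fin Reg ->
  (forall v, B0 v -> Reg v /\ d v <= 0) ->
  (forall v, P v -> inV G v /\ ~ Reg v /\ 1 <= d v) ->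
  (forall u v, Reg u -> inV G v -> adj G u v -> Reg v \/ P v) ->
  (forall u v, adj G u v -> d v <= d u + 1) ->
  (forall v, P v -> card (fun u => P u /\ d u <= d v) <= Int_part (IZR (d v) * q)) ->
  container_wins_from G q g B0.
Proof.
  intros Hq FP FR HB HP HR Hd Hall.
  destruct (rank_ex P d FP) as (idx & I1 & I2).
  exists (fun t _ v => P v /\ quota q (t - 1) <= idx v < quota q t).
  intros B E0 SL.
  assert (Inc : forall s t, (s <= t)%nat -> forall v, B s v -> B t v).
  { intros s t L. induction L; auto. intros v Hv. apply (SL (S m)); [lia|].
    replace (S m - 1)%nat with m by lia. auto. }
  set (sigma := fun (t : nat) (_ : list vset) v => P v /\ quota q (t - 1) <= idx v < quota q t) in *.
  assert (Del : forall v t, P v -> d v <= Z.of_nat t -> deleted sigma B t v).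
  { intros v t Pv L. destruct (HP v Pv) as (_ & _ & D1).
    assert (J : forall s, idx v < quota q s -> exists s', (1 <= s' <= s)%nat /\ quota q (s' - 1) <= idx v < quota q s').
    { induction s; intros Ls; [rewrite quota_0 in Ls; destruct (I2 v Pv); lia|].
      destruct (Z.lt_ge_cases (idx v) (quota q s)) as [L'|L'].
      - destruct (IHs L') as (s' & ? & ?). exists s'. split; auto. lia.
      - exists (S s). split; [lia|]. replace (S s - 1)%nat with s by lia. auto. }
    destruct (J (Z.to_nat (d v))) as (s' & K1 & K2).
    - eapply Z.lt_le_trans; [apply I2; auto|]. eapply Z.le_trans; [apply Hall; auto|].
      rewrite INR_IZR_INZ, Z2Nat.id by lia. lia.
    - exists s'. split; [lia|]. split; auto. }
  assert (Inv : forall t v, B t v -> Reg v /\ d v <= Z.of_nat t).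
  { induction t; intros v Hv.
    - apply E0, HB in Hv. auto.
    - destruct (SL (S t) ltac:(lia)) as (_ & S2 & _). replace (S t - 1)%nat with t in S2 by lia.
      destruct (S2 v Hv) as [K|(K1 & K2 & u & K3 & K4)].
      + apply IHt in K. split; [tauto|lia].
      + apply IHt in K3 as [Ru Du]. assert (Dv := Hd u v K4). split; [|lia].
        destruct (HR u v Ru K1 K4) as [K|K]; auto. exfalso. apply K2. apply Del; auto. lia. }
  split.
  - intros t Ht. unfold container_legal. fold sigma.
    assert (M := quota_mono q (t - 1) t Hq ltac:(lia)).
    split.
    + apply card_le_card; [apply (Fin_sub _ P); auto; intros v []; auto|].
      unfold budget. rewrite Z2Nat.id by lia.
      replace (quota q t - quota q (t - 1)) with ((quota q t - 1) - quota q (t - 1) + 1) by ring.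
      rewrite <- card_interval by lia.
      apply (card_le_inj idx); [apply Fin_interval| |].
      * intros v [_ ?]. lia.
      * intros u v [? _] [? _]. auto.
    + intros v [Pv Iv]. destruct (HP v Pv) as (H1 & H2 & _). split; auto. split.
      * intros (s & Ls & _ & Is). assert (M' := quota_mono q s (t - 1) Hq ltac:(lia)). lia.
      * intros Bv. apply Inv in Bv. tauto.
  (* The increasing sets [B t] stay inside the finite [Reg]; they are constant once the cardinality
     is maximal. *)
  - destruct (Fin_max (fun z => exists t, z = card (B t))) as (z & (T & ->) & HT);
      [|exists (card (B 0%nat)), 0%nat; reflexivity|].
    + apply (Fin_sub _ (fun z => 0 <= z <= card Reg)); [apply Fin_interval|].
      intros z (t & ->). assert (FB : Fin (B t)) by (apply (Fin_sub _ Reg); auto; intros v Hv; apply (Inv t v Hv)).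
      split; [apply card_nonneg; auto|apply card_mono; auto; intros v Hv; apply (Inv t v Hv)].
    + exists T. intros t Ht. apply card_full.
      * apply (Fin_sub _ Reg); auto. intros v Hv. apply (Inv t v Hv).
      * intros v. apply Inc. auto.
      * apply HT. eauto.
Qed.

Lemma arch_gap (p : Z) q : (IZR p < q)%R -> exists N, 1 <= N /\ (IZR p + / IZR N <= q)%R.
Proof.
  intros H. destruct (archimed (/ (q - IZR p))) as [A _].
  assert (I0 : (0 < / (q - IZR p))%R) by (apply Rinv_0_lt_compat; lra).
  exists (up (/ (q - IZR p))).
  assert (P0 : (0 < IZR (up (/ (q - IZR p))))%R) by lra.
  split; [apply lt_IZR in P0; lia|].
  assert (/ IZR (up (/ (q - IZR p))) <= / / (q - IZR p))%R by (apply Rinv_le_contravar; lra).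
  rewrite Rinv_inv in H0. lra.
Qed.

(** The surplus [1 / N] of [q] over [p] pays, up to time [z], for [z / N] cells more than [p z]. *)
Lemma gap_count p N q k z : 1 <= N -> (IZR p + / IZR N <= q)%R -> 0 <= z -> N * (k - p * z) <= z ->
  k <= Int_part (IZR z * q).
Proof.
  intros HN Hq Hz H. assert (N0 : (1 <= IZR N)%R) by (apply IZR_le; auto).
  assert (Z0 : (0 <= IZR z)%R) by (apply IZR_le; auto).
  apply IZR_le in H. rewrite mult_IZR, minus_IZR, mult_IZR in H.
  assert (L : (IZR k <= IZR z * q)%R).
  { apply Rle_trans with (IZR z * (IZR p + / IZR N))%R; [|apply Rmult_le_compat_l; auto].
    apply Rmult_le_reg_l with (IZR N); [lra|].
    replace (IZR N * (IZR z * (IZR p + / IZR N)))%R with (IZR N * IZR z * IZR p + IZR z)%R by (field; lra).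
    lra. }
  destruct (base_Int_part (IZR z * q)) as [_ B]. assert (k < Int_part (IZR z * q) + 1); [|lia].
  apply lt_IZR. rewrite plus_IZR. lra.
Qed.

Lemma finite_bound (B0 : vset) : finite_set B0 -> exists R, 0 <= R /\
  forall v, B0 v -> - R <= fst v <= R /\ - R <= snd v <= R.
Proof.
  intros [l H].
  assert (G : exists R, 0 <= R /\ forall v, In v l -> - R <= fst v <= R /\ - R <= snd v <= R).
  { clear H. induction l as [|u l (R & H1 & H2)]; [exists 0; split; [lia|intros v []]|].
    exists (Z.max R (Z.max (Z.abs (fst u)) (Z.abs (snd u)))). split; [lia|].
    intros v [->|Hv]; [lia|]. apply H2 in Hv. lia. }
  destruct G as (R & H1 & H2). exists R. auto.
Qed.

Lemma eighth_container q g B0 : (1 < q)%R -> finite_set B0 -> (forall v, B0 v -> inV Eighth v) ->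
  container_wins_from Eighth q g B0.
Proof.
  intros Hq HF HV. destruct (finite_bound B0 HF) as (R & HR & HB).
  (* By time [Y - R] the row of [Y + 1] cells has to be deleted. These are [R + 1] more than one per
     turn, which the surplus covers in [N * (R + 1)] turns. *)
  destruct (arch_gap 1 q Hq) as (N & HN & Hg). set (Y := R + N * (R + 1)).
  assert (HY : R < Y) by (unfold Y; nia).
  apply (barrier_wins Eighth q g B0 (fun v => 0 <= fst v <= Y /\ Y <= snd v <= Y)
    (fun v => 0 <= fst v <= snd v /\ snd v < Y) (fun v => snd v - R)).
  - lra.
  - apply (Fin_prod (fun x => 0 <= x <= Y) (fun y => Y <= y <= Y)); apply Fin_interval.
  - apply (Fin_sub _ (fun v : vtx => (0 <= fst v <= Y) /\ (0 <= snd v <= Y))); [|intros v ?; lia].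
    apply (Fin_prod (fun x => 0 <= x <= Y) (fun y => 0 <= y <= Y)); apply Fin_interval.
  - intros v Hv. assert (H1 := HV v Hv). assert (H2 := HB v Hv). unfold inV in H1. lia.
  - intros v Hv. unfold inV. lia.
  - intros u v Hu Hv Ha. unfold inV in Hv. unfold adj in Ha. lia.
  - intros u v Ha. unfold adj in Ha. lia.
  - intros v Hv. apply (gap_count 1 N); auto; [lia|].
    replace (snd v) with Y by lia.
    assert (C : card (fun u : vtx => (0 <= fst u <= Y /\ Y <= snd u <= Y) /\ snd u - R <= Y - R) <= Y + 1).
    { etransitivity; [|etransitivity; [apply (card_box 0 Y Y Y); lia|]].
      - apply card_mono; [apply (Fin_prod (fun x => 0 <= x <= Y) (fun y => Y <= y <= Y)); apply Fin_interval|tauto].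
      - lia. }
    unfold Y in *. nia.
Qed.

Lemma king_container q g B0 : (3 < q)%R -> finite_set B0 -> container_wins_from King q g B0.
Proof.
  intros Hq HF. destruct (finite_bound B0 HF) as (R & HR & HB).
  destruct (arch_gap 3 q Hq) as (N & HN & Hg).
  (* The sides are so far apart that the fire meets them one after another. Until the last is met,
     the barrier has two ends that must keep up with the fire, at two cells per turn. The third cell
     is saved for the next side, which is then needed at once in a length close to the time elapsed.
     So at each such moment the demand is three cells per turn plus a constant from the earlier
     distances; [A] and [A1] are large enough for the surplus [1 / N] to cover it. [A2] is so large
     that three cells per turn pay for the whole perimeter. *)
  remember (3 * R + 1) as Y eqn:EY.
  remember (R + N * (Y + 3 * R + 3)) as A eqn:EA.
  remember (R + N * (A + 2 * Y + 3 * R + 4)) as A1 eqn:EA1.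
  remember (2 * A + 2 * A1 + 2 * Y + 4 + 3 * R) as A2 eqn:EA2.
  assert (L1 : R < Y < A) by nia. assert (L2 : A < A1 < A2) by nia.
  set (box := fun v : vtx => - A1 <= fst v <= A /\ - A2 <= snd v <= Y).
  set (P := fun v : vtx => box v /\ (fst v = A \/ fst v = - A1 \/ snd v = Y \/ snd v = - A2)).
  assert (FB : Fin box).
  { apply (Fin_prod (fun x => - A1 <= x <= A) (fun y => - A2 <= y <= Y)); apply Fin_interval. }
  assert (FP : Fin P) by (apply (Fin_sub _ box); auto; intros v []; auto).
  set (m := fun v : vtx => Z.max (Z.abs (fst v)) (Z.abs (snd v))).
  apply (barrier_wins King q g B0 P (fun v => - A1 < fst v < A /\ - A2 < snd v < Y) (fun v => m v - R)).
  - lra.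
  - auto.
  - apply (Fin_sub _ box); auto. unfold box. intros v ?; lia.
  - intros v Hv. apply HB in Hv. unfold m. lia.
  - intros v [Bv Hv]. unfold box, m in *. split; [exact I|]. lia.
  - intros u v Hu _ Ha. unfold adj in Ha. unfold P, box. lia.
  - intros u v Ha. unfold adj in Ha. unfold m. lia.
  - intros v [Bv Hv]. assert (Mv : Y <= m v) by (unfold box, m in *; lia).
    apply (gap_count 3 N); auto; [lia|].
    set (M := m v) in *. clearbody M. clear v Bv Hv.
    set (Q := fun u : vtx => P u /\ m u - R <= M - R).
    assert (FBx : forall i0 i1 j0 j1, Fin (fun v : Z * Z => i0 <= fst v <= i1 /\ j0 <= snd v <= j1)).
    { intros. apply (Fin_prod (fun x => i0 <= x <= i1) (fun y => j0 <= y <= j1)); apply Fin_interval. }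
    assert (Bd : forall xl xr yb, xl <= xr + 1 -> yb <= Y + 1 -> forall (W S : Prop),
      (forall u, Q u -> (snd u = Y /\ xl <= fst u <= xr) \/ (fst u = A /\ yb <= snd u <= Y) \/
         (fst u = - A1 /\ yb <= snd u <= Y /\ W) \/ (snd u = - A2 /\ xl <= fst u <= xr /\ S)) ->
      card Q <= (xr - xl + 1) + (Y - yb + 1) + ((Y - yb + 1) + (xr - xl + 1)) /\
      (~ S -> card Q <= (xr - xl + 1) + (Y - yb + 1) + (Y - yb + 1)) /\
      (~ S -> ~ W -> card Q <= (xr - xl + 1) + (Y - yb + 1))).
    { intros xl xr yb H1 H2 W S H.
      assert (C1 := card_box xl xr Y Y ltac:(lia) ltac:(lia)). assert (C2 := card_box A A yb Y ltac:(lia) ltac:(lia)).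
      assert (C3 := card_box (- A1) (- A1) yb Y ltac:(lia) ltac:(lia)). assert (C4 := card_box xl xr (- A2) (- A2) ltac:(lia) ltac:(lia)).
      assert (O1 := card_or _ _ (FBx xl xr Y Y) (FBx A A yb Y)).
      assert (O2 := card_or _ _ (FBx (- A1) (- A1) yb Y) (FBx xl xr (- A2) (- A2))).
      assert (O3 := card_or _ _ (Fin_or _ _ (FBx xl xr Y Y) (FBx A A yb Y)) (Fin_or _ _ (FBx (- A1) (- A1) yb Y) (FBx xl xr (- A2) (- A2)))).
      assert (O4 := card_or _ _ (Fin_or _ _ (FBx xl xr Y Y) (FBx A A yb Y)) (FBx (- A1) (- A1) yb Y)).
      cbv beta in *. split; [|split].
      - etransitivity; [|etransitivity; [exact O3|lia]]. apply card_mono; [repeat apply Fin_or; apply FBx|].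
        intros u Hu. apply H in Hu. lia.
      - intros NS. etransitivity; [|etransitivity; [exact O4|lia]]. apply card_mono; [repeat apply Fin_or; apply FBx|].
        intros u Hu. apply H in Hu. destruct Hu as [Hu|[Hu|[Hu|(_ & _ & Hu)]]]; [lia|lia|lia|contradiction].
      - intros NS NW. etransitivity; [|etransitivity; [exact O1|lia]]. apply card_mono; [repeat apply Fin_or; apply FBx|].
        intros u Hu. apply H in Hu. destruct Hu as [Hu|[Hu|[(_ & _ & Hu)|(_ & _ & Hu)]]]; [lia|lia|contradiction|contradiction]. }
    destruct (Z.lt_ge_cases M A) as [Q1|Q1]; [|destruct (Z.lt_ge_cases M A1) as [Q2|Q2]; [|destruct (Z.lt_ge_cases M A2) as [Q3|Q3]]].
    + destruct (Bd (- M) M (Y + 1) ltac:(lia) ltac:(lia) False False) as (_ & _ & C).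
      { intros u [[Bu Hu] Mu]. unfold box, m in *. lia. }
      specialize (C ltac:(tauto) ltac:(tauto)). nia.
    + destruct (Bd (- M) A (- M) ltac:(lia) ltac:(lia) False False) as (_ & _ & C).
      { intros u [[Bu Hu] Mu]. unfold box, m in *. lia. }
      specialize (C ltac:(tauto) ltac:(tauto)). nia.
    + destruct (Bd (- A1) A (- M) ltac:(lia) ltac:(lia) True False) as (_ & C & _).
      { intros u [[Bu Hu] Mu]. unfold box, m in *. lia. }
      specialize (C ltac:(tauto)). nia.
    + destruct (Bd (- A1) A (- A2) ltac:(lia) ltac:(lia) True True) as (C & _ & _).
      { intros u [[Bu Hu] Mu]. unfold box, m in *. lia. }
      nia.
Qed.

Lemma wins_infty_pow G C q B0 :
  container_wins_from G q g_infty B0 -> container_wins_from G q (g_pow C) B0.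
Proof.
  intros (sigma & W). exists sigma. intros B E L. apply W; auto.
  intros t Ht. destruct (L t Ht) as (H1 & H2 & _). split; auto. split; simpl; auto.
Qed.

Open Scope R_scope.

Theorem theorem1 : forall G : Graph,
  exists C0 : R, 0 < C0 /\
    forall C : R, C > C0 ->
      forall q : R, in_qset G (g_pow C) q <-> in_qset G g_infty q.
Proof.
  (* Each of the four fronts of the strong grid adds at most [KC * w6 w] cells per turn. *)
  intros G. exists (IZR (4 * KC)). split; [apply IZR_lt; unfold KC; lia|].
  intros C HC q. split; intros [Hq W]; split; auto; intros B0 HF HV; [|apply wins_infty_pow; auto].
  destruct G.
  - destruct (Rlt_le_dec 1 q) as [L|L]; [apply eighth_container; auto|].
    exfalso. apply (eighth_spreader C q); auto.
    + apply Rle_lt_trans with (IZR (4 * KC)); [apply IZR_le; unfold KC; lia|auto].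
    + apply W.
      * exists [(0, 0)%Z]. intros v ->. simpl; auto.
      * intros v ->. simpl. lia.
  - destruct (Rlt_le_dec 3 q) as [L|L]; [apply king_container; auto|].
    exfalso. apply (king_spreader C q); auto. apply W; [|simpl; auto].
    apply (Fin_prod (fun x => -1 <= x <= 1)%Z (fun y => -1 <= y <= 1)%Z); apply Fin_interval.
Qed.
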